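(* Let $n\ge 1$ and let $\Omega\subset\mathbb R^{n+1}$ be a domain with nonempty $C^2$ boundary which is weakly mean convex, i.e. $H(y)\ge 0$ for all $y\in\partial\Omega$. Let $p>1$. Then for every $f\in C_0^\infty(\Omega)$, $$\int_\Omega |\nabla f(x)|^p\,dx\ \ge\ \left(\frac{p-1}{p}\right)^p\int_\Omega \frac{|f(x)|^p}{\delta(x)^p}\,dx ,$$ and the constant $\left(\frac{p-1}{p}\right)^p$ is the best (largest possible) constant for which this inequality holds for all $f\in C_0^\infty(\Omega)$. Moreover, equality cannot be achieved by a non-zero function $f$.
   Context: A domain is an open connected subset of Euclidean space; its boundary is $C^2$ if near each boundary point the domain is, after a rotation, the region on one side of the graph of a $C^2$ function. $\delta(x)=\inf_{y\in\mathbb R^{n+1}\setminus\Omega}|x-y|$. For $y\in\partial\Omega$, $\kappa_1(y),\dots,\kappa_n(y)$ are the principal curvatures of $\partial\Omega$ at $y$ with respect to the outward unit normal, with the sign convention that they all equal $1$ when $\Omega$ is the unit ball, and $H(y)=\sum_{i=1}^n\kappa_i(y)$ is the mean curvature (so the unit sphere has $H=n$). $C_0^\infty(\Omega)$ denotes smooth functions with compact support in $\Omega$. *)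

(* Defs.v *)
From HB Require Import structures.
From mathcomp Require Import all_boot all_order all_algebra.
From mathcomp Require Import all_classical all_reals all_analysis.
From mathcomp Require Import measurable_realfun.

Set Implicit Arguments.
Unset Strict Implicit.
Unset Printing Implicit Defensive.

Import Order.TTheory GRing.Theory Num.Theory.
Import numFieldNormedType.Exports.

Local Open Scope classical_set_scope.
Local Open Scope ring_scope.

Section borel_matrix.
Context {R : realType} {m n : nat}.

HB.instance Definition _ :=
  @isMeasurable.Build (sigma_display (@open 'M[R]_(m, n))) 'M[R]_(m, n)
    <<s @open 'M[R]_(m, n) >> (@sigma_algebra0 _ setT _)
    (@sigma_algebraC _ _) (@sigma_algebra_bigcup _ setT _).

Lemma open_measurable_mx (U : set 'M[R]_(m, n)) : open U -> measurable U.
Proof. by move=> oU; exact: sub_sigma_algebra. Qed.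

Lemma measurable_coord (i : 'I_m) (j : 'I_n) :
  measurable_fun setT (fun A : 'M[R]_(m, n) => A i j : measurableTypeR R).
Proof.
apply: (measurability _ (RGenOpens.measurableE R)).
move=> _ [_ [a [b ->] <-]]; rewrite setTI; apply: open_measurable_mx.
have /continuousP := @coord_continuous R m n i j; apply.
exact: interval_open.
Qed.

(* Open sets are countable unions of boxes with rational centres and radii, so
   it is enough to check measurability coordinatewise. *)
Lemma measurable_fun_mxP d (T : measurableType d) (f : T -> 'M[R]_(m, n)) :
  (forall i j, measurable_fun setT (fun t => f t i j : measurableTypeR R)) ->
  measurable_fun setT f.
Proof.
move=> mf.
apply: (@measurability _ _ T 'M[R]_(m, n) setT f open) => //.
move=> _ [U oU <-]; rewrite setTI.
pose B (q : 'M[rat]_(m, n) * nat) : set 'M[R]_(m, n) :=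
  [set A | forall i j, `|ratr (q.1 i j) - A i j| < q.2.+1%:R^-1].
pose D := [set q | B q `<=` U].
have -> : f @^-1` U = \bigcup_q (f @^-1` (if q \in D then B q else set0)).
  apply/seteqP; split=> [t Uft|t [q _]]; last first.
    by rewrite /=; case: ifPn => // /set_mem; exact.
  have /nbhs_ballP[e /= e0 eU] : nbhs (f t) U by apply: open_nbhs_nbhs.
  have [k _ ke] : exists2 k : nat, True & k.+1%:R^-1 < e / 2.
    have [k /= kP] := ltr_add_invr (divr_gt0 e0 (ltr0n R 2)).
    by exists k => //; rewrite -[X in X < _]add0r.
  have /choice[q qP] : forall ij : 'I_m * 'I_n, exists r : rat,
      `|ratr r - f t ij.1 ij.2| < k.+1%:R^-1 :> R.
    move=> ij; have lt_k : f t ij.1 ij.2 - k.+1%:R^-1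
                         < f t ij.1 ij.2 + k.+1%:R^-1.
      by rewrite ltrD2l gt0_cp// invr_gt0.
    have [r] := rat_in_itvoo lt_k.
    by rewrite in_itv/= => rP; exists r; rewrite ltr_distl.
  exists (\matrix_(i, j) q (i, j), k) => //=.
  rewrite ifT; first by move=> i j; rewrite mxE; exact: (qP (i, j)).
  apply/mem_set => A BA; apply: eU.
  split=> // i j; rewrite /ball /= -(subrKA (ratr (q (i, j)))).
  rewrite (le_lt_trans (ler_normD _ _))// (splitr e) ltrD// (lt_trans _ ke)//.
    by rewrite distrC; exact: (qP (i, j)).
  by have /= := BA i j; rewrite mxE.
apply: countable_bigcupT_measurable => // q.
case: ifPn => _; last by rewrite preimage_set0.
rewrite (_ : _ @^-1` _ = \bigcap_(ij in [set: 'I_m * 'I_n])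
   ((fun t => f t ij.1 ij.2 : measurableTypeR R) @^-1`
      ball (ratr (q.1 ij.1 ij.2) : R) (q.2.+1%:R^-1))); last first.
  by apply/seteqP; split=> [t Bt [i j] _|t Bt i j];
    [exact: Bt|exact: (Bt (i, j))].
apply: fin_bigcap_measurable => // -[i j] _.
rewrite -[X in measurable X]setTI; apply: mf => //; exact: measurable_ball.
Qed.

End borel_matrix.

Section lebesgue_succ.
Context {R : realType} {n : nat}.

Definition rV_cons (p : measurableTypeR R * 'rV[R]_n) : 'rV[R]_n.+1 :=
  \row_i if unlift ord0 i is Some j then p.2 ord0 j else p.1.

Definition rV_uncons (x : 'rV[R]_n.+1) : measurableTypeR R * 'rV[R]_n :=
  (x ord0 ord0, \row_j x ord0 (lift ord0 j)).

Lemma rV_consK : cancel rV_cons rV_uncons.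
Proof.
move=> [a v]; congr pair; first by rewrite mxE unlift_none.
by apply/rowP => j; rewrite !mxE liftK.
Qed.

Lemma measurable_rV_cons : measurable_fun setT rV_cons.
Proof.
apply: measurable_fun_mxP => i j.
under eq_fun do rewrite mxE.
case: (unliftP ord0 j) => [k _|_]; last exact: measurable_fst.
apply: (@measurableT_comp _ _ _ _ _ _
  (fun v : 'rV[R]_n => v ord0 k : measurableTypeR R)).
  exact: measurable_coord.
exact: measurable_snd.
Qed.

Lemma measurable_rV_uncons : measurable_fun setT rV_uncons.
Proof.
apply: measurable_fun_pair; first exact: measurable_coord.
apply: measurable_fun_mxP => i j.
by under eq_fun do rewrite mxE; exact: measurable_coord.
Qed.

Variable mu : {sigma_finite_measure set 'rV[R]_n -> \bar R}.

Definition lebesgue_cons : set 'rV[R]_n.+1 -> \bar R :=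
  pushforward (@lebesgue_measure R \x mu)%E rV_cons.

HB.instance Definition _ := Measure.copy lebesgue_cons
  (measure_function_pushforward__canonical__measure_function_Measure
     _ measurable_rV_cons).

Let lebesgue_cons_sigma_finite : sigma_finite setT lebesgue_cons.
Proof.
have /sigma_finiteP[F [FT ndF Foo]] := sigma_finiteT (@lebesgue_measure R).
have /sigma_finiteP[G [GT ndG Goo]] := sigma_finiteT mu.
exists (fun k => rV_uncons @^-1` (F k `*` G k)).
  rewrite -preimage_bigcup -[LHS](preimage_setT rV_uncons); congr (_ @^-1` _).
  rewrite -setXTT FT GT; apply/seteqP; split=> -[x y].
    move=> [/= [k _ Fkx] [l _ Gly]]; exists (maxn k l) => //; split.
    - by move: x Fkx; exact/subsetPset/ndF/leq_maxl.
    - by move: y Gly; exact/subsetPset/ndG/leq_maxr.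
  by move=> [k _ []/= ? ?]; split; exists k.
move=> k; have [mFk Fkoo] := Foo k; have [mGk Gkoo] := Goo k; split.
  rewrite -[X in measurable X]setTI; apply: measurable_rV_uncons => //.
  exact: measurableX.
rewrite /lebesgue_cons /pushforward -comp_preimage.
rewrite (_ : rV_uncons \o rV_cons = id); last exact/funext/rV_consK.
by rewrite product_measure1E// lte_mul_pinfty// ge0_fin_numE.
Qed.

HB.instance Definition _ :=
  Measure_isSigmaFinite.Build _ _ _ lebesgue_cons lebesgue_cons_sigma_finite.

End lebesgue_succ.

(* The [n]-fold product of the one-dimensional Lebesgue measure. *)
Fixpoint lebesgue_rV {R : realType} (n : nat) :
    {sigma_finite_measure set 'rV[R]_n -> \bar R} :=
  match n with
  | 0 => \d_(0 : 'rV[R]_0)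
  | n'.+1 => lebesgue_cons (lebesgue_rV n')
  end.

Section euclidean.
Context {R : realType}.

(* The library norm on ['rV[R]_n] is the sup norm: it induces the same
   topology, but lengths must be measured with [enorm]. *)
Definition enorm {n} (x : 'rV[R]_n) : R := Num.sqrt (\sum_i x 0 i ^+ 2).

Definition partial {n} (i : 'I_n) (f : 'rV[R]_n -> R) (x : 'rV[R]_n) : R :=
  'D_(delta_mx 0 i) f x.

Definition gradient {n} (f : 'rV[R]_n -> R) (x : 'rV[R]_n) : 'rV[R]_n :=
  \row_i partial i f x.

Definition hessian {n} (f : 'rV[R]_n -> R) (x : 'rV[R]_n) : 'M[R]_n :=
  \matrix_(i, j) partial i (partial j f) x.

Fixpoint Ck {n} (k : nat) (U : set 'rV[R]_n) (f : 'rV[R]_n -> R) : Prop :=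
  (forall x, U x -> {for x, continuous f}) /\
  match k with
  | 0 => True
  | k'.+1 => forall i : 'I_n,
      (forall x, U x -> derivable f x (delta_mx 0 i)) /\ Ck k' U (partial i f)
  end.

(* [C_0^oo(Omega)], its elements being extended by zero to the whole space. *)
Definition test_function {n} (Omega : set 'rV[R]_n) (f : 'rV[R]_n -> R) :=
  [/\ forall k, Ck k setT f,
      compact (closure [set x | f x != 0]) &
      closure [set x | f x != 0] `<=` Omega].

Definition boundary {n} (Omega : set 'rV[R]_n) : set 'rV[R]_n :=
  closure Omega `\` Omega°.

Definition dist_compl {n} (Omega : set 'rV[R]_n) (x : 'rV[R]_n) : R :=
  inf [set enorm (x - y) | y in ~` Omega].

End euclidean.

Section boundary_geometry.
Context {R : realType} {n : nat}.
Implicit Types (Omega : set 'rV[R]_n.+1) (y : 'rV[R]_n.+1) (Q : 'M[R]_n.+1).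

Definition rotation Q := Q *m Q^T = 1%:M /\ \det Q = 1.

(* In the rotated coordinates [z = (x - y) *m Q], the set [Omega] is, near [y],
   the region above the graph of [phi], a [C^2] function of the first [n]
   coordinates [col' ord_max z]. *)
Definition local_graph Omega y Q (phi : 'rV[R]_n -> R) :=
  rotation Q /\ exists2 r : R, 0 < r &
    Ck 2 [set w | enorm w < r] phi /\
    forall x, enorm (x - y) < r ->
      let z := (x - y) *m Q in
      Omega x <-> phi (col' ord_max z) < z 0 ord_max.

Definition C2_boundary Omega :=
  forall y, boundary Omega y -> exists Q phi, local_graph Omega y Q phi.

(* Principal curvatures, listed with multiplicity.  When the tangent
   hyperplane at [y] is [z 0 ord_max = 0], so that the outward unit normal is
   the opposite of the last basis vector, the first fundamental form of the
   graph at [y] is the identity and the second one is the Hessian of [phi],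
   whose eigenvalues are then the principal curvatures.  Since [Omega] lies above the
   graph, they are nonnegative for convex domains, and equal to [1] for the unit
   ball, where [phi w = 1 - sqrt (1 - enorm w ^+ 2)]. *)
Definition principal_curvatures Omega y (kappa : 'I_n -> R) :=
  exists Q phi, [/\ local_graph Omega y Q phi, gradient phi 0 = 0 &
    char_poly (hessian phi 0) = \prod_i ('X - (kappa i)%:P)].

Definition mean_curvature Omega y (H : R) :=
  exists2 kappa, principal_curvatures Omega y kappa & H = \sum_i kappa i.

(* A [C^2] boundary has exactly one mean curvature at each of its points. *)
Definition weakly_mean_convex Omega :=
  forall y, boundary Omega y -> exists2 H, mean_curvature Omega y H & 0 <= H.

End boundary_geometry.

(* Main.v *)
(* The inequality follows from the superharmonicity of the distance [delta] to
   the complement, used in integrated form against [|f| ^ p * delta ^ (1 - p)],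
   together with [|grad delta| = 1] and the tangent inequality for [t ^ p] at
   [(p - 1) / p * |f| / delta]. Superharmonicity holds pointwise in the following
   weak sense: if [y] is a nearest boundary point of [x], and the boundary is the
   graph of [phi] over its tangent hyperplane at [y], then the height above that
   graph is an upper barrier for [delta], equal to it at [x], with Laplacian
   [- H y <= 0] there.  Since [delta] is semiconcave, its second differences are
   bounded above, and dominated convergence turns this into an integral
   inequality.  Working with difference quotients throughout, neither the
   differentiability of [delta] nor an integration by parts is needed: the
   forward and backward quotients of a semiconcave function agree in the limit
   in [L^1].
   Equality would force [|grad f| = (p - 1) / p * |f| / delta] everywhere, which
   fails at a maximum point of [|f|].
   For optimality, a neighbourhood of a boundary point looks like a half-space at
   small scales, where smooth truncations of [t ^ ((p - 1) / p)], [t] being the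
   height above the tangent hyperplane, are almost extremal. *)

Require Import Defs.
From HB Require Import structures.
From mathcomp Require Import all_boot all_order all_algebra.
From mathcomp Require Import all_classical all_reals all_analysis.
From mathcomp Require Import ring lra measurable_realfun.

Set Implicit Arguments.
Unset Strict Implicit.
Unset Printing Implicit Defensive.

Import Order.TTheory GRing.Theory Num.Theory.
Import numFieldNormedType.Exports.

Local Open Scope classical_set_scope.
Local Open Scope ring_scope.

(** * The Lebesgue measure on row vectors *)

(** Formally, [- laplacian delta >= 0] tested against [|f|^p * delta^(1 - p)] gives [(p - 1) * int
    |f|^p / delta^p <= p * int |f|^(p - 1) * |grad f| / delta^(p - 1)]. The slope
    [alpha = (p - 1) / p] of the tangent point [alpha * |f| / delta] is the one with
    [p * alpha = p - 1]: the tangent inequality then contains exactly this difference of integrals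
    and leaves [alpha^p]. The delicate point is uniformity: the barrier bounds second differences of
    [delta] only for steps below a threshold that depends on the point, and only from above. Hence
    only their positive part is passed to the limit. For optimality, [t^alpha] turns both densities
    into multiples of [1 / t]. Heights from [2 * a] to [b] then carry the mass [ln (b / (2 * a))],
    whereas truncating over one doubling of scale at each end costs a multiple of [ln 2], whatever
    the length of the range. A long logarithmic range makes the truncations negligible. The layer is
    cut laterally in the original coordinates, so that Fubini along one axis transversal to the
    boundary computes its integral. *)

Section lebesgue_affine.
Context {R : realType}.
Implicit Types g : measurableTypeR R -> \bar R.
Local Notation mu := (@lebesgue_measure R).

Let affine (a b : R) (x : measurableTypeR R) : measurableTypeR R := a * x + b.

Let measurable_affine (a b : R) : measurable_fun setT (affine a b).
Proof. by apply: measurable_funD => //; exact: measurable_funM. Qed.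

(** Lebesgue measure is the only measure giving each []u, v]] its length, so the scaled pushforward
    need only be evaluated on such intervals. *)
Let lebesgue_pushforward_affine_gt0 (a b : R) (X : set R) : 0 < a ->
  measurable X -> mu X = (a%:E * pushforward mu (affine a b) X)%E.
Proof.
move=> a0 mX.
pose m := mscale (NngNum (ltW a0))
  (measure_function_pushforward__canonical__measure_function_Measure mu
     (measurable_affine a b)).
have := @lebesgue_measure_unique R m; rewrite /m /mscale/=; apply => //.
move=> _ [[u v] /= _ <-].
rewrite -[RHS]/(a%:E * mu (affine a b @^-1` `]u, v]%classic))%E.
rewrite (_ : affine a b @^-1` _ = `](u - b) / a, (v - b) / a]%classic).
  rewrite !lebesgue_measure_itv/= !lte_fin ltr_pM2r ?invr_gt0// ltrD2r.
  case: ifP => _; last by rewrite mule0.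
  rewrite -!EFinB -EFinM; congr EFin; field; exact: lt0r_neq0.
apply/seteqP; split => x; rewrite /= /affine !in_itv/= ltr_pdivrMr//;
  by rewrite ler_pdivlMr// ltrBlDr lerBrDr (mulrC x).
Qed.

Let lebesgue_pushforward_affine (a b : R) (X : set R) : a != 0 ->
  measurable X -> mu X = (`|a|%:E * pushforward mu (affine a b) X)%E.
Proof.
move=> a0 mX; have [a_gt0|a_lt0|/eqP] := ltgtP 0 a; last by rewrite eq_sym (negPf a0).
  by rewrite gtr0_norm//; exact: lebesgue_pushforward_affine_gt0.
rewrite ltr0_norm//.
have mNX : measurable ((affine a b) @^-1` X).
  by have := measurable_affine a b measurableT mX; rewrite setTI.
rewrite (@lebesgue_pushforward_affine_gt0 (- a) b) ?oppr_gt0//.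
congr (_ * _)%E; rewrite [in RHS]/pushforward -(lebesgue_measureN mNX).
rewrite /pushforward; congr (mu _).
by apply/seteqP; split => x /=; rewrite /affine mulrN mulNr.
Qed.

Lemma ge0_integral_affine (a b : R) g : a != 0 ->
  measurable_fun setT g -> (forall x, 0 <= g x)%E ->
  (\int[mu]_x g x = `|a|%:E * \int[mu]_x g (a * x + b)%R)%E.
Proof.
move=> a0 mg g0.
have -> : (\int[mu]_x g (a * x + b)%R =
           \int[pushforward mu (affine a b)]_x g x)%E.
  rewrite ge0_integral_pushforward//; exact: measurable_affine.
have a_ge0 : 0 <= `|a| by [].
rewrite -(@ge0_integral_mscale _ _ _ _ _ measurableT (NngNum a_ge0))//.
apply: eq_measure_integral => X mX _.
exact: lebesgue_pushforward_affine.
Qed.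

End lebesgue_affine.

Section lebesgue_rV.
Context {R : realType}.
Local Notation mu := (@lebesgue_rV R).

Lemma ge0_integral_rV_cons n (g : 'rV[R]_n.+1 -> \bar R) :
  measurable_fun setT g -> (forall x, 0 <= g x)%E ->
  (\int[mu n.+1]_x g x =
   \int[@lebesgue_measure R]_x \int[mu n]_v g (rV_cons (x, v)))%E.
Proof.
move=> mg g0; rewrite [LHS]ge0_integral_pushforward//; last exact: measurable_rV_cons.
rewrite fubini_tonelli1//=.
by apply: measurableT_comp => //; exact: measurable_rV_cons.
Qed.

Lemma rV_consD n (x y : R) (u v : 'rV[R]_n) :
  rV_cons (x, u) + rV_cons (y, v) = rV_cons (x + y, u + v).
Proof.
by apply/rowP => i; rewrite !mxE; case: unliftP => [j|] _ //=; rewrite mxE.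
Qed.

Lemma rV_unconsK n : cancel (@rV_uncons R n) (@rV_cons R n).
Proof.
move=> v; apply/rowP => i; rewrite !mxE /rV_uncons/=.
by case: unliftP => [j|] -> //=; rewrite mxE.
Qed.

Lemma measurable_rV_consl n (x : R) :
  measurable_fun setT (fun v : 'rV[R]_n => rV_cons (x : measurableTypeR R, v)).
Proof.
apply: (measurableT_comp measurable_rV_cons).
exact: measurable_fun_pair.
Qed.

Lemma measurable_rV_addr n (v : 'rV[R]_n) : measurable_fun setT (fun x : 'rV[R]_n => x + v).
Proof.
apply: measurable_fun_mxP => i j.
under eq_fun do rewrite mxE.
apply: measurable_funD => //; exact: measurable_coord.
Qed.

Lemma ge0_integral_translate n (v : 'rV[R]_n) (g : 'rV[R]_n -> \bar R) :
  measurable_fun setT g -> (forall x, 0 <= g x)%E ->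
  (\int[mu n]_x g (x + v)%R = \int[mu n]_x g x)%E.
Proof.
elim: n v g => [|n IHn] v g mg g0.
  by apply: eq_integral => x _; congr g; rewrite (thinmx0 v) addr0.
rewrite !ge0_integral_rV_cons//; last first.
  apply: (measurableT_comp mg); exact: measurable_rV_addr.
rewrite [RHS](@ge0_integral_affine _ 1 (rV_uncons v).1)//; last first.
- by move=> x; apply: integral_ge0.
- rewrite -/(fubini_F (mu n) (fun z => g (rV_cons z))).
  apply: measurable_fun_fubini_tonelli_F => //.
  by apply: (measurableT_comp mg); exact: measurable_rV_cons.
rewrite normr1 mul1e; apply: eq_integral => x _.
rewrite mul1r -[RHS](IHn (rV_uncons v).2)//; last first.
  by apply: (measurableT_comp mg); exact: measurable_rV_consl.
by apply: eq_integral => w _; rewrite -rV_consD -{1}(rV_unconsK v).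
Qed.

End lebesgue_rV.

(** * Fubini along an arbitrary coordinate *)

Section insertion.
Context {R : realType}.
Local Notation mu := (@lebesgue_rV R).

(** [rV_cons] singles out the first coordinate. Here it may be any one: the last for heights over
    the graph, one transversal to the boundary for the slab integrals. *)
Definition rV_insert n (i : 'I_n.+1) (s : R) (w : 'rV[R]_n) : 'rV[R]_n.+1 :=
  \row_j if unlift i j is Some k then w ord0 k else s.

Lemma rV_insert_at n (i : 'I_n.+1) s (w : 'rV[R]_n) : rV_insert i s w 0 i = s.
Proof. by rewrite mxE unlift_none. Qed.

Lemma rV_insert_lift n (i : 'I_n.+1) s (w : 'rV[R]_n) k :
  rV_insert i s w 0 (lift i k) = w 0 k.
Proof. by rewrite mxE liftK. Qed.

Lemma measurable_rV_insert n (i : 'I_n.+1) :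
  measurable_fun setT
    (fun z : measurableTypeR R * 'rV[R]_n => rV_insert i z.1 z.2).
Proof.
apply: measurable_fun_mxP => i0 j.
under eq_fun do rewrite mxE.
case: (unliftP i j) => [k _|_]; last exact: measurable_fst.
by apply: (measurableT_comp (measurable_coord ord0 k)); exact: measurable_snd.
Qed.

Lemma rV_insert_cons n (j : 'I_n.+1) s x (w : 'rV[R]_n) :
  rV_insert (lift ord0 j) s (rV_cons (x, w)) = rV_cons (x, rV_insert j s w).
Proof.
apply/rowP => k; have [->|] := eqVneq k (lift ord0 j).
  by rewrite rV_insert_at mxE liftK rV_insert_at.
have [m -> _|->] := unliftP (lift ord0 j) k; last by rewrite eqxx.
rewrite rV_insert_lift; case: (unliftP ord0 m) => [l ->|->].
  rewrite mxE liftK mxE.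
  have -> : lift (lift ord0 j) (lift ord0 l) = lift ord0 (lift j l).
    by apply/val_inj; rewrite /= /bump !leq0n /= !add1n ltnS; case: (_ <= _)%N.
  by rewrite liftK/= rV_insert_lift.
rewrite mxE unlift_none.
have -> : lift (lift ord0 j) (@ord0 n) = ord0 by exact/val_inj.
by rewrite mxE unlift_none.
Qed.

(** For the first coordinate this is Tonelli. For another one, the first coordinate is peeled off,
    the induction hypothesis acts on the tail, and [rV_insert_cons] commutes the two insertions. *)
Lemma ge0_integral_rV_insert n (i : 'I_n.+1) (g : 'rV[R]_n.+1 -> \bar R) :
  measurable_fun setT g -> (forall x, 0 <= g x)%E ->
  (\int[mu n.+1]_x g x =
   \int[mu n]_w \int[@lebesgue_measure R]_s g (rV_insert i s w))%E.
Proof.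
elim: n i g => [|n IHn] i g mg g0; rewrite ge0_integral_rV_cons//.
  rewrite (ord1 i) (fubini_tonelli (fun z => g (rV_cons z)))//; last first.
    by apply: measurableT_comp => //; exact: measurable_rV_cons.
case: (unliftP ord0 i) => [j ->|->]; last first.
  rewrite (fubini_tonelli (fun z => g (rV_cons z)))//.
  by apply: measurableT_comp => //; exact: measurable_rV_cons.
transitivity (\int[@lebesgue_measure R]_x
   \int[mu n]_w \int[@lebesgue_measure R]_s
      g (rV_cons (x, rV_insert j s w)))%E.
  apply: eq_integral => x _; rewrite (IHn j (fun v => g (rV_cons (x, v))))//.
  by apply: measurableT_comp => //; exact: measurable_rV_consl.
pose G v := (\int[@lebesgue_measure R]_s g (rV_insert (lift ord0 j) s v))%E.
have mG : measurable_fun setT G.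
  apply: (@measurable_fun_fubini_tonelli_G _ _ _ _ _ (@lebesgue_measure R)
    (fun z => g (rV_insert (lift ord0 j) z.1 z.2))) => //.
  by apply: measurableT_comp => //; exact: measurable_rV_insert.
have G0 v : (0 <= G v)%E by exact: integral_ge0.
rewrite -[RHS]/(\int[mu n.+1]_v G v)%E (ge0_integral_rV_cons mG G0).
apply: eq_integral => x _; apply: eq_integral => w _.
by apply: eq_integral => s _; rewrite rV_insert_cons.
Qed.

End insertion.

(** * Cubes, their volume, and compact sets *)

Section cubes.
Context {R : realType}.
Local Notation mu := (@lebesgue_rV R).

Definition cube n (c : 'rV[R]_n) (r : R) : set 'rV[R]_n :=
  [set x | forall j, `|x 0 j - c 0 j| <= r].

Lemma measurable_cube n (c : 'rV[R]_n) r : measurable (cube c r).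
Proof.
rewrite (_ : cube c r = \bigcap_(j in [set: 'I_n])
   ((fun x : 'rV[R]_n => x 0 j : measurableTypeR R) @^-1`
      `[c 0 j - r, c 0 j + r]%classic)); last first.
  by apply/seteqP; split=> [x cx j _|x cx j]; have := cx j;
    rewrite /= in_itv/= ler_distl //; apply.
apply: fin_bigcap_measurable => // j _.
rewrite -[X in measurable X]setTI; exact: measurable_coord.
Qed.

Lemma lebesgue_cube n (c : 'rV[R]_n) r : 0 <= r ->
  mu n (cube c r) = ((2 * r) ^+ n)%:E.
Proof.
move=> r0; elim: n c => [|n IHn] c.
  by rewrite /= diracE mem_set// => -[].
rewrite [LHS]/= /lebesgue_cons /pushforward.
rewrite (_ : _ @^-1` _ = (`[c 0 ord0 - r, c 0 ord0 + r]%classic : set (measurableTypeR R)) `*`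
   cube (rV_uncons c).2 r); last first.
  apply/seteqP; split=> -[x v] /=.
    move=> h; split.
      by have := h ord0; rewrite mxE unlift_none/= in_itv/= ler_distl.
    by move=> j; have := h (lift ord0 j); rewrite !mxE liftK/=.
  move=> [xc vc] j; rewrite mxE; case: unliftP => [k ->|->]/=.
    by have := vc k; rewrite mxE.
  by move: xc; rewrite in_itv/= ler_distl.
rewrite product_measure1E ?IHn//; last exact: measurable_cube.
transitivity (lebesgue_measure `[(c 0 ord0 - r)%R, (c 0 ord0 + r)%R]%classic *
  ((2 * r) ^+ n)%:E)%E; first by [].
rewrite lebesgue_measure_itv/= lte_fin.
case: ifPn => [_|].
  by rewrite -EFinB -EFinM exprS; congr (_ * _)%:E; ring.
rewrite -leNgt => h; have -> : r = 0 by apply/eqP; rewrite eq_le r0 andbT; lra.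
by rewrite mulr0 exprS mul0r mul0e.
Qed.

Lemma mx_norm_coord n (x : 'rV[R]_n) j : `|x 0 j| <= `|x|.
Proof.
rewrite [leRHS]/Num.Def.normr/= mx_normrE.
exact: (@le_bigmax _ _ _ 0 (fun i : 'I_1 * 'I_n => `|x i.1 i.2|) (0, j)).
Qed.

Lemma compact_sub_cube n (K : set 'rV[R]_n) : compact K ->
  exists2 r, 0 <= r & K `<=` cube 0 r.
Proof.
move=> /compact_bounded [M [Mr MK]]; exists (`|M| + 1); first by rewrite addr_ge0.
move=> x Kx j; rewrite mxE subr0 (le_trans (mx_norm_coord x j))//.
by apply: (MK (`|M| + 1)) => //; rewrite (le_lt_trans (ler_norm _))// ltrDl.
Qed.

Lemma lebesgue_compact_lty n (K : set 'rV[R]_n) : compact K -> measurable K ->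
  (mu n K < +oo)%E.
Proof.
move=> /compact_sub_cube[r r0 Kr] mK.
apply: (@le_lt_trans _ _ (mu n (cube 0 r))).
  by apply: le_measure; rewrite ?inE//; exact: measurable_cube.
by rewrite lebesgue_cube// ltry.
Qed.

End cubes.

(** * Integration of continuous functions with compact support *)

Section compactly_supported.
Context {R : realType} {n : nat}.
Local Notation mu := (@lebesgue_rV R n).
Implicit Types (f g : 'rV[R]_n -> R) (r M : R).

Lemma continuous_measurable_rV f : continuous f ->
  measurable_fun setT (f : 'rV[R]_n -> measurableTypeR R).
Proof.
move=> cf; apply: (measurability _ (RGenOpens.measurableE R)).
move=> _ [_ [a [b ->] <-]]; rewrite setTI; apply: open_measurable_mx.
by move/continuousP : cf; apply; exact: interval_open.
Qed.

Lemma cube_compact (c : 'rV[R]_n) r : compact (cube c r).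
Proof.
rewrite (_ : cube c r =
    [set v : 'rV[R]_n | forall j, `[c 0 j - r, c 0 j + r]%classic (v 0 j)]).
  apply: (@rV_compact _ _ (fun j => `[c 0 j - r, c 0 j + r]%classic)) => j.
  exact: segment_compact.
by apply/seteqP; split=> x /= xc j; have := xc j; rewrite in_itv/= ler_distl.
Qed.

Definition vanishes_off_cube r f := forall x, ~ cube 0 r x -> f x = 0.

(** The support is recorded by the radius of a cube: a cube common to all members of a sequence
    yields the dominating function of [Int_dominated_cvg0]. *)
Definition Cc f := continuous f /\ exists r, vanishes_off_cube r f.

Lemma sub_cube r r' : r <= r' -> cube (0 : 'rV[R]_n) r `<=` cube 0 r'.
Proof. by move=> rr x xr j; rewrite (le_trans (xr j)). Qed.

Lemma vanishes_off_cubeW r r' f :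
  r <= r' -> vanishes_off_cube r f -> vanishes_off_cube r' f.
Proof. by move=> rr vf x xr; apply: vf => /(sub_cube rr). Qed.

Lemma Cc_bounded f : Cc f -> exists2 M, 0 <= M & forall x, `|f x| <= M.
Proof.
move=> [cf [r vf]].
have /compact_bounded[M [Mr MP]] : compact (f @` cube 0 r).
  apply: continuous_compact; last exact: cube_compact.
  by apply: continuous_subspaceT.
exists (`|M| + 1); first by rewrite addr_ge0.
move=> x; have [xr|xr] := pselect (cube 0 r x); last by rewrite vf// normr0 addr_ge0.
by apply: (MP (`|M| + 1)); [rewrite (le_lt_trans (ler_norm _))// ltrDl|exists x].
Qed.

Lemma integrable_cube_cst r M : mu.-integrable setT
   (EFin \o (fun x => M * \1_(cube (0 : 'rV[R]_n) r) x)).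
Proof.
apply/integrableP; split.
  by apply/measurable_EFinP; apply: measurable_funM => //;
    apply: measurable_indic; exact: measurable_cube.
under eq_integral do rewrite /= normrM (@ger0_norm _ (\1_ _ _))// EFinM.
rewrite ge0_integralZl//; last first.
  by apply/measurable_EFinP; apply: measurable_indic; exact: measurable_cube.
rewrite integral_indic ?setIT//; last exact: measurable_cube.
rewrite lte_mul_pinfty// ?lee_fin//.
by apply: lebesgue_compact_lty; [exact: cube_compact|exact: measurable_cube].
Qed.

Lemma Cc_integrable f : Cc f -> mu.-integrable setT (EFin \o f).
Proof.
move=> Cf; have [M M0 MP] := Cc_bounded Cf; have [cf [r vf]] := Cf.
apply: (@le_integrable _ _ _ mu setT measurableT _
   (EFin \o (fun x => M * \1_(cube 0 r) x))); last exact: integrable_cube_cst.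
  by apply/measurable_EFinP; exact: continuous_measurable_rV.
move=> x _ /=; rewrite lee_fin normrM (ger0_norm M0) (@ger0_norm _ (\1_ _ _))//.
rewrite indicE; have [/set_mem xr|xr] := boolP (x \in cube 0 r).
  by rewrite mulr1.
by rewrite vf ?normr0 ?mulr0// => /mem_set; apply/negP.
Qed.

Lemma Cc0 : Cc (fun=> 0).
Proof. by split; [exact: cst_continuous|exists 0]. Qed.

Lemma CcD f g : Cc f -> Cc g -> Cc (fun x => f x + g x).
Proof.
move=> [cf [r vf]] [cg [s vg]]; split.
  by move=> x; exact: (continuousD (cf x) (cg x)).
exists (Num.max r s) => x xrs; rewrite (vanishes_off_cubeW _ vf xrs) ?le_max ?lexx//.
by rewrite (vanishes_off_cubeW _ vg xrs) ?le_max ?lexx ?orbT// addr0.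
Qed.

Lemma CcMr f g : Cc f -> continuous g -> Cc (fun x => f x * g x).
Proof.
move=> [cf [r vf]] cg; split.
  by move=> x; exact: (continuousM (cf x) (cg x)).
by exists r => x xr; rewrite vf// mul0r.
Qed.

Lemma CcMl f g : continuous g -> Cc f -> Cc (fun x => g x * f x).
Proof.
by move=> cg Cf; under eq_fun do rewrite mulrC; exact: CcMr.
Qed.

Lemma CcZ a f : Cc f -> Cc (fun x => a * f x).
Proof. by apply: CcMl; exact: cst_continuous. Qed.

Lemma CcN f : Cc f -> Cc (fun x => - f x).
Proof. by move=> Cf; under eq_fun do rewrite -mulN1r; exact: CcZ. Qed.

Lemma CcB f g : Cc f -> Cc g -> Cc (fun x => f x - g x).
Proof. by move=> Cf Cg; apply: CcD => //; exact: CcN. Qed.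

Lemma Cc_norm f : Cc f -> Cc (fun x => `|f x|).
Proof.
move=> [cf [r vf]]; split; first by move=> x; exact: (cvg_norm (cf x)).
by exists r => x xr; rewrite vf// normr0.
Qed.

Lemma continuous_sum (I : Type) (s : seq I) (F : I -> 'rV[R]_n -> R) :
  (forall i, continuous (F i)) -> continuous (fun x => \sum_(i <- s) F i x).
Proof.
move=> cF; elim: s => [|i s IHs] x.
  by under eq_fun do rewrite big_nil; exact: cst_continuous.
under eq_fun do rewrite big_cons.
exact: (continuousD (cF i x) (IHs x)).
Qed.

Lemma Cc_sum (I : Type) (s : seq I) (F : I -> 'rV[R]_n -> R) :
  (forall i, Cc (F i)) -> Cc (fun x => \sum_(i <- s) F i x).
Proof.
move=> CF; elim: s => [|i s IHs].
  by under eq_fun do rewrite big_nil; exact: Cc0.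
by under eq_fun do rewrite big_cons; exact: CcD.
Qed.

Lemma Cc_translate (v : 'rV[R]_n) f : Cc f -> Cc (fun x => f (x + v)).
Proof.
move=> [cf [r vf]]; split.
  move=> x; have cv : {for x, continuous (fun y : 'rV[R]_n => y + v)}.
    by apply: (@continuousD _ _ _ id (cst v)) => //; exact: cst_continuous.
  exact: (continuous_comp cv (cf (x + v))).
exists (r + `|v|) => x xr; apply: vf => xvr; apply: xr => j.
have := xvr j; rewrite !mxE !subr0 => h.
rewrite -(addrK (v 0 j) (x 0 j)) (le_trans (ler_normB _ _))//.
by rewrite lerD//; exact: mx_norm_coord.
Qed.

Definition Int f : R := \int[mu]_x f x.

Lemma IntD f g : Cc f -> Cc g -> Int (fun x => f x + g x) = Int f + Int g.
Proof. by move=> Cf Cg; rewrite /Int RintegralD//; exact: Cc_integrable. Qed.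

Lemma IntB f g : Cc f -> Cc g -> Int (fun x => f x - g x) = Int f - Int g.
Proof. by move=> Cf Cg; rewrite /Int RintegralB//; exact: Cc_integrable. Qed.

Lemma IntZ a f : Cc f -> Int (fun x => a * f x) = a * Int f.
Proof. by move=> Cf; rewrite /Int RintegralZl//; exact: Cc_integrable. Qed.

Lemma Int_le f g : Cc f -> Cc g -> (forall x, f x <= g x) -> Int f <= Int g.
Proof. by move=> Cf Cg fg; apply: le_Rintegral => //; exact: Cc_integrable. Qed.

Lemma Int_sum (I : Type) (s : seq I) (F : I -> 'rV[R]_n -> R) :
  (forall i, Cc (F i)) ->
  Int (fun x => \sum_(i <- s) F i x) = \sum_(i <- s) Int (F i).
Proof.
move=> CF; elim: s => [|i s IHs].
  rewrite big_nil -[RHS](mul0r (Int (fun=> 0))) -IntZ; last exact: Cc0.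
  by apply: eq_Rintegral => x _; rewrite big_nil mulr0.
rewrite big_cons -IHs -IntD//; last exact: Cc_sum.
by apply: eq_Rintegral => x _; rewrite big_cons.
Qed.

Lemma Int_translate (v : 'rV[R]_n) f : Cc f -> Int (fun x => f (x + v)) = Int f.
Proof.
move=> Cf; rewrite /Int/Rintegral; congr fine.
have mf : measurable_fun setT (EFin \o f).
  by case/integrableP: (Cc_integrable Cf).
rewrite integralE [RHS]integralE; congr (_ - _)%E.
  rewrite -[RHS](ge0_integral_translate v)//; last exact: measurable_funepos.
  by apply: eq_integral => x _; rewrite !funeposE.
rewrite -[RHS](ge0_integral_translate v)//; last exact: measurable_funeneg.
by apply: eq_integral => x _; rewrite !funenegE.
Qed.

Lemma Int_dominated_cvg0 (r M : R) (g_ : nat -> 'rV[R]_n -> R) :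
  (forall k, continuous (g_ k)) -> (forall k, vanishes_off_cube r (g_ k)) ->
  (forall k x, `|g_ k x| <= M) -> (forall x, g_ k x @[k --> \oo] --> 0) ->
  Int (g_ k) @[k --> \oo] --> 0.
Proof.
move=> cg vg gM g0.
have [|||||_ _] := @dominated_convergence _ _ R mu setT measurableT
   (fun k x => (g_ k x)%:E) (cst 0%E) (EFin \o (fun x => M * \1_(cube 0 r) x)).
- by move=> k; apply/measurable_EFinP; exact: continuous_measurable_rV.
- exact: measurable_cst.
- by apply: aeW => x _; apply: cvg_EFin; [exact: nearW|exact: g0].
- exact: integrable_cube_cst.
- apply: aeW => x k _ /=; rewrite lee_fin indicE.
  have [/set_mem xr|xr] := boolP (x \in cube 0 r); first by rewrite mulr1.
  by rewrite vg ?normr0 ?mulr0// => /mem_set; apply/negP.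
rewrite integral0 => h.
by have := fine_cvg h; apply.
Qed.

End compactly_supported.

(** * Euclidean geometry and the distance to the complement *)

Section euclidean_norm.
Context {R : realType}.
Implicit Types n : nat.

Definition dot n (u v : 'rV[R]_n) : R := \sum_i u 0 i * v 0 i.

Lemma enorm_ge0 n (u : 'rV[R]_n) : 0 <= enorm u.
Proof. exact: sqrtr_ge0. Qed.

Lemma dot_ge0 n (u : 'rV[R]_n) : 0 <= dot u u.
Proof. by apply: sumr_ge0 => i _; rewrite -expr2 sqr_ge0. Qed.

Lemma sqr_enorm n (u : 'rV[R]_n) : enorm u ^+ 2 = dot u u.
Proof.
rewrite /enorm sqr_sqrtr; first by apply: eq_bigr => i _; rewrite expr2.
by apply: sumr_ge0 => i _; exact: sqr_ge0.
Qed.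

Lemma dotC n (u v : 'rV[R]_n) : dot u v = dot v u.
Proof. by apply: eq_bigr => i _; rewrite mulrC. Qed.

Lemma dotDl n (u v w : 'rV[R]_n) : dot (u + v) w = dot u w + dot v w.
Proof. by rewrite -big_split; apply: eq_bigr => i _; rewrite mxE mulrDl. Qed.

Lemma dotZl n a (u v : 'rV[R]_n) : dot (a *: u) v = a * dot u v.
Proof. by rewrite mulr_sumr; apply: eq_bigr => i _; rewrite mxE mulrA. Qed.

Lemma dotDr n (u v w : 'rV[R]_n) : dot w (u + v) = dot w u + dot w v.
Proof. by rewrite dotC dotDl !(dotC w). Qed.

Lemma dotZr n a (u v : 'rV[R]_n) : dot v (a *: u) = a * dot v u.
Proof. by rewrite dotC dotZl dotC. Qed.

Lemma dotNl n (u v : 'rV[R]_n) : dot (- u) v = - dot u v.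
Proof. by rewrite -scaleN1r dotZl mulN1r. Qed.

Lemma dotNr n (u v : 'rV[R]_n) : dot v (- u) = - dot v u.
Proof. by rewrite dotC dotNl dotC. Qed.

Lemma dot_delta n (u : 'rV[R]_n) i : dot u (delta_mx 0 i) = u 0 i.
Proof.
rewrite /dot (bigD1 i)//= mxE !eqxx mulr1 big1 ?addr0// => j ji.
by rewrite mxE (negPf ji) andbF mulr0.
Qed.

Lemma enorm_sqrt n (u : 'rV[R]_n) : enorm u = Num.sqrt (dot u u).
Proof. by rewrite -sqr_enorm sqrtr_sqr ger0_norm// enorm_ge0. Qed.

Lemma enorm_delta n (i : 'I_n) : enorm (delta_mx 0 i : 'rV[R]_n) = 1.
Proof. by rewrite enorm_sqrt dot_delta mxE !eqxx sqrtr1. Qed.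

Lemma enorm0 n : enorm (0 : 'rV[R]_n) = 0.
Proof. by rewrite enorm_sqrt -(scale0r 0) dotZl mul0r sqrtr0. Qed.

Lemma enormZ n a (u : 'rV[R]_n) : enorm (a *: u) = `|a| * enorm u.
Proof.
rewrite !enorm_sqrt dotZl dotZr mulrA -expr2 sqrtrM ?sqr_ge0//.
by rewrite sqrtr_sqr.
Qed.

Lemma enormN n (u : 'rV[R]_n) : enorm (- u) = enorm u.
Proof. by rewrite -scaleN1r enormZ normrN1 mul1r. Qed.

Lemma enorm_coord n (u : 'rV[R]_n) i : `|u 0 i| <= enorm u.
Proof.
rewrite -sqrtr_sqr enorm_sqrt ler_sqrt ?dot_ge0// /dot (bigD1 i)//= -expr2 lerDl.
by apply: sumr_ge0 => j _; rewrite -expr2 sqr_ge0.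
Qed.

Lemma enorm_eq0 n (u : 'rV[R]_n) : enorm u = 0 -> u = 0.
Proof.
move=> u0; apply/rowP => i; rewrite mxE; apply/eqP.
by rewrite -normr_le0 -u0 enorm_coord.
Qed.

Lemma enorm_gt0 n (u : 'rV[R]_n) : u != 0 -> 0 < enorm u.
Proof.
move=> u0; rewrite lt_neqAle enorm_ge0 andbT eq_sym.
by apply: contra_neq u0; exact: enorm_eq0.
Qed.

Lemma cauchy_schwarz n (u v : 'rV[R]_n) : dot u v <= enorm u * enorm v.
Proof.
have [->|v0] := eqVneq v 0.
  by rewrite enorm0 mulr0 -(scale0r 0) dotZr mul0r.
have ev0 := enorm_gt0 v0.
(* The vector is [|v|^2] times the component of [u] orthogonal to [v]. *)
have : 0 <= dot (enorm v ^+ 2 *: u - dot u v *: v) (enorm v ^+ 2 *: u - dot u v *: v).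
  exact: dot_ge0.
rewrite !(dotDl, dotDr, dotNl, dotNr, dotZl, dotZr) (dotC v u) -!sqr_enorm.
set a := enorm u; set b := enorm v in ev0 *; set c := dot u v.
rewrite [X in 0 <= X](_ : _ = b ^+ 2 * ((a * b) ^+ 2 - c ^+ 2)); last by ring.
rewrite pmulr_rge0 ?exprn_gt0// subr_ge0 => h.
rewrite (le_trans (ler_norm c))// -(@ler_pXn2r _ 2)//.
- by rewrite -normrX ger0_norm// sqr_ge0.
- by rewrite nnegrE; apply: mulr_ge0; exact: enorm_ge0.
Qed.

Lemma enormD n (u v : 'rV[R]_n) : enorm (u + v) <= enorm u + enorm v.
Proof.
rewrite -(@ler_pXn2r _ 2)// ?nnegrE ?addr_ge0 ?enorm_ge0//.
rewrite sqr_enorm sqrrD !(dotDl, dotDr) -!sqr_enorm (dotC v u).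
have := cauchy_schwarz u v; lra.
Qed.

Lemma enormB n (u v : 'rV[R]_n) : enorm (u - v) = enorm (v - u).
Proof. by rewrite -enormN opprB. Qed.

Lemma mx_norm_le_enorm n (u : 'rV[R]_n) : `|u| <= enorm u.
Proof.
rewrite [leLHS]/Num.Def.normr/= mx_normrE; apply/bigmax_leP; split.
  exact: enorm_ge0.
by move=> [i j] _; rewrite (ord1 i) enorm_coord.
Qed.

Lemma enorm_le_mx_norm n (u : 'rV[R]_n) : enorm u <= n%:R * `|u|.
Proof.
have [->|u0] := eqVneq u 0; first by rewrite enorm0 mulr_ge0.
have eu0 := enorm_gt0 u0.
rewrite -(ler_pM2l eu0) -expr2 sqr_enorm /dot.
apply: (@le_trans _ _ (\sum_(i < n) enorm u * `|u|)); last first.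
  by rewrite sumr_const card_ord mulrCA mulr_natl.
apply: ler_sum => i _; rewrite (le_trans (ler_norm _))// normrM.
by apply: ler_pM => //; [exact: enorm_coord|exact: mx_norm_coord].
Qed.

Lemma enorm_lipschitz n (u v : 'rV[R]_n) : `|enorm u - enorm v| <= enorm (u - v).
Proof.
rewrite ler_norml.
by have := enormD (v - u) u; have := enormD (u - v) v; rewrite !subrK (enormB v u);
  lra.
Qed.

Lemma lipschitz_continuous n (f : 'rV[R]_n -> R) :
  (forall u v, `|f u - f v| <= enorm (u - v)) -> continuous f.
Proof.
move=> lf x; apply/(@cvgrPdist_lt _ _ _ (nbhs x) (nbhs_filter x)) => e e0.
(* [n + 1] instead of [n] keeps the divisor positive in dimension zero. *)
have n1 : 0 < n%:R + 1 :> R by rewrite ltr_wpDl.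
apply/nbhs_ballP; exists (e / (n%:R + 1)); first by rewrite /= divr_gt0.
move=> y; rewrite -ball_normE /= ltr_pdivlMr// => xy.
rewrite (le_lt_trans (lf _ _))// (le_lt_trans (enorm_le_mx_norm _))//.
by rewrite (le_lt_trans _ xy)// mulrC ler_wpM2l// lerDl.
Qed.

Lemma enorm_continuous n : continuous (@enorm R n).
Proof. by apply: lipschitz_continuous => u v; exact: enorm_lipschitz. Qed.

Lemma dotE n (u v : 'rV[R]_n) : u *m v^T = (dot u v)%:M.
Proof.
apply/matrixP => i j; rewrite !ord1 !mxE eqxx mulr1n.
by apply: eq_bigr => k _; rewrite mxE.
Qed.

Lemma dot_rotation n (Q : 'M[R]_n.+1) (u v : 'rV[R]_n.+1) : rotation Q ->
  dot (u *m Q) (v *m Q) = dot u v.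
Proof.
move=> [QQ _]; have : (u *m Q) *m (v *m Q)^T = u *m v^T.
  by rewrite trmx_mul -mulmxA (mulmxA Q) QQ mul1mx.
by rewrite !dotE => /matrixP/(_ 0 0); rewrite !mxE eqxx !mulr1n.
Qed.

Lemma enorm_rotation n (Q : 'M[R]_n.+1) (u : 'rV[R]_n.+1) : rotation Q ->
  enorm (u *m Q) = enorm u.
Proof. by move=> rQ; rewrite !enorm_sqrt dot_rotation. Qed.

Lemma rotation_tr n (Q : 'M[R]_n.+1) : rotation Q -> Q^T *m Q = 1%:M.
Proof. by move=> [/mulmx1C]. Qed.

Lemma enorm_le_sum n (v : 'rV[R]_n) : enorm v <= \sum_k `|v 0 k|.
Proof.
have S0 : 0 <= \sum_k `|v 0 k| by apply: sumr_ge0.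
rewrite -(@ler_pXn2r _ 2)// ?nnegrE ?enorm_ge0//.
rewrite sqr_enorm /dot expr2 mulr_suml; apply: ler_sum => k _.
rewrite (le_trans (ler_norm _))// normrM ler_wpM2l//.
by rewrite (bigD1 k)//= lerDl sumr_ge0.
Qed.

End euclidean_norm.

(** * Nearest points, Lipschitz bound and semiconcavity of the distance *)

Section distance_to_complement.
Context {R : realType} {n : nat}.
Variable Omega : set 'rV[R]_n.
Hypotheses (Omega_open : open Omega) (compl0 : ~` Omega !=set0).
Local Notation delta := (dist_compl Omega).

Let dist_has_lb x : has_lbound [set enorm (x - y) | y in ~` Omega].
Proof. by exists 0 => _ [y _ <-]; exact: enorm_ge0. Qed.

Lemma dist_compl_le x y : ~ Omega y -> delta x <= enorm (x - y).
Proof. by move=> Oy; apply: ge_inf => //; exists y. Qed.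

(** The complement is closed but possibly unbounded; intersecting it with a ball around [x] that
    reaches one of its points gives a compact set with the same infimum. *)
Lemma dist_compl_nearest x : exists2 y, ~ Omega y & delta x = enorm (x - y).
Proof.
have [y0 Oy0] := compl0.
have lip u v : `|enorm (x - u) - enorm (x - v)| <= enorm (u - v).
  by rewrite (le_trans (enorm_lipschitz _ _))// opprB addrC subrKA enormB.
pose A := ~` Omega `&` [set y | enorm (x - y) <= enorm (x - y0)].
have cA : compact A.
  apply: bounded_closed_compact.
    exists (`|x| + enorm (x - y0)); split; first by rewrite num_real.
    move=> M MP y [_ /= yx]; rewrite -(subrK x y) (le_trans (ler_normD _ _))//.
    rewrite addrC (le_trans _ (ltW MP))// lerD2l (le_trans _ yx)//.
    by rewrite enormB mx_norm_le_enorm.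
  apply: closedI; first exact: open_closedC.
  apply: (@preimage_closed _ _ (fun y : 'rV[R]_n => enorm (x - y))
    [set r : R | r <= enorm (x - y0)]).
    move=> y _; apply: lipschitz_continuous => u v.
    exact: lip.
  exact: closed_le.
have A0 : A !=set0 by exists y0; split=> /=.
have [] := @EVT_min_rV R n (fun y => enorm (x - y)) A A0 cA.
  apply: continuous_subspaceT; apply: lipschitz_continuous => u v.
  exact: lip.
move=> y /set_mem[Oy yx] ymin; exists y => //.
apply/eqP; rewrite eq_le dist_compl_le//=.
apply: lb_le_inf; first by exists (enorm (x - y)), y.
move=> _ [z Oz <-]; have [zx|/ltW zx] := leP (enorm (x - z)) (enorm (x - y0)).
  by apply: ymin; apply/mem_set; split.
exact: (le_trans yx).
Qed.

Lemma dist_compl_lipschitz x y : `|delta x - delta y| <= enorm (x - y).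
Proof.
have h u v : delta u <= delta v + enorm (u - v).
  have [z Oz ->] := dist_compl_nearest v.
  rewrite (le_trans (dist_compl_le u Oz))// -[u in leLHS](subrK v) -addrA.
  by rewrite (le_trans (enormD _ _))// [leRHS]addrC.
by rewrite ler_norml; have := h x y; have := h y x; rewrite (enormB y x); lra.
Qed.

Lemma dist_compl_continuous : continuous delta.
Proof. by apply: lipschitz_continuous; exact: dist_compl_lipschitz. Qed.

Lemma dist_compl_gt0 x : Omega x -> 0 < delta x.
Proof.
move=> Ox; have [y Oy ->] := dist_compl_nearest x.
by apply: enorm_gt0; rewrite subr_eq0; apply: contra_not_neq Oy => <-.
Qed.

(* The segment joining a point of [Omega] to a nearest point of the complement
   stays in [Omega] until its endpoint, which is thus a boundary point. *)
Lemma nearest_boundary x y : Omega x -> ~ Omega y -> delta x = enorm (x - y) ->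
  boundary Omega y.
Proof.
move=> Ox Oy xy; split; last by move/interior_id : Omega_open => ->.
have xy0 : 0 < enorm (x - y) by rewrite -xy dist_compl_gt0.
move=> B /nbhs_ballP[e /= e0 eB].
pose t := Num.min 1 (e / 2 / enorm (x - y)).
have t0 : 0 < t by rewrite lt_min ltr01 !divr_gt0.
have t1 : t <= 1 by rewrite ge_min lexx.
have te : t * enorm (x - y) <= e / 2.
  by rewrite -ler_pdivlMr// ge_min lexx orbT.
exists (y + t *: (x - y)); split.
  apply: contrapT => /(dist_compl_le x); rewrite xy.
  have -> : x - (y + t *: (x - y)) = (1 - t) *: (x - y).
    by rewrite scalerBl scale1r opprD addrA.
  rewrite enormZ ger0_norm ?subr_ge0// mulrBl mul1r.
  by rewrite lerBrDr gerDl leNgt mulr_gt0.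
apply: eB; rewrite -ball_normE /= opprD addrA subrr add0r normrN.
rewrite (le_lt_trans (mx_norm_le_enorm _))// enormZ gtr0_norm//.
by rewrite (le_lt_trans te)// ltr_pdivrMr// ltr_pMr// ltr1n.
Qed.

(** The distance to the fixed point [y] lies above [delta] and agrees with it at [x]. Its expansion
    reduces to [2 * D * E <= D^2 + E^2], where [D = |x - y|] and [E = |x + v - y|]. *)
Lemma dist_compl_semiconcave x y v : Omega x -> delta x = enorm (x - y) ->
  ~ Omega y ->
  delta (x + v) <= delta x + dot ((delta x)^-1 *: (x - y)) v
                   + enorm v ^+ 2 / (2 * delta x).
Proof.
move=> Ox xy Oy; have d0 := dist_compl_gt0 Ox.
rewrite (le_trans (dist_compl_le _ Oy))//.
rewrite dotZl -(ler_pM2l d0) -[leRHS]/(_ * _).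
set D := delta x in d0 xy *.
have -> : D * (D + D^-1 * dot (x - y) v + enorm v ^+ 2 / (2 * D)) =
   (D ^+ 2 + (D ^+ 2 + 2 * dot (x - y) v + enorm v ^+ 2)) / 2.
  by field; exact: lt0r_neq0.
have -> : D ^+ 2 + 2 * dot (x - y) v + enorm v ^+ 2 = enorm (x + v - y) ^+ 2.
  rewrite xy !sqr_enorm (_ : x + v - y = (x - y) + v); last by rewrite addrAC.
  by move: (x - y) => w; rewrite !dotDl !dotDr (dotC v w); ring.
have := sqr_ge0 (D - enorm (x + v - y)); rewrite sqrrB; lra.
Qed.

End distance_to_complement.

(** * Taylor expansions along lines *)

Section line_derivatives.
Context {R : realType} {n : nat}.
Implicit Types (f phi : 'rV[R]_n -> R) (a b v w : 'rV[R]_n).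

Lemma is_derive_line f b v (s : R) :
  derivable f (b + s *: v) v ->
  is_derive s 1 (fun t => f (b + t *: v)) ('D_v f (b + s *: v)).
Proof.
have E : (fun h : R => h^-1 *: (f (b + (h *: 1 + s) *: v) - f (b + s *: v))) =
         (fun h : R => h^-1 *: (f (h *: v + (b + s *: v)) - f (b + s *: v))).
  apply/funext => h; congr (_ *: (f _ - _)).
  by rewrite [h *: 1]mulr1 scalerDl addrCA.
move=> df; apply: DeriveDef.
  by rewrite /derivable /= E.
by rewrite /derive /= E.
Qed.

Lemma MVT_between (g dg : R -> R) (t : R) :
  (forall s : R, `|s| <= `|t| -> is_derive s 1 g (dg s)) ->
  exists2 s, `|s| <= `|t| & g t - g 0 = dg s * t.
Proof.
move=> dgP.
have cg s : `|s| <= `|t| -> {for s, continuous g}.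
  move=> st; apply: differentiable_continuous; apply/derivable1_diffP.
  by have [] := dgP s st.
have cgw (c d : R) : (forall s : R, s \in `[c, d] -> `|s| <= `|t|) ->
    {within `[c, d], continuous g}.
  move=> cd; apply: continuous_in_subspaceT => s /set_mem /= suv.
  by apply: cg; exact: cd.
have [t0|t0|<-] := ltgtP 0 t.
- have [||s] := @MVT R g dg 0 t t0.
  + move=> s; rewrite in_itv/= => /andP[s0 st]; apply: dgP.
    by rewrite !gtr0_norm// ltW.
  + apply: cgw => s; rewrite in_itv/= => /andP[s0 st].
    by rewrite (gtr0_norm t0) ger0_norm.
  rewrite in_itv/= => /andP[s0 st]; rewrite subr0 => h; exists s => //.
  by rewrite !gtr0_norm// ltW.
- have [||s] := @MVT R g dg t 0 t0.
  + move=> s; rewrite in_itv/= => /andP[st s0]; apply: dgP.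
    by rewrite !ltr0_norm// lerN2 ltW.
  + apply: cgw => s; rewrite in_itv/= => /andP[st s0].
    by rewrite (ltr0_norm t0) ler0_norm// lerN2.
  rewrite in_itv/= => /andP[st s0]; rewrite sub0r mulrN => h; exists s.
    by rewrite !ltr0_norm// lerN2 ltW.
  by rewrite -[RHS]opprK -h opprB.
- by exists 0; rewrite ?subrr ?mulr0.
Qed.

(** The vertices of the staircase path from [0] to [v] along the axes. *)
Definition take_coord (k : nat) (v : 'rV[R]_n) : 'rV[R]_n :=
  \row_j if (j < k)%N then v 0 j else 0.

Lemma take_coordS (k : 'I_n) v :
  take_coord k.+1 v = take_coord k v + v 0 k *: delta_mx 0 k.
Proof.
apply/rowP => j; rewrite !mxE eqxx/= ltnS leq_eqVlt -val_eqE/=.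
case: eqVneq => [/val_inj ->|] /=; first by rewrite ltnn mulr1 add0r.
by rewrite mulr0 addr0.
Qed.

(** [Ck] speaks only of derivatives along the axes. The increment is telescoped over the staircase
    path; on each leg the mean value theorem produces a partial derivative at a nearby point, close
    to its value at [a] by continuity. *)
Lemma C1_expansion (U : set 'rV[R]_n) phi a : open U -> U a -> Ck 1 U phi ->
  forall e, 0 < e -> exists2 d, 0 < d & forall v, enorm v < d ->
    `|phi (a + v) - phi a - \sum_j v 0 j * partial j phi a| <= e * enorm v.
Proof.
move=> oU Ua [_ C1] e e0.
have n1 : 0 < n%:R + 1 :> R by rewrite ltr_wpDl.
pose e' := e / (n%:R + 1).
have e'0 : 0 < e' by rewrite divr_gt0.
have [d /= d0 dP] : exists2 d : R, 0 < d & forall x, ball a d x ->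
    U x /\ forall j, `|partial j phi a - partial j phi x| < e'.
  have : nbhs a (U `&` [set x | forall j, `|partial j phi a - partial j phi x| < e']).
    apply: filterI; first exact: open_nbhs_nbhs.
    apply: (@filter_forall _ _ _ (nbhs a) (nbhs_filter a)) => j; have [_ [cj _]] := C1 j.
    have /(@cvgrPdist_lt _ _ _ (nbhs a) (nbhs_filter a)) := cj a Ua.
    exact.
  by move=> /nbhs_ballP[d d0 dP]; exists d => // x /dP.
exists d => // v vd.
(* The legs stay in the ball, since no coordinate on them exceeds that of [v] in absolute value. *)
have pt (k : 'I_n) s : `|s| <= `|v 0 k| ->
    ball a d (a + take_coord k v + s *: delta_mx 0 k).
  move=> sv; rewrite -ball_normE /= -addrA opprD addrA subrr add0r normrN.
  apply: le_lt_trans vd; rewrite [leLHS]/Num.Def.normr/= mx_normrE.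
  apply/bigmax_leP; split; first exact: enorm_ge0.
  move=> [i j] _; rewrite (ord1 i) /= !mxE eqxx/=.
  have [->|jk] := eqVneq j k.
    by rewrite ltnn add0r mulr1 (le_trans sv)// enorm_coord.
  rewrite mulr0 addr0; case: ifP => _; first exact: enorm_coord.
  by rewrite normr0 enorm_ge0.
have step (k : 'I_n) :
    `|phi (a + take_coord k.+1 v) - phi (a + take_coord k v)
      - v 0 k * partial k phi a| <= e' * enorm v.
  pose g s := phi (a + take_coord k v + s *: delta_mx 0 k).
  pose dg s := partial k phi (a + take_coord k v + s *: delta_mx 0 k).
  have [|s sv] := @MVT_between g dg (v 0 k).
    move=> s /pt /dP[Us _]; apply: is_derive_line.
    by have [+ _] := C1 k; apply.
  rewrite /g scale0r addr0 -addrA -take_coordS => ->.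
  rewrite mulrC -mulrBr normrM mulrC ler_pM// ?enorm_coord//.
  by have [_ /(_ k)] := dP _ (pt k s sv); rewrite distrC /dg => /ltW.
have -> : phi (a + v) - phi a - \sum_j v 0 j * partial j phi a =
   \sum_(k < n) (phi (a + take_coord k.+1 v) - phi (a + take_coord k v)
      - v 0 k * partial k phi a).
  rewrite sumrB; congr (_ - _).
  have := @telescope_sumr R 0 n (fun k => phi (a + take_coord k v)) (leq0n n).
  rewrite big_mkord => ->.
  rewrite (_ : take_coord n v = v); last by apply/rowP => j; rewrite mxE ltn_ord.
  rewrite (_ : take_coord 0 v = 0); last by apply/rowP => j; rewrite !mxE.
  by rewrite addr0.
rewrite (le_trans (ler_norm_sum _ _ _))//.
apply: (@le_trans _ _ (\sum_(k < n) e' * enorm v)); first exact: ler_sum.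
rewrite sumr_const card_ord -mulr_natl mulrA ler_wpM2r ?enorm_ge0//.
rewrite /e' mulrCA ger_pMr// ler_pdivrMr// mul1r lerDl//.
Qed.

Lemma C1_line (U : set 'rV[R]_n) phi a v (t : R) : open U -> U (a + t *: v) -> Ck 1 U phi ->
  is_derive t 1 (fun s => phi (a + s *: v))
    (\sum_j v 0 j * partial j phi (a + t *: v)).
Proof.
move=> oU Ua C1; set D := \sum_j _.
have cv : (fun h : R => h^-1 *: (phi (a + (h *: 1 + t) *: v) - phi (a + t *: v)))
    @ 0^' --> D.
  apply/cvgrPdist_le => e e0.
  have ev : 0 < e / (enorm v + 1) by rewrite divr_gt0// ltr_wpDl ?enorm_ge0.
  have [d d0 dP] := C1_expansion oU Ua C1 ev.
  near=> h.
  have h0 : h != 0 by near: h; exact: nbhs_dnbhs_neq.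
  have hv : enorm (h *: v) < d.
    rewrite enormZ; apply: (@le_lt_trans _ _ (`|h| * (enorm v + 1))).
      by rewrite ler_wpM2l// lerDl.
    rewrite -ltr_pdivlMr; last by rewrite ltr_wpDl ?enorm_ge0.
    near: h; apply: dnbhs0_lt; rewrite divr_gt0// ltr_wpDl ?enorm_ge0//.
  have := dP _ hv.
  rewrite (_ : a + t *: v + h *: v = a + (h *: 1 + t) *: v); last first.
    by rewrite [h *: 1]mulr1 scalerDl addrCA addrC.
  rewrite (_ : \sum_j _ = h * D); last first.
    by rewrite mulr_sumr; apply: eq_bigr => j _; rewrite mxE mulrA.
  rewrite enormZ => le_h; rewrite -(ler_pM2l (_ : 0 < `|h|)) ?normr_gt0//.
  rewrite -normrM mulrBr /GRing.scale/= mulrA divff// mul1r distrC.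
  apply: le_trans le_h _; rewrite mulrCA ler_wpM2l// mulrAC.
  by rewrite ler_pdivrMr ?ltr_wpDl ?enorm_ge0// ler_wpM2l ?lerDl// ltW.
by apply: DeriveDef; [apply/cvg_ex; exists D|exact/cvg_lim].
Unshelve. all: by end_near. Qed.

Lemma CkS_partial k (U : set 'rV[R]_n) phi i : Ck k.+1 U phi -> Ck k U (partial i phi).
Proof. by move=> [_ /(_ i)[]]. Qed.

Lemma CkW k (U : set 'rV[R]_n) phi : Ck k.+1 U phi -> Ck k U phi.
Proof.
elim: k phi => [|k IHk] phi; first by case.
by move=> [c0 c1]; split=> // i; have [d1 c2] := c1 i; split=> //; exact: IHk.
Qed.

(** The mean value theorem, applied to the second difference minus its quadratic part, leaves the
    difference of the first derivatives at [s] and [- s]. When each partial derivative is expanded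
    to first order, the values at [0] cancel and the Hessian terms match [B]. *)
Lemma second_difference (U : set 'rV[R]_n) phi w : open U -> U 0 -> Ck 2 U phi ->
  forall e : R, 0 < e -> exists2 d, 0 < d & forall t : R, `|t| < d ->
    `|phi (t *: w) + phi (- t *: w) - 2 * phi 0
      - t ^+ 2 * \sum_j \sum_k w 0 j * w 0 k * hessian phi 0 j k| <= e * t ^+ 2.
Proof.
move=> oU U0 C2 e e0.
set B := \sum_j _.
have w1 : 0 < enorm w + 1 by rewrite ltr_wpDl ?enorm_ge0.
pose S := \sum_k `|w 0 k|.
have S0 : 0 <= S by exact: sumr_ge0.
(* The [2] accounts for the two points [s] and [- s], the other factors for [enorm w] and [S]; the
   added units keep the divisor positive. *)
have e'0 : 0 < e / (2 * (enorm w + 1) * (S + 1)).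
  by rewrite divr_gt0 ?mulr_gt0// ltr_wpDl.
set e' := _ / _ in e'0.
have /choice[d dP] : forall k, exists d : R, 0 < d /\ forall v, enorm v < d ->
   `|partial k phi (0 + v) - partial k phi 0
     - \sum_j v 0 j * partial j (partial k phi) 0| <= e' * enorm v.
  move=> k; have [d d0 dP] := C1_expansion oU U0 (CkS_partial k C2) e'0.
  by exists d.
have [d1 /= d10 d1U] : exists2 d1 : R, 0 < d1 & ball 0 d1 `<=` U.
  by have /nbhs_ballP[d1 d10 d1P] := open_nbhs_nbhs (conj oU U0); exists d1.
pose d2 := \big[Num.min/d1]_k d k.
have d20 : 0 < d2.
  by apply: lt_bigmin => // k _; have [] := dP k.
exists (d2 / (enorm w + 1)); first by rewrite divr_gt0.
move=> t td.
have small s : `|s| <= `|t| -> enorm (s *: w) < d2.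
  move=> st; rewrite enormZ.
  apply: (@le_lt_trans _ _ (`|t| * (enorm w + 1))).
    by apply: ler_pM => //; rewrite ?enorm_ge0// lerDl.
  by rewrite -ltr_pdivlMr.
have Us s : `|s| <= `|t| -> U (0 + s *: w).
  move=> /small sd; apply: d1U; rewrite -ball_normE /= opprD addNKr normrN.
  rewrite (le_lt_trans (mx_norm_le_enorm _))// (lt_le_trans sd)//.
  exact: bigmin_le_id.
pose dphi s := \sum_j w 0 j * partial j phi (0 + s *: w).
pose g s := phi (0 + s *: w) + phi (0 + (- s) *: w) - s ^+ 2 * B.
pose dg s := dphi s - dphi (- s) - 2 * s * B.
have dgP (s : R) : `|s| <= `|t| -> is_derive s 1 g (dg s).
  move=> st.
  have D1 := C1_line oU (Us _ st) (CkW C2).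
  have d2' : is_derive s 1 (fun s => phi (0 + (- s) *: w)) (- dphi (- s)).
    have := @is_derive1_comp R (fun s => phi (0 + s *: w)) (fun s => - s) s (dphi (- s)) (-1).
    rewrite mulrN1; apply.
      by apply: (C1_line oU _ (CkW C2)); apply: Us; rewrite normrN.
  have d3 : is_derive s 1 (fun s : R => s ^+ 2 * B) (2 * s * B).
    have -> : (fun s : R => s ^+ 2 * B) = B \*: (@id R ^+ 2).
      by apply/funext => u /=; rewrite mulrC.
    apply: is_derive_eq.
    rewrite /GRing.scale/= expr1. by ring.
  have D := is_deriveB (is_deriveD D1 d2') d3.
  exact D.
have [s st] := MVT_between dgP.
rewrite /g scale0r oppr0 scale0r expr0n/= mul0r subr0 !add0r => gE.
have -> : phi (t *: w) + phi (- t *: w) - 2 * phi 0 - t ^+ 2 * B = dg s * t.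
  by rewrite -gE; ring.
have st2 : `|- s| <= `|t| by rewrite normrN.
pose q k := partial k phi 0; pose b k := \sum_j w 0 j * hessian phi 0 j k.
have est (u : R) k : `|u| <= `|t| ->
    `|partial k phi (0 + u *: w) - q k - u * b k| <= e' * (`|t| * enorm w).
  move=> ut; have [_] := dP k.
  have uw : enorm (u *: w) < d k by rewrite (lt_le_trans (small u ut))// bigmin_le_cond.
  move=> /(_ _ uw); rewrite (_ : \sum_j _ = u * b k); last first.
    by rewrite mulr_sumr; apply: eq_bigr => j _; rewrite !mxE mulrA.
  move=> /le_trans; apply; rewrite enormZ ler_pM2l// ler_wpM2r// enorm_ge0//.
have BE : B = \sum_k w 0 k * b k.
  rewrite /B exchange_big/=; apply: eq_bigr => k _; rewrite mulr_sumr.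
  by apply: eq_bigr => j _; rewrite mulrA (mulrC (w 0 k)).
have -> : dg s = \sum_k w 0 k *
   ((partial k phi (0 + s *: w) - q k - s * b k)
    - (partial k phi (0 + - s *: w) - q k - (- s) * b k)).
  rewrite /dg /dphi BE mulr_sumr -!sumrB; apply: eq_bigr => k _; ring.
rewrite normrM expr2 -[t * t]ger0_norm -?expr2 ?sqr_ge0// expr2 normrM mulrA.
rewrite ler_wpM2r// (le_trans (ler_norm_sum _ _ _))//.
apply: (@le_trans _ _ (\sum_k `|w 0 k| * (2 * e' * (`|t| * enorm w)))).
  apply: ler_sum => k _; rewrite normrM ler_wpM2l// (le_trans (ler_normB _ _))//.
  by have := est s k st; have := est (- s) k st2; lra.
rewrite -mulr_suml -/S.
have -> : S * (2 * e' * (`|t| * enorm w)) = `|t| * (e' * (2 * enorm w * S)) by ring.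
rewrite mulrC ler_wpM2r// /e' mulrAC ler_pdivrMr; last first.
  by rewrite !mulr_gt0// ltr_wpDl.
rewrite ler_wpM2l ?(ltW e0)// ler_pM ?mulr_ge0 ?enorm_ge0 ?lerDl//.
by rewrite ler_wpM2l// lerDl.
Qed.

End line_derivatives.

(** * The boundary as a graph *)

Section graph_coordinates.
Context {R : realType} {n : nat}.
Implicit Types (w : 'rV[R]_n) (z : 'rV[R]_n.+1).

Lemma open_enorm_lt m (r : R) : open [set w : 'rV[R]_m | enorm w < r].
Proof.
rewrite (_ : [set w | _] = @enorm R m @^-1` [set s : R | s < r])//.
by apply: open_comp; [move=> w _; exact: enorm_continuous|exact: open_lt].
Qed.

Lemma dot_rV_insert (i : 'I_n.+1) (s s' : R) w w' :
  dot (rV_insert i s w) (rV_insert i s' w') = s * s' + dot w w'.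
Proof.
rewrite /dot (bigD1_ord i)//= !rV_insert_at; congr (_ + _).
by apply: eq_bigr => j _; rewrite !rV_insert_lift.
Qed.

Lemma sqr_enorm_rV_insert (i : 'I_n.+1) (s : R) w :
  enorm (rV_insert i s w) ^+ 2 = s ^+ 2 + enorm w ^+ 2.
Proof. by rewrite !sqr_enorm dot_rV_insert expr2. Qed.

Lemma enorm_rV_insert0 (i : 'I_n.+1) (s : R) : enorm (rV_insert i s 0) = `|s|.
Proof. by rewrite enorm_sqrt -sqr_enorm sqr_enorm_rV_insert enorm0 expr0n addr0 sqrtr_sqr. Qed.

Lemma enorm_rV_insert_le (i : 'I_n.+1) (s : R) w :
  enorm (rV_insert i s w) <= `|s| + enorm w.
Proof.
rewrite -(@ler_pXn2r _ 2)// ?nnegrE ?addr_ge0 ?enorm_ge0//.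
rewrite sqr_enorm_rV_insert sqrrD real_normK ?num_real// lerD2r lerDl.
by rewrite mulrn_wge0// mulr_ge0// enorm_ge0.
Qed.

Lemma col'_rV_insert (i : 'I_n.+1) (s : R) w : col' i (rV_insert i s w) = w.
Proof. by apply/rowP => j; rewrite mxE rV_insert_lift. Qed.

Lemma rV_insert_col' (i : 'I_n.+1) z : rV_insert i (z 0 i) (col' i z) = z.
Proof. by apply/rowP => j; rewrite mxE; case: unliftP => [k|] ->; rewrite ?mxE. Qed.

Lemma rV_insertB (i : 'I_n.+1) (s s' : R) w w' :
  rV_insert i s w - rV_insert i s' w' = rV_insert i (s - s') (w - w').
Proof. by apply/rowP => j; rewrite !mxE; case: unliftP => [k|] _; rewrite ?mxE. Qed.

Lemma enorm_col'_le (i : 'I_n.+1) z : enorm (col' i z) <= enorm z.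
Proof.
rewrite -(@ler_pXn2r _ 2)// ?nnegrE ?enorm_ge0//.
by rewrite -[in leRHS](rV_insert_col' i z) sqr_enorm_rV_insert lerDr sqr_ge0.
Qed.

End graph_coordinates.

(** * The graph over the tangent hyperplane as a barrier *)

Section graph_barrier.
Context {R : realType} {n : nat}.
Variables (Omega : set 'rV[R]_n.+1) (y : 'rV[R]_n.+1) (Q : 'M[R]_n.+1).
Variable phi : 'rV[R]_n -> R.
Hypotheses (Omega_open : open Omega) (bdy : boundary Omega y).
Hypotheses (graph : local_graph Omega y Q phi) (grad0 : gradient phi 0 = 0).
Local Notation delta := (dist_compl Omega).

Let Oy : ~ Omega y.
Proof. by case: bdy => _; move/interior_id : Omega_open => ->. Qed.

Let compl0 : ~` Omega !=set0. Proof. by exists y. Qed.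

(** Were [phi 0] positive, the graph would stay above [phi 0 / 2] near [y], and [Omega], lying above
    it, would miss a neighbourhood of [y]; were it negative, [y] would belong to [Omega]. The rest
    is the first-order expansion with zero gradient. *)
Lemma graph_flat : phi 0 = 0 /\
  forall e : R, 0 < e -> exists2 d, 0 < d & forall w, enorm w < d ->
    `|phi w| <= e * enorm w.
Proof.
have [rQ [r r0 [C2 gr]]] := graph.
have flat : forall e : R, 0 < e -> exists2 d, 0 < d & forall w, enorm w < d ->
    `|phi w - phi 0| <= e * enorm w.
  move=> e e0.
  have [|d d0 dP] := C1_expansion (@open_enorm_lt _ _ r) _ (CkW C2) e0 (a := 0).
    by rewrite /= enorm0.
  exists d => // w /dP; rewrite add0r (_ : \sum_j _ = 0) ?subr0//.
  apply: big1 => j _; have /rowP/(_ j) := grad0; rewrite !mxE => ->.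
  by rewrite mulr0.
suff phi0 : phi 0 = 0.
  by split=> // e /flat[d d0 dP]; exists d => // w /dP; rewrite phi0 subr0.
apply/eqP; rewrite eq_le; apply/andP; split.
- rewrite leNgt; apply/negP => phi0.
  have [d d0 dP] := flat 1 ltr01.
  pose d' := Num.min r (Num.min d (phi 0 / 2)).
  have d'0 : 0 < d' by rewrite !lt_min r0 d0 divr_gt0.
  case: bdy => /(_ [set x | enorm (x - y) < d'])[].
    have -> : [set x | enorm (x - y) < d'] =
        (fun x : 'rV[R]_n.+1 => enorm (x - y)) @^-1` [set s : R | s < d'] by [].
    apply: open_nbhs_nbhs; split; last by rewrite /= subrr enorm0.
    apply: open_comp; last exact: open_lt.
    move=> x _; apply: lipschitz_continuous => u v.
    by rewrite (le_trans (enorm_lipschitz _ _))// opprB subrKA.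
  move=> x [Ox /=]; rewrite !lt_min => /and3P[xr xd xp].
  have [/(_ Ox) + _] := gr x xr.
  set z := (x - y) *m Q => zP _.
  have nz : enorm z = enorm (x - y) by exact: enorm_rotation.
  have zd : enorm (col' ord_max z) < d.
    by rewrite (le_lt_trans (enorm_col'_le _ _))// nz.
  have := dP _ zd; rewrite mul1r => h.
  have h1 : enorm (col' ord_max z) <= enorm z by exact: enorm_col'_le.
  have := enorm_coord z ord_max.
  rewrite ler_norml => /andP[_ h2].
  move: h; rewrite ler_norml => /andP[h3 _]; lra.
- rewrite leNgt; apply/negP => phi0; apply: Oy.
  apply/gr; first by rewrite subrr enorm0.
  rewrite subrr mul0mx mxE (_ : col' _ _ = 0)//.
  by apply/rowP => j; rewrite !mxE.
Qed.

Lemma graph_compl : exists2 r, 0 < r & forall w (s : R),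
  enorm (rV_insert ord_max s w) < r -> s <= phi w ->
  ~ Omega (y + rV_insert ord_max s w *m Q^T).
Proof.
have [rQ [r r0 [_ gr]]] := graph; exists r => // w s sw sphi.
have [|+ _] := gr (y + rV_insert ord_max s w *m Q^T).
  by rewrite addrC addKr -(enorm_rotation _ rQ) -mulmxA rotation_tr// mulmx1.
rewrite (addrC y) addrK -mulmxA rotation_tr// mulmx1 col'_rV_insert rV_insert_at.
by move=> h /h; rewrite ltNge sphi.
Qed.

(* Compare with the point of the graph on the same vertical line. *)
Lemma dist_compl_le_graph : exists2 r, 0 < r & forall x,
  let z := (x - y) *m Q in
  enorm (rV_insert ord_max (phi (col' ord_max z)) (col' ord_max z)) < r ->
  delta x <= `|z 0 ord_max - phi (col' ord_max z)|.
Proof.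
have [rQ _] := graph; have [r r0 rP] := graph_compl; exists r => // x z zr.
rewrite (le_trans (dist_compl_le x (rP _ _ zr _)))//.
rewrite -(enorm_rotation _ rQ) opprD addrA mulmxDl -/z mulNmx -mulmxA.
rewrite rotation_tr// mulmx1 -[X in enorm (X - _)](rV_insert_col' ord_max) rV_insertB.
by rewrite subrr enorm_rV_insert0.
Qed.

(** If [x - y] had a tangential part, sliding the foot point along the graph in that direction would
    shorten the distance to first order, while flatness makes the change of height small in
    comparison. With no tangential part left, the sign follows: for [x] below the graph, points of
    the normal between [y] and [x] lie in the complement and are closer. *)
Lemma nearest_normal x : Omega x -> delta x = enorm (x - y) ->
  (x - y) *m Q = rV_insert ord_max (delta x) 0.
Proof.
move=> Ox xy; have [rQ _] := graph.
have [phi0 flat] := graph_flat; have [r r0 rP] := graph_compl.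
have D0 : 0 < delta x by exact: dist_compl_gt0.
set D := delta x in xy D0 *; set z := _ *m Q.
have nz : enorm z = D by rewrite /z enorm_rotation.
have cmp w s : enorm (rV_insert ord_max s w) < r -> s <= phi w ->
    D <= enorm (z - rV_insert ord_max s w).
  move=> sw sphi; have := dist_compl_le x (rP w s sw sphi).
  rewrite -(enorm_rotation _ rQ) opprD addrA mulmxDl -/z mulNmx -mulmxA.
  by rewrite rotation_tr// mulmx1.
have zE := rV_insert_col' ord_max z.
set z' := col' ord_max z in zE; set zl := z 0 ord_max in zE.
have z'0 : z' = 0.
  apply: contrapT => /eqP /enorm_gt0 a0; set a := enorm z' in a0.
  (* Sliding by [m / 2] lowers the squared distance by [2 * a * (m / 2)]. With this [e] and
     [m <= a / 4], the three error terms together use up at most half of that gain. *)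
  pose e := Num.min 1 (a / (4 * D)).
  have e0 : 0 < e by rewrite lt_min ltr01 divr_gt0// mulr_gt0.
  have e1 : e <= 1 by rewrite ge_min lexx.
  have eD : e * D <= a / 4.
    have : e <= a / (4 * D) by rewrite ge_min lexx orbT.
    by rewrite ler_pdivlMr ?mulr_gt0// => h; rewrite ler_pdivlMr//; lra.
  have [d d0 dP] := flat e e0.
  pose m := Num.min d (Num.min (r / 2) (a / 4)).
  have m0 : 0 < m by rewrite !lt_min d0 !divr_gt0.
  pose t := m / 2 / a.
  have t0 : 0 < t by rewrite !divr_gt0.
  have ta : t * a = m / 2 by rewrite /t divfK// gt_eqF.
  have md : m <= d by rewrite ge_min lexx.
  have mr : m <= r / 2 by rewrite !ge_min lexx !orbT.
  have ma : m <= a / 4 by rewrite !ge_min lexx !orbT.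
  have nw : enorm (t *: z') = m / 2 by rewrite enormZ gtr0_norm.
  have pz : `|phi (t *: z')| <= e * (m / 2).
    by rewrite -nw; apply: dP; rewrite nw; lra.
  have pz' : `|phi (t *: z')| <= m / 2.
    by rewrite (le_trans pz)// ler_piMl// divr_ge0// ltW.
  have ins : enorm (rV_insert ord_max (phi (t *: z')) (t *: z')) < r.
    by rewrite (le_lt_trans (enorm_rV_insert_le _ _ _))// nw; lra.
  have := cmp _ _ ins (lexx _).
  rewrite -zE rV_insertB -(@ler_pXn2r _ 2)// ?nnegrE ?enorm_ge0 ?(ltW D0)//.
  rewrite sqr_enorm_rV_insert -{2}[z']scale1r -scalerBl enormZ exprMn real_normK ?num_real//.
  have : D ^+ 2 = zl ^+ 2 + a ^+ 2 by rewrite -nz -zE sqr_enorm_rV_insert.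
  move=> ->; rewrite -/a; set f := phi _ in pz pz' *.
  have zlD : `|zl| <= D by rewrite -nz enorm_coord.
  have zf : - (zl * f) <= D * (e * (m / 2)).
    rewrite (le_trans (ler_norm _))// normrN normrM ler_pM//.
  have ff : f ^+ 2 <= (m / 2) ^+ 2.
    by rewrite -[f ^+ 2]real_normK ?num_real// ler_pXn2r// ?nnegrE//; lra.
  have -> : (1 - t) ^+ 2 * a ^+ 2 = a ^+ 2 - 2 * (m / 2) * a + (m / 2) ^+ 2.
    by rewrite -ta; ring.
  have : D * (e * (m / 2)) <= a / 4 * (m / 2).
    have m2 : 0 <= m / 2 by lra.
    by have := ler_wpM2r m2 eD; lra.
  have : (m / 2) ^+ 2 <= a / 4 * (m / 2).
    have m2 : 0 <= m / 2 by lra.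
    have m4 : m / 2 <= a / 4 by lra.
    by have := ler_wpM2r m2 m4; lra.
  have : 0 < a * (m / 2) by rewrite mulr_gt0// divr_gt0.
  rewrite sqrrB; lra.
have zlD : `|zl| = D by rewrite -nz -zE z'0 enorm_rV_insert0.
rewrite -[LHS]/z -zE z'0; congr rV_insert.
have [zl0|zl0] := leP 0 zl; first by rewrite -zlD ger0_norm.
exfalso.
(* The point at height [s * zl] is below the graph, within the chart because [s * D < r], and at
   distance [(1 - s) * D] from [x]. *)
pose s := Num.min (1 / 2) (r / (2 * D)).
have s0 : 0 < s by rewrite lt_min !divr_gt0// mulr_gt0.
have s1 : s <= 1 / 2 by rewrite ge_min lexx.
have sr : s * D < r.
  have : s <= r / (2 * D) by rewrite ge_min lexx orbT.
  by rewrite ler_pdivlMr ?mulr_gt0//; lra.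
have := cmp 0 (s * zl); rewrite enorm_rV_insert0 normrM zlD gtr0_norm// phi0.
move=> /(_ sr); rewrite pmulr_rle0// => /(_ (ltW zl0)).
rewrite -zE z'0 rV_insertB subrr enorm_rV_insert0 -{1}[zl]mul1r -mulrBl normrM zlD.
rewrite ger0_norm; last by lra.
by have := mulr_gt0 s0 D0; rewrite mulrBl; lra.
Qed.

End graph_barrier.

(** * Weak superharmonicity of the distance *)

Section mean_convexity.
Context {R : realType} {n : nat}.
Variable Omega : set 'rV[R]_n.+1.
Hypotheses (n_gt0 : (0 < n)%N) (Omega_open : open Omega).
Hypothesis compl0 : ~` Omega !=set0.
Hypothesis mean_convex : weakly_mean_convex Omega.
Local Notation delta := (dist_compl Omega).

(** The trace is minus the subleading coefficient of the characteristic polynomial, and the diagonal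
    matrix [K] has the same polynomial. *)
Lemma mxtrace_char_poly_prod (A : 'M[R]_n) (kappa : 'I_n -> R) :
  char_poly A = \prod_i ('X - (kappa i)%:P) -> \tr A = \sum_i kappa i.
Proof.
move=> AE; pose K := diag_mx (\row_i kappa i).
have KE : char_poly K = char_poly A.
  rewrite AE char_poly_trig ?diag_mx_is_trig//; apply: eq_bigr => i _.
  by rewrite !mxE eqxx mulr1n.
apply: oppr_inj; rewrite -char_poly_trace// -KE char_poly_trace// mxtrace_diag.
by congr (- _); apply: eq_bigr => i _; rewrite mxE.
Qed.

(* The rows of the first [n] columns of a rotation form a tight frame. *)
Lemma sum_rotation_quadratic (Q : 'M[R]_n.+1) (A : 'M[R]_n) : rotation Q ->
  \sum_i (\sum_j \sum_k (col' ord_max (row i Q)) 0 j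
                      * (col' ord_max (row i Q)) 0 k * A j k) = \tr A.
Proof.
move=> rQ; rewrite exchange_big/= /mxtrace; apply: eq_bigr => j _.
have ortho k : \sum_i (col' ord_max (row i Q)) 0 j * (col' ord_max (row i Q)) 0 k
             = (j == k)%:R :> R.
  have := rotation_tr rQ => /matrixP/(_ (lift ord_max j) (lift ord_max k)).
  rewrite !mxE (inj_eq lift_inj) => <-; apply: eq_bigr => i _.
  by rewrite !mxE.
rewrite exchange_big/=; under eq_bigr do rewrite -mulr_suml ortho.
rewrite (bigD1 j)//= eqxx mul1r big1 ?addr0// => k kj.
by rewrite eq_sym (negPf kj) mul0r.
Qed.

(** In the second difference of the barrier the linear terms [s * Q i ord_max] cancel, leaving minus
    the second difference of [phi] along the projected axis [w i]. Summed over [i], the tight frame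
    identity turns the quadratic parts into [- h^2] times the trace of the Hessian, which is the
    mean curvature. *)
Lemma dist_compl_superharmonic x : Omega x ->
  forall e : R, 0 < e -> exists2 d, 0 < d & forall h : R, 0 < h -> h < d ->
    \sum_(i < n.+1) (delta (x + h *: delta_mx 0 i) + delta (x - h *: delta_mx 0 i)
                     - 2 * delta x) <= e * h ^+ 2.
Proof.
move=> Ox e e0.
have [y Oy xy] := dist_compl_nearest Omega_open compl0 x.
have bdy := nearest_boundary Omega_open compl0 Ox Oy xy.
have D0 := dist_compl_gt0 Omega_open compl0 Ox.
have [H [kappa [Q [phi [gr grad0 charE]]] HE] H0] := mean_convex bdy.
have [rQ [rU rU0 [C2 _]]] := gr.
have [phi0 flat] := graph_flat Omega_open bdy gr grad0.
have [r r0 le_graph] := dist_compl_le_graph gr.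
have normal := nearest_normal Omega_open bdy gr grad0 Ox xy.
pose w i := col' ord_max (row i Q).
have wE i : w i = col' ord_max (delta_mx 0 i *m Q) by rewrite /w rowE.
have w1 i : enorm (w i) <= 1.
  by rewrite wE (le_trans (enorm_col'_le _ _))// enorm_rotation// enorm_delta.
have e'0 : 0 < e / n.+1%:R by rewrite divr_gt0.
have U0 : [set v : 'rV[R]_n | enorm v < rU] 0 by rewrite /= enorm0.
have /choice[d dP] : forall i, exists d : R, 0 < d /\ forall t : R, `|t| < d ->
    `|phi (t *: w i) + phi (- t *: w i) - 2 * phi 0
      - t ^+ 2 * \sum_j \sum_k w i 0 j * w i 0 k * hessian phi 0 j k|
      <= e / n.+1%:R * t ^+ 2.
  move=> i; have [d d0 dP] := second_difference (w i) (@open_enorm_lt _ _ rU) U0 C2 e'0.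
  by exists d.
have [d1 d10 d1P] := flat 1 ltr01.
pose m := Num.min d1 (Num.min (r / 2) (delta x / 2)).
have m0 : 0 < m by rewrite !lt_min d10 !divr_gt0.
exists (\big[Num.min/m]_i d i).
  by apply: lt_bigmin => // i _; have [] := dP i.
move=> h h0 hd.
have hm : h < m by rewrite (lt_le_trans hd)// bigmin_le_id.
move: hm; rewrite !lt_min => /and3P[hd1 hr hD].
have upper i (s : R) : `|s| = h -> delta (x + s *: delta_mx 0 i) <=
    delta x + s * Q i ord_max - phi (s *: w i).
  move=> sh; have := le_graph (x + s *: delta_mx 0 i).
  have -> : (x + s *: delta_mx 0 i - y) *m Q =
      rV_insert ord_max (delta x + s * Q i ord_max) (s *: w i).
    rewrite addrAC mulmxDl normal -scalemxAl -(rowE i Q).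
    rewrite -[X in _ + X](rV_insert_col' ord_max) -[X in _ + X]opprK.
    have -> (a b : R) (u v : 'rV[R]_n) : rV_insert ord_max a u - - rV_insert ord_max b v =
       rV_insert ord_max (a + b) (u + v).
      by apply/rowP => j; rewrite !mxE; case: unliftP => [k|] _; rewrite ?mxE opprK.
    congr (rV_insert _ (_ + _) _); first by rewrite !mxE.
    by rewrite add0r; apply/rowP => j; rewrite !mxE.
  rewrite /= col'_rV_insert rV_insert_at.
  have sw : enorm (s *: w i) <= h by rewrite enormZ sh ler_piMr// ltW.
  have phw : `|phi (s *: w i)| <= h.
    by rewrite (le_trans (d1P _ _)) ?mul1r// (le_lt_trans sw).
  have insr : enorm (rV_insert ord_max (phi (s *: w i)) (s *: w i)) < r.
    by rewrite (le_lt_trans (enorm_rV_insert_le _ _ _))//; lra.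
  move=> /(_ insr)/le_trans; apply; rewrite ger0_norm//.
  have : `|s * Q i ord_max| <= h.
    rewrite normrM sh ler_piMr// ?(ltW h0)//.
    have -> : Q i ord_max = ((delta_mx 0 i : 'rV[R]_n.+1) *m Q) 0 ord_max by rewrite -(rowE i Q) mxE.
    by rewrite (le_trans (enorm_coord _ _))// enorm_rotation// enorm_delta.
  by move: phw; rewrite !ler_norml => /andP[? ?] /andP[? ?]; lra.
have step i : delta (x + h *: delta_mx 0 i) + delta (x - h *: delta_mx 0 i)
     - 2 * delta x <= e / n.+1%:R * h ^+ 2
      - h ^+ 2 * \sum_j \sum_k w i 0 j * w i 0 k * hessian phi 0 j k.
  have [_ /(_ h)] := dP i.
  have hdi : `|h| < d i by rewrite gtr0_norm// (lt_le_trans hd)// bigmin_le_cond.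
  move=> /(_ hdi).
  have := upper i h (gtr0_norm h0); have := upper i (- h).
  rewrite normrN gtr0_norm// !scaleNr => /(_ erefl) ? ?.
  rewrite phi0 mulr0 subr0; move: (e / _ * _) (h ^+ 2 * _) => E B.
  by rewrite ler_norml => /andP[? ?]; lra.
apply: (le_trans (ler_sum _ (fun i _ => step i))).
rewrite sumrB sumr_const card_ord (_ : _ *+ n.+1 = e * h ^+ 2); last first.
  by rewrite -[LHS]mulr_natr mulrAC divfK// pnatr_eq0.
rewrite gerBl -mulr_sumr mulr_ge0 ?sqr_ge0// sum_rotation_quadratic//.
by rewrite (mxtrace_char_poly_prod charE) -HE.
Qed.

End mean_convexity.

(** * Real powers *)

Section real_powers.
Context {R : realType}.
Implicit Types a b c p q s : R.

Lemma continuous_powR_gt0 q s : 0 < s -> {for s, continuous (fun t : R => t `^ q)}.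
Proof.
move=> s0; apply: differentiable_continuous; apply/derivable1_diffP.
by have [] := is_derive1_powR q s0.
Qed.

Lemma continuous_norm_powR q : 0 < q -> continuous (fun t : R => `|t| `^ q).
Proof.
move=> q0 s; have [->|s0] := eqVneq s 0.
  apply/cvgrPdist_lt => e e0; apply/nbhs_ballP; exists (e `^ q^-1).
    by rewrite /= powR_gt0.
  move=> t; rewrite /ball/= sub0r normrN => te.
  rewrite normr0 powR0 ?gt_eqF// sub0r normrN ger0_norm ?powR_ge0//.
  have -> : e = (e `^ q^-1) `^ q by rewrite -powRrM mulVf ?gt_eqF// powRr1// ltW.
  by rewrite gt0_ltr_powR// nnegrE// powR_ge0.
have h1 : {for s, continuous (fun t : R => `|t|)} by exact: norm_continuous.
have h2 : {for `|s|, continuous (fun t : R => t `^ q)}.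
  by apply: continuous_powR_gt0; rewrite normr_gt0.
exact: (continuous_comp h1 h2).
Qed.

Lemma ler_powR_neg q a b : q <= 0 -> 0 < a -> a <= b -> b `^ q <= a `^ q.
Proof.
move=> q0 a0 ab; have b0 : 0 < b by exact: lt_le_trans ab.
rewrite /powR !gt_eqF// ler_expR -subr_ge0 -mulrBr -mulrNN mulr_ge0 ?oppr_ge0//.
by rewrite subr_le0 ler_ln.
Qed.

(** By homogeneity this is the case [a = 1], where [b^q = exp (q * ln b)] lies above [1 + q * ln b],
    and [ln b <= b - 1] is multiplied by [q <= 0]. *)
Lemma powR_tangent_neg q a b : q <= 0 -> 0 < a -> 0 < b ->
  a `^ q + q * a `^ (q - 1) * (b - a) <= b `^ q.
Proof.
move=> q0 a0 b0; have aq : 0 < a `^ q by exact: powR_gt0.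
have -> : b `^ q = a `^ q * (b / a) `^ q.
  by rewrite -powRM ?divr_ge0// ?(ltW a0) ?(ltW b0)// mulrC divfK ?gt_eqF.
have -> : a `^ (q - 1) = a `^ q / a.
  by rewrite powRB; [rewrite powRr1 ?ltW|apply/implyP => _; rewrite gt_eqF].
have -> : a `^ q + q * (a `^ q / a) * (b - a) = a `^ q * (1 + q * (b / a - 1)).
  by field; rewrite gt_eqF.
rewrite ler_pM2l// /powR gt_eqF ?divr_gt0// (le_trans _ (expR_ge1Dx _))//.
rewrite lerD2l -subr_ge0 -mulrBr -mulrNN mulr_ge0 ?oppr_ge0// subr_le0.
have := @expR_ge1Dx R (ln (b / a)); rewrite lnK ?posrE ?divr_gt0//; lra.
Qed.

(** The tangent at the larger of [a] and [b] bounds the increment, and the slope there is at most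
    the slope at [c]. With [q = 1 - p] this replaces [grad d . grad d^(1 - p) = - (p - 1) * d^(- p)
    * |grad d|^2] for difference quotients. *)
Lemma powR_neg_increment q a b c : q <= 0 -> 0 < a -> 0 < b -> a <= c -> b <= c ->
  (b - a) * (b `^ q - a `^ q) <= q * c `^ (q - 1) * (b - a) ^+ 2.
Proof.
move=> q0 a0 b0 ac bc.
have slope s : 0 < s -> s <= c -> q * s `^ (q - 1) <= q * c `^ (q - 1).
  move=> s0 sc; rewrite -subr_ge0 -mulrBr -mulrNN mulr_ge0 ?oppr_ge0// subr_le0.
  by rewrite ler_powR_neg//; lra.
have [ab|ba] := leP a b.
  have T := powR_tangent_neg q0 b0 a0.
  have ab0 : 0 <= b - a by lra.
  apply: (@le_trans _ _ ((b - a) * (q * b `^ (q - 1) * (b - a)))).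
    by rewrite ler_wpM2l//; lra.
  by rewrite mulrCA -expr2 ler_wpM2r ?sqr_ge0// slope.
have T := powR_tangent_neg q0 a0 b0.
have ab0 : 0 <= a - b by lra.
rewrite -mulrNN opprB; apply: (@le_trans _ _ ((a - b) * (q * a `^ (q - 1) * (a - b)))).
  by rewrite ler_wpM2l//; lra.
by rewrite mulrCA -expr2 -[in leRHS]sqrrN opprB ler_wpM2r ?sqr_ge0// slope.
Qed.

(** This is Young's inequality for [b] and [c^(p - 1)], with exponents [p] and [p / (p - 1)]. *)
Lemma powR_tangent p b c : 1 < p -> 0 <= b -> 0 <= c ->
  c `^ p + p * c `^ (p - 1) * (b - c) <= b `^ p.
Proof.
move=> p1 b0 c0; have p0 : 0 < p by lra.
have p10 : 0 < p - 1 by lra.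
pose q := p / (p - 1).
have q0 : 0 < q by rewrite divr_gt0.
have pq : p^-1 + q^-1 = 1 by rewrite /q; field; rewrite !gt_eqF.
have := conjugate_powR b0 (powR_ge0 c (p - 1)) p0 q0 pq.
rewrite -powRrM (_ : (p - 1) * q = p); last by rewrite /q; field; rewrite gt_eqF.
rewrite -(ler_pM2l p0) mulrDr (mulrCA p (b `^ p)) divff ?gt_eqF// mulr1.
rewrite (_ : p * (c `^ p / q) = (p - 1) * c `^ p); last first.
  by rewrite /q; field; rewrite !gt_eqF.
have : p * (c * c `^ (p - 1)) = p * c `^ p by rewrite mulr_powRB1.
lra.
Qed.

(** The derivative [p * |s|^(p - 1) * sgn s] of [|s|^p], split into positive and negative parts so
    that continuity at [0] is apparent. *)
Definition dnorm_powR p s : R := p * (Num.max s 0 `^ (p - 1) - Num.max (- s) 0 `^ (p - 1)).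

Lemma dnorm_powR_continuous p : 1 < p -> continuous (dnorm_powR p).
Proof.
move=> p1 s; have p10 : 0 < p - 1 by lra.
have cm : continuous (fun s : R => Num.max s 0 `^ (p - 1)).
  move=> t; have E : (fun s : R => Num.max s 0 `^ (p - 1)) =
      (fun s => `|s| `^ (p - 1)) \o (fun s => Num.max s 0).
    by apply/funext => u /=; rewrite ger0_norm// le_max lexx orbT.
  rewrite E; apply: continuous_comp; last exact: continuous_norm_powR.
  by apply: (@continuous_max _ _ id (cst 0)); [exact: cvg_id|exact: cst_continuous].
have cN : {for s, continuous (fun s : R => Num.max (- s) 0 `^ (p - 1))}.
  have hN : {for s, continuous (fun s : R => - s)} by exact: opp_continuous.
  exact: (continuous_comp hN (cm (- s))).
exact: (continuousM (@cst_continuous _ _ p s) (continuousB (cm s) cN)).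
Qed.

Lemma dnorm_powR_ge0 p s : 1 < p -> 0 <= s -> dnorm_powR p s = p * s `^ (p - 1).
Proof.
move=> p1 s0; rewrite /dnorm_powR max_l// [Num.max (- s) 0]max_r ?oppr_le0//.
by rewrite powR0 ?subr0//; apply/eqP; lra.
Qed.

Lemma dnorm_powRN p s : dnorm_powR p (- s) = - dnorm_powR p s.
Proof. by rewrite /dnorm_powR opprK -mulrN opprB. Qed.

Lemma norm_dnorm_powR p s : 1 < p -> `|dnorm_powR p s| = p * `|s| `^ (p - 1).
Proof.
move=> p1; have [s0|/ltW s0] := leP 0 s.
  by rewrite dnorm_powR_ge0// !ger0_norm// mulr_ge0 ?powR_ge0//; lra.
rewrite -normrN -dnorm_powRN dnorm_powR_ge0 ?oppr_ge0// (ler0_norm s0) ger0_norm//.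
by rewrite mulr_ge0 ?powR_ge0//; lra.
Qed.

Lemma norm_powR_tangent p a b : 1 < p ->
  `|a| `^ p + dnorm_powR p a * (b - a) <= `|b| `^ p.
Proof.
move=> p1; wlog a0 : a b / 0 <= a.
  move=> h; have [a0|a0] := leP 0 a; first exact: h.
  have na0 : 0 <= - a by lra.
  have := h (- a) (- b) na0; rewrite !normrN dnorm_powRN; lra.
rewrite (le_trans _ (powR_tangent p1 (normr_ge0 b) (normr_ge0 a)))//.
rewrite lerD2l dnorm_powR_ge0// (ger0_norm a0) ler_wpM2l//.
  by rewrite mulr_ge0 ?powR_ge0//; lra.
by rewrite lerD2r ler_norm.
Qed.

(* The convex function [`|s| `^ p] lies between its tangents, so its derivative
   is squeezed by the continuous function [dnorm_powR p]. *)
Lemma is_derive_norm_powR p s : 1 < p ->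
  is_derive s 1 (fun t : R => `|t| `^ p) (dnorm_powR p s).
Proof.
move=> p1; set F := fun t : R => _.
have cv : (fun h : R => h^-1 *: (F (h *: 1 + s) - F s)) @ 0^' --> dnorm_powR p s.
  apply/cvgrPdist_le => e e0.
  have /cvgrPdist_le/(_ e e0) := @dnorm_powR_continuous p p1 s.
  move=> /nbhs_ballP[d /= d0 dP].
  near=> h.
  have h0 : h != 0 by near: h; exact: nbhs_dnbhs_neq.
  have hd : `|h| < d by near: h; exact: dnbhs0_lt.
  have : `|dnorm_powR p s - dnorm_powR p (h + s)| <= e.
    by apply: dP; rewrite /ball/= opprD addrCA subrr addr0 normrN.
  rewrite [h *: 1]mulr1 => le_e.
  have T1 := norm_powR_tangent s (h + s) p1.
  have T2 := norm_powR_tangent (h + s) s p1.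
  rewrite -(ler_pM2l (_ : 0 < `|h|)) ?normr_gt0//.
  rewrite -normrM mulrBr -[h^-1 *: _]/(h^-1 * _) [h * (h^-1 * _)]mulrA divff// mul1r.
  apply: le_trans (_ : `|h * (dnorm_powR p s - dnorm_powR p (h + s))| <= _).
    rewrite /F mulrBr distrC [leRHS]distrC.
    move: T1 T2; rewrite addrK opprD addrCA subrr addr0 => T1 T2.
    move: (`|h + s| `^ p) (`|s| `^ p) T1 T2 => X Y T1 T2.
    by rewrite !ger0_norm; lra.
  by rewrite normrM ler_wpM2l.
by apply: DeriveDef; [apply/cvg_ex; eexists; exact: cv|exact/cvg_lim].
Unshelve. all: by end_near. Qed.

End real_powers.

(** * The integrated inequality, by difference quotients *)

Section discrete_hardy.
Context {R : realType} {n : nat}.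
Local Notation V := 'rV[R]_n.
Implicit Types (x v : V) (i : 'I_n).

(** Translating the backward difference by [v] turns it into minus the forward one, taken against
    the translate of [w]. *)
Lemma Int_summation_by_parts (d w : V -> R) v : continuous d -> Cc w ->
  Int (fun x => (d (x + v) + d (x - v) - 2 * d x) * w x) =
  - Int (fun x => (d (x + v) - d x) * (w (x + v) - w x)).
Proof.
move=> cd Cw.
have tr_cts u : continuous (fun x => d (x + u)).
  move=> x; have cu : {for x, continuous (fun y : V => y + u)}.
    by apply: (@continuousD _ _ _ id (cst u)) => //; exact: cst_continuous.
  exact: (continuous_comp cu (cd (x + u))).
have cD u : continuous (fun x => d (x + u) - d x).
  by move=> x; exact: (continuousB (tr_cts u x) (cd x)).
have C1 : Cc (fun x => (d (x + v) - d x) * w x) by exact: CcMl.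
have C2 : Cc (fun x => (d (x - v) - d x) * w x) by exact: CcMl.
have C3 : Cc (fun x => (d (x + v) - d x) * w (x + v)).
  by apply: CcMl => //; exact: Cc_translate.
transitivity (Int (fun x => (d (x + v) - d x) * w x)
            + Int (fun x => (d (x - v) - d x) * w x)).
  by rewrite -IntD//; apply: eq_Rintegral => x _; ring.
rewrite -(Int_translate v C2).
have -> : Int (fun x => (d (x + v - v) - d (x + v)) * w (x + v)) =
          - Int (fun x => (d (x + v) - d x) * w (x + v)).
  rewrite -mulN1r -IntZ//; apply: eq_Rintegral => x _; rewrite addrK; ring.
rewrite -opprB -IntB//; congr (- _); apply: eq_Rintegral => x _; ring.
Qed.

(** In the application [d] is the truncated distance, [S] the set where [f] does not vanish,
    [A = |f|^p] with partial derivatives [a i], and [G = p * |f|^(p - 1) * |grad f|]. The unit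
    vector [nu] of the semiconcavity hypothesis stands in for the gradient of [d]. *)
Variables (d : V -> R) (r0 p : R) (S : set V).
Variables (A G : V -> R) (a : 'I_n -> V -> R).
Hypotheses (r0_gt0 : 0 < r0) (p_gt1 : 1 < p).
Hypotheses (d_ge : forall x, r0 <= d x).
Hypothesis d_lip : forall x y, `|d x - d y| <= enorm (x - y).
Hypothesis d_semiconcave : forall x, S x -> exists2 nu, enorm nu = 1 &
  forall v, enorm v <= r0 -> d (x + v) <= d x + dot nu v + enorm v ^+ 2 / r0.
Hypothesis d_superharmonic : forall x, S x -> forall e : R, 0 < e ->
  exists2 eta, 0 < eta & forall h : R, 0 < h -> h < eta ->
    \sum_i (d (x + h *: delta_mx 0 i) + d (x - h *: delta_mx 0 i) - 2 * d x)
      <= e * h ^+ 2.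
Hypotheses (CA : Cc A) (A_ge0 : forall x, 0 <= A x) (SA : forall x, ~ S x -> A x = 0).
Hypotheses (Ca : forall i, Cc (a i)) (Sa : forall i x, ~ S x -> a i x = 0).
Hypothesis dA : forall i x (s : R),
  is_derive s 1 (fun t => A (x + t *: delta_mx 0 i)) (a i (x + s *: delta_mx 0 i)).
Hypotheses (CG : Cc G) (G_ge0 : forall x, 0 <= G x).
Hypothesis aG : forall x nu, enorm nu = 1 -> \sum_i nu 0 i * a i x <= G x.

Let e_ i : V := delta_mx 0 i.
(** A sequence, as dominated convergence requires; its members never exceed [r0], the range in which
    semiconcavity is assumed. *)
Let step (k : nat) : R := r0 / k.+1%:R.

Let step_gt0 k : 0 < step k. Proof. exact: divr_gt0. Qed.

Let step_le k : step k <= r0.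
Proof. by rewrite ler_pdivrMr// ler_peMr ?(ltW r0_gt0)// ler1n. Qed.

Let step_cvg0 : step k @[k --> \oo] --> 0.
Proof.
rewrite -[X in _ --> X](mulr0 r0); apply: cvgMl_tmp; exact: cvg_harmonic.
Qed.

Let step_near (e : R) : 0 < e -> \forall k \near \oo, step k < e.
Proof.
move=> e0; have /cvgrPdist_lt/(_ e e0) := step_cvg0.
by apply: filterS => k; rewrite sub0r normrN gtr0_norm.
Qed.

Let d_gt0 x : 0 < d x. Proof. exact: lt_le_trans (d_ge x). Qed.

Let d_continuous : continuous d. Proof. exact: lipschitz_continuous. Qed.

Let translate_continuous (f : V -> R) v : continuous f -> continuous (fun x => f (x + v)).
Proof.
move=> cf x; have cu : {for x, continuous (fun y : V => y + v)}.
  by apply: (@continuousD _ _ _ id (cst v)) => //; exact: cst_continuous.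
exact: (continuous_comp cu (cf (x + v))).
Qed.

Let dpow_continuous (q : R) : continuous (fun x => d x `^ q).
Proof.
move=> x; apply: (@continuous_comp _ _ _ d (fun t : R => t `^ q)).
  exact: d_continuous.
exact: continuous_powR_gt0.
Qed.

Let D i k x := (d (x + step k *: e_ i) - d x) / step k.

Let D_le1 i k x : `|D i k x| <= 1.
Proof.
rewrite normrM normfV (gtr0_norm (step_gt0 k)) ler_pdivrMr// mul1r.
rewrite (le_trans (d_lip _ _))// addrC addKr enormZ enorm_delta mulr1.
by rewrite gtr0_norm.
Qed.

Let D_continuous i k : continuous (D i k).
Proof.
move=> x; have c0 : {for x, continuous d} by exact: d_continuous.
have c1 := @translate_continuous d (step k *: e_ i) d_continuous x.
exact: (continuousM (continuousB c1 c0) (@cst_continuous _ _ (step k)^-1 x)).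
Qed.

Let translate_cvg (f : V -> R) i x : continuous f ->
  f (x + step k *: e_ i) @[k --> \oo] --> f x.
Proof.
move=> cf; have : (x + step k *: e_ i) @[k --> \oo] --> x.
  rewrite -[X in _ --> X]addr0; apply: cvgD; first exact: cvg_cst.
  by rewrite -(scale0r (e_ i)); apply: cvgZr_tmp; exact: step_cvg0.
by move=> h; exact: (cvg_comp _ _ h (cf x)).
Qed.

Let vanishes_translate r v (f : V -> R) : vanishes_off_cube r f ->
  enorm v <= r0 -> vanishes_off_cube (r + r0) (fun x => f (x + v)).
Proof.
move=> vf vr x xr; apply: vf => h; apply: xr => j.
have := h j; rewrite !mxE !subr0 => hj.
rewrite -(addrK (v 0 j) (x 0 j)) (le_trans (ler_normB _ _))// lerD//.
by rewrite (le_trans (enorm_coord _ _)).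
Qed.

Let step_enorm i k : enorm (step k *: e_ i) <= r0.
Proof. by rewrite enormZ enorm_delta mulr1 gtr0_norm. Qed.

Let vanishesW r (f : V -> R) : vanishes_off_cube r f -> vanishes_off_cube (r + r0) f.
Proof. by apply: vanishes_off_cubeW; rewrite lerDl ltW. Qed.

Let cvg0_le (u v : nat -> R) : (forall k, `|u k| <= v k) ->
  v k @[k --> \oo] --> 0 -> u k @[k --> \oo] --> 0.
Proof.
move=> uv v0; apply/cvgrPdist_lt => e e0.
have /cvgrPdist_lt/(_ e e0) := v0; apply: filterS => k; rewrite !sub0r !normrN.
by apply: le_lt_trans; rewrite (le_trans (uv k))// ler_norm.
Qed.

(** The backward minus the forward quotient. On [S] semiconcavity keeps it above
    [- 2 * step k / r0], so that the limit of its integrals against nonnegative weights controls its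
    size. *)
Let gap i k x := (2 * d x - d (x + step k *: e_ i) - d (x - step k *: e_ i)) / step k.

Let gap_continuous i k : continuous (gap i k).
Proof.
move=> x; have c0 : {for x, continuous d} by exact: d_continuous.
have c1 := @translate_continuous d (step k *: e_ i) d_continuous x.
have c2 := @translate_continuous d (- (step k *: e_ i)) d_continuous x.
have c3 := continuousM (@cst_continuous _ _ (2 : R) x) c0.
exact: (continuousM (continuousB (continuousB c3 c1) c2)
  (@cst_continuous _ _ (step k)^-1 x)).
Qed.

(* The forward and backward difference quotients of [d] have asymptotically the
   same integrals, although [d] need not be differentiable. *)
Let Int_gap_cvg0 i (psi : V -> R) : Cc psi ->
  Int (fun x => gap i k x * psi x) @[k --> \oo] --> 0.
Proof.
move=> Cpsi; have [cpsi [r vpsi]] := Cpsi.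
have CcD k : Cc (fun x => psi (x + step k *: e_ i) - psi x).
  by apply: CcB => //; exact: Cc_translate.
have -> : (fun k => Int (fun x => gap i k x * psi x)) =
   (fun k => Int (fun x => D i k x * (psi (x + step k *: e_ i) - psi x))).
  apply/funext => k.
  have := Int_summation_by_parts (step k *: e_ i) d_continuous Cpsi.
  set f1 := fun x => _; set f2 := fun x => _ => f12.
  have Cf1 : Cc f1.
    apply: (CcMl _ Cpsi) => x; have := @gap_continuous i k x => cg.
    have -> : (fun x => d (x + step k *: e_ i) + d (x - step k *: e_ i) - 2 * d x) =
      (fun x => (- step k) * gap i k x).
      by apply/funext => z; rewrite /gap mulNr mulrCA divff ?gt_eqF// mulr1; ring.
    exact: (continuousM (@cst_continuous _ _ (- step k) x) cg).
  have Cf2 : Cc f2.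
    apply: (CcMl _ (CcD k)) => x.
    have -> : (fun x => d (x + step k *: e_ i) - d x) = (fun x => step k * D i k x).
      by apply/funext => z; rewrite /D mulrCA divff ?gt_eqF// mulr1.
    have cD := @D_continuous i k x.
    exact: (continuousM (@cst_continuous _ _ (step k) x) cD).
  transitivity (- (step k)^-1 * Int f1).
    by rewrite -IntZ//; apply: eq_Rintegral => x _; rewrite /f1 /gap; ring.
  rewrite f12 mulrNN -IntZ//; apply: eq_Rintegral => x _; rewrite /f2 /D; ring.
have [M M0 MP] := Cc_bounded Cpsi.
apply: (@Int_dominated_cvg0 _ _ (r + r0) (2 * M)).
- move=> k x; have [/(_ x) c _] := CcD k; have cD := @D_continuous i k x.
  exact: (continuousM cD c).
- move=> k x xr; rewrite (vanishes_translate vpsi (step_enorm i k))//.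
  by rewrite (vanishesW vpsi)// subr0 mulr0.
- move=> k x; rewrite normrM -[leRHS]mul1r ler_pM// (le_trans (ler_normB _ _))//.
  by have := MP x; have := MP (x + step k *: e_ i); lra.
- move=> x; apply: (@cvg0_le _ (fun k => `|psi (x + step k *: e_ i) - psi x|)).
    by move=> k; rewrite normrM ler_piMl.
  apply/norm_cvg0P/subr_cvg0; exact: translate_cvg.
Qed.

Let m x := d x `^ (1 - p).
Let m0 := r0 `^ (1 - p).
Let DA i k x := (A (x + step k *: e_ i) - A x) / step k.

Let m_ge0 x : 0 <= m x. Proof. exact: powR_ge0. Qed.

Let q_le0 : 1 - p <= 0. Proof. by rewrite subr_le0 ltW. Qed.

Let Np_le0 : - p <= 0. Proof. by rewrite oppr_le0 (le_trans _ (ltW p_gt1)). Qed.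

Let m_le x : m x <= m0. Proof. exact: ler_powR_neg. Qed.

Let DA_mean_value i k x : exists2 s : R, `|s| <= step k &
  DA i k x = a i (x + s *: e_ i).
Proof.
have H (s : R) : `|s| <= `|step k| -> is_derive s 1 (fun t => A (x + t *: e_ i))
   (a i (x + s *: e_ i)) by move=> _; exact: dA.
have [s sk] := MVT_between H.
rewrite scale0r addr0 => E; exists s; first by rewrite (le_trans sk)// gtr0_norm.
by rewrite /DA E mulfK// gt_eqF.
Qed.

Let CcDA i k : Cc (fun x => DA i k x - a i x).
Proof.
apply: CcB => //; apply: CcMr; last exact: cst_continuous.
by apply: CcB => //; exact: Cc_translate.
Qed.

Let Int_DA_cvg0 i : Int (fun x => `|DA i k x - a i x|) @[k --> \oo] --> 0.
Proof.
have [M M0 MP] := Cc_bounded (Ca i).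
have [_ [r vA]] := CA; have [ca [s va]] := Ca i.
have vA' : vanishes_off_cube (Num.max r s) A.
  by apply: (vanishes_off_cubeW _ vA); rewrite le_max lexx.
have va' : vanishes_off_cube (Num.max r s) (a i).
  by apply: (vanishes_off_cubeW _ va); rewrite le_max lexx orbT.
apply: (@Int_dominated_cvg0 _ _ (Num.max r s + r0) (2 * M)).
- by move=> k; have [] := Cc_norm (CcDA i k).
- move=> k x xr; rewrite /DA (vanishes_translate vA' (step_enorm i k))//.
  by rewrite (vanishesW vA')// (vanishesW va')// !subrr mul0r subrr normr0.
- move=> k x; rewrite normr_id; have [t _ ->] := DA_mean_value i k x.
  rewrite (le_trans (ler_normB _ _))//.
  by have := MP x; have := MP (x + t *: e_ i); lra.
move=> x; apply/cvgrPdist_lt => e e0.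
have /(@cvgrPdist_lt _ _ _ (nbhs x) (nbhs_filter x))/(_ e e0) := ca x.
move=> /nbhs_ballP[eta /= eta0 etaP].
have := step_near eta0; apply: filterS => k keta.
rewrite sub0r normrN normr_id; have [t tk ->] := DA_mean_value i k x.
rewrite distrC; apply: etaP; rewrite -ball_normE /= opprD addrA subrr add0r normrN.
rewrite (le_lt_trans (mx_norm_le_enorm _))// enormZ enorm_delta mulr1.
exact: le_lt_trans keta.
Qed.

Let Cc_am i k : Cc (fun x => `|a i x| * `|m (x + step k *: e_ i) - m x|).
Proof.
apply: CcMr; first exact: Cc_norm.
move=> x; have c0 : {for x, continuous m} by exact: dpow_continuous.
have c1 := @translate_continuous m (step k *: e_ i) (@dpow_continuous _) x.
exact: (cvg_norm (continuousB c1 c0)).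
Qed.

Let Int_am_cvg0 i :
  Int (fun x => `|a i x| * `|m (x + step k *: e_ i) - m x|) @[k --> \oo] --> 0.
Proof.
have [M M0 MP] := Cc_bounded (Ca i); have [_ [s va]] := Ca i.
apply: (@Int_dominated_cvg0 _ _ s (M * m0)).
- by move=> k; have [] := Cc_am i k.
- by move=> k x xr; rewrite va// normr0 mul0r.
- move=> k x; rewrite normrM !normr_id ler_pM// ler_norml.
  have := m_le x; have := m_le (x + step k *: e_ i).
  by have := m_ge0 x; have := m_ge0 (x + step k *: e_ i); lra.
move=> x; rewrite -[X in _ --> X](mulr0 `|a i x|); apply: cvgMl_tmp.
apply/norm_cvg0P/subr_cvg0; apply: translate_cvg; exact: dpow_continuous.
Qed.

(** The increment of [m] is estimated with the slope at [d x + step k], an upper bound for both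
    values of [d]; this records the loss against the slope at [d x]. *)
Let kappa k x := A x * (d x `^ (- p) - (d x + step k) `^ (- p)).

Let Cc_kappa k : Cc (kappa k).
Proof.
apply: CcMr => // x.
have c0 : {for x, continuous (fun x => d x `^ (- p))} by exact: dpow_continuous.
have c2 : {for x, continuous (fun x => (d x + step k) `^ (- p))}.
  apply: (@continuous_comp _ _ _ (fun x => d x + step k) (fun t : R => t `^ (- p))).
    exact: (continuousD (@d_continuous x) (@cst_continuous _ _ (step k) x)).
  by apply: continuous_powR_gt0; rewrite addr_gt0.
exact: (continuousB c0 c2).
Qed.

Let kappa_ge0 k x : 0 <= kappa k x.
Proof.
by rewrite mulr_ge0// subr_ge0 ler_powR_neg// lerDl ltW.
Qed.

Let Int_kappa_cvg0 : Int (kappa k) @[k --> \oo] --> 0.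
Proof.
have [M M0 MP] := Cc_bounded CA; have [_ [s vA]] := CA.
apply: (@Int_dominated_cvg0 _ _ s (M * r0 `^ (- p))).
- by move=> k; have [] := Cc_kappa k.
- by move=> k x xr; rewrite /kappa vA// mul0r.
- move=> k x; rewrite ger0_norm// ler_pM//.
  + by rewrite subr_ge0 ler_powR_neg// lerDl ltW.
  + by rewrite (le_trans (ler_norm _))// MP.
  rewrite lerBlDr (le_trans (_ : _ <= r0 `^ (- p))) ?lerDl ?powR_ge0//.
  exact: ler_powR_neg.
move=> x; rewrite -[X in _ --> X](mulr0 (A x)); apply: cvgMl_tmp.
apply/norm_cvg0P; under eq_fun do rewrite distrC; apply/norm_cvg0P/subr_cvg0.
have h : (d x + step k) @[k --> \oo] --> d x.
  by rewrite -[X in _ --> X]addr0; apply: cvgD; [exact: cvg_cst|exact: step_cvg0].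
have c := @continuous_powR_gt0 R (- p) _ (d_gt0 x).
have F := @continuous_cvg nat R R \oo _ (fun k => d x + step k) (fun t : R => t `^ (- p)) (d x) c h.
exact: F.
Qed.

(** The weight that multiplies [B] when [D] is replaced by [nu]: once in the first-order term, twice
    in the square, as [D^2 >= nu^2 - 2 * B]. *)
Let psi i x := `|a i x| * m x + 2 * (p - 1) * (A x * d x `^ (- p)).

Let Cc_psi i : Cc (psi i).
Proof.
apply: CcD; first by apply: CcMr; [exact: Cc_norm|exact: dpow_continuous].
by apply: CcZ; apply: CcMr => //; exact: dpow_continuous.
Qed.

(** A bound for [|D - nu|] on [S]: semiconcavity controls the forward quotient from above and the
    backward one from below, each up to [step k / r0], and [gap] links them. The other two units in
    [3] make up for a negative [gap]. *)
Let B i k x := 3 * step k / r0 + gap i k x.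

Let err i k x := `|DA i k x - a i x| * m0
  + `|a i x| * `|m (x + step k *: e_ i) - m x| + B i k x * psi i x
  + (p - 1) * kappa k x.

Let Cc_err1 i k : Cc (fun x => `|DA i k x - a i x| * m0).
Proof. by apply: CcMr; [exact: Cc_norm|exact: cst_continuous]. Qed.

Let Cc_err3 i k : Cc (fun x => B i k x * psi i x).
Proof.
apply: CcMl => // x.
exact: (continuousD (@cst_continuous _ _ (3 * step k / r0) x) (@gap_continuous i k x)).
Qed.

Let Cc_err i k : Cc (err i k).
Proof. by apply: CcD; [apply: CcD; [apply: CcD|]|exact: CcZ]. Qed.

Let Int_err_cvg0 i : Int (err i k) @[k --> \oo] --> 0.
Proof.
have -> : (fun k => Int (err i k)) = (fun k =>
    m0 * Int (fun x => `|DA i k x - a i x|)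
    + Int (fun x => `|a i x| * `|m (x + step k *: e_ i) - m x|)
    + (3 / r0 * Int (psi i) * step k + Int (fun x => gap i k x * psi i x))
    + (p - 1) * Int (kappa k)).
  apply/funext => k; rewrite /err IntD//; last 2 first.
  - by apply: CcD => //; exact: CcD.
  - exact: CcZ.
  rewrite IntD//; last exact: CcD.
  rewrite IntD// IntZ//; congr (_ + _ + _ + _).
    by rewrite -IntZ; [apply: eq_Rintegral => x _; rewrite mulrC|exact: Cc_norm].
  have Cg : Cc (fun x => gap i k x * psi i x) by apply: CcMl => //; exact: gap_continuous.
  rewrite mulrAC -IntZ// -IntD//; last exact: CcZ.
  by apply: eq_Rintegral => x _; rewrite /B; ring.
have -> : 0 = m0 * 0 + 0 + (3 / r0 * Int (psi i) * 0 + 0) + (p - 1) * 0 :> R by ring.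
apply: cvgD; last by apply: cvgMl_tmp; exact: Int_kappa_cvg0.
apply: cvgD.
  by apply: cvgD; [apply: cvgMl_tmp; exact: Int_DA_cvg0|exact: Int_am_cvg0].
by apply: cvgD; [apply: cvgMl_tmp; exact: step_cvg0|exact: Int_gap_cvg0].
Qed.

Let w x := A x * m x.

Let Cc_w : Cc w. Proof. by apply: CcMr => //; exact: dpow_continuous. Qed.

Let lap k x := \sum_i (d (x + step k *: e_ i) + d (x - step k *: e_ i) - 2 * d x).

Let lap_continuous k : continuous (lap k).
Proof.
have -> : lap k = (fun x => \sum_i (- step k) * gap i k x).
  apply/funext => x; apply: eq_bigr => i _.
  by rewrite /gap mulNr mulrCA divff ?gt_eqF// mulr1; ring.
apply: continuous_sum => i x; have cg := @gap_continuous i k x.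
exact: (continuousM (@cst_continuous _ _ (- step k) x) cg).
Qed.

(** Semiconcavity bounds the discrete Laplacian over [step k ^+ 2] from above only, so the positive
    part is what dominated convergence can handle; superharmonicity sends it to zero. *)
Let P k x := w x * Num.max (lap k x / step k ^+ 2) 0.

Let Cc_P k : Cc (P k).
Proof.
apply: CcMr => // x.
apply: (@continuous_max _ _ (fun x => lap k x / step k ^+ 2) (cst 0)).
  have cl := @lap_continuous k x.
  exact: (continuousM cl (@cst_continuous _ _ (step k ^+ 2)^-1 x)).
exact: cst_continuous.
Qed.

Let lap_le k x : S x -> lap k x / step k ^+ 2 <= 2 * n%:R / r0.
Proof.
move=> Sx; have [nu nu1 nuP] := d_semiconcave Sx.
rewrite ler_pdivrMr ?exprn_gt0//.
have -> : 2 * n%:R / r0 * step k ^+ 2 = \sum_(i < n) 2 * (step k ^+ 2 / r0).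
  by rewrite sumr_const card_ord -mulr_natl; ring.
apply: ler_sum => i _.
have := nuP _ (step_enorm i k); have := nuP (- (step k *: e_ i)).
rewrite !enormN => /(_ (step_enorm i k)).
by rewrite dotNr dotZr enormZ enorm_delta mulr1 gtr0_norm//; lra.
Qed.

Let Int_P_cvg0 : Int (P k) @[k --> \oo] --> 0.
Proof.
have [M M0 MP] := Cc_bounded Cc_w; have [_ [s vw]] := Cc_w.
have n0 : 0 <= 2 * n%:R / r0 by rewrite divr_ge0// ?mulr_ge0// ltW.
have w0 x : ~ S x -> w x = 0 by move=> Sx; rewrite /w SA// mul0r.
apply: (@Int_dominated_cvg0 _ _ s (M * (2 * n%:R / r0))).
- by move=> k; have [] := Cc_P k.
- by move=> k x xs; rewrite /P vw// mul0r.
- move=> k x; have [Sx|Sx] := pselect (S x); last first.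
    by rewrite /P w0// mul0r normr0 mulr_ge0.
  rewrite normrM ler_pM// ger0_norm ?le_max ?lexx ?orbT//.
  by rewrite ge_max n0 lap_le.
move=> x; have [Sx|Sx] := pselect (S x); last first.
  by rewrite /P w0//; under eq_fun do rewrite mul0r; exact: cvg_cst.
rewrite -[X in _ --> X](mulr0 (w x)); apply: cvgMl_tmp.
apply/cvgrPdist_le => e e0; have [eta eta0 etaP] := d_superharmonic Sx e0.
have := step_near eta0; apply: filterS => k keta.
rewrite sub0r normrN ger0_norm ?le_max ?lexx ?orbT// ge_max (ltW e0) andbT.
by rewrite ler_pdivrMr ?exprn_gt0//; exact: etaP.
Qed.

Let Dw i k x := D i k x * ((w (x + step k *: e_ i) - w x) / step k).

Let Cc_Dw i k : Cc (Dw i k).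
Proof.
apply: CcMl; first exact: D_continuous.
apply: CcMr; last exact: cst_continuous.
by apply: CcB => //; exact: Cc_translate.
Qed.

(** The discrete form of [int grad d . grad w >= 0], up to the error [P]: summation by parts gives
    minus the integral of [w] times the discrete Laplacian. *)
Let Int_Dw_ge k : - Int (P k) <= \sum_i Int (Dw i k).
Proof.
have E i : Int (Dw i k) = - Int (fun x =>
    (step k ^+ 2)^-1 * ((d (x + step k *: e_ i) + d (x - step k *: e_ i) - 2 * d x) * w x)).
  have Cf : Cc (fun x => (d (x + step k *: e_ i) + d (x - step k *: e_ i) - 2 * d x) * w x).
    have -> : (fun x => (d (x + step k *: e_ i) + d (x - step k *: e_ i) - 2 * d x) * w x)
        = (fun x => gap i k x * (- step k * w x)).
      apply/funext => x; rewrite /gap; field; exact: lt0r_neq0.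
    by apply: CcMl; [exact: gap_continuous|exact: CcZ].
  rewrite IntZ// Int_summation_by_parts// mulrN opprK -IntZ.
    apply: eq_Rintegral => x _; rewrite /Dw /D; field; exact: lt0r_neq0.
  have -> : (fun x => (d (x + step k *: e_ i) - d x) * (w (x + step k *: e_ i) - w x))
    = (fun x => step k ^+ 2 * Dw i k x).
    by apply/funext => x; rewrite /Dw /D; field; exact: lt0r_neq0.
  exact: CcZ.
rewrite (eq_bigr _ (fun i _ => E i)) sumrN lerN2 -Int_sum; last first.
  move=> i; have -> : (fun x => (step k ^+ 2)^-1 *
     ((d (x + step k *: e_ i) + d (x - step k *: e_ i) - 2 * d x) * w x))
      = (fun x => gap i k x * (- (step k)^-1 * w x)).
    by apply/funext => x; rewrite /gap; field; exact: lt0r_neq0.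
  by apply: CcMl; [exact: gap_continuous|exact: CcZ].
have E2 : (fun x => \sum_i (step k ^+ 2)^-1 * ((d (x + step k *: e_ i)
     + d (x - step k *: e_ i) - 2 * d x) * w x)) = (fun x => w x * (lap k x / step k ^+ 2)).
  by apply/funext => x; rewrite -mulr_sumr -mulr_suml -/(lap k x); ring.
rewrite E2; apply: Int_le => //.
  apply: CcMr => // x; have cl := @lap_continuous k x.
  exact: (continuousM cl (@cst_continuous _ _ (step k ^+ 2)^-1 x)).
by move=> x; rewrite /P ler_wpM2l ?le_max ?lexx// mulr_ge0.
Qed.

Let Dw_le i k x : Dw i k x <= `|DA i k x - a i x| * m0
    + `|a i x| * `|m (x + step k *: e_ i) - m x|
    + D i k x * a i x * m x
    - (p - 1) * (A x * (d x + step k) `^ (- p)) * D i k x ^+ 2.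
Proof.
set xp := x + step k *: e_ i.
have sk := step_gt0 k.
(* Discrete product rule for [w = A * m], followed by the replacement of [DA] by [a i] and of [m xp]
   by [m x]. *)
have -> : Dw i k x = D i k x * (DA i k x - a i x) * m xp
    + D i k x * a i x * (m xp - m x) + D i k x * a i x * m x
    + A x * (D i k x * ((m xp - m x) / step k)).
  by rewrite /Dw /w /DA -/xp; ring.
have T1 : D i k x * (DA i k x - a i x) * m xp <= `|DA i k x - a i x| * m0.
  rewrite (le_trans (ler_norm _))// (normrM _ (m xp)) (normrM (D i k x)).
  by rewrite (ger0_norm (m_ge0 xp)) ler_pM ?mulr_ge0 ?m_le// ler_piMl ?D_le1.
have T2 : D i k x * a i x * (m xp - m x) <= `|a i x| * `|m xp - m x|.
  rewrite (le_trans (ler_norm _))// (normrM _ (m xp - m x)) (normrM (D i k x)).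
  by rewrite ler_wpM2r// ler_piMl ?D_le1.
have T3 : D i k x * ((m xp - m x) / step k) <=
    - (p - 1) * (d x + step k) `^ (- p) * D i k x ^+ 2.
  have dd : d xp <= d x + step k.
    have := D_le1 i k x; rewrite /D -/xp ler_norml => /andP[_].
    by rewrite ler_pdivrMr// mul1r; lra.
  have := powR_neg_increment q_le0 (d_gt0 x) (d_gt0 xp) _ dd.
  rewrite lerDl (ltW sk) => /(_ erefl).
  have -> : 1 - p - 1 = - p by ring.
  rewrite -(ler_pM2r (_ : 0 < (step k ^+ 2)^-1)) ?invr_gt0 ?exprn_gt0//.
  rewrite -/(m xp) -/(m x).
  have -> : D i k x * ((m xp - m x) / step k) =
     (d xp - d x) * (m xp - m x) / step k ^+ 2.
    by rewrite /D -/xp; field; exact: lt0r_neq0.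
  have -> : - (p - 1) * (d x + step k) `^ (- p) * D i k x ^+ 2 =
     (1 - p) * (d x + step k) `^ (- p) * (d xp - d x) ^+ 2 / step k ^+ 2.
    by rewrite /D -/xp; field; exact: lt0r_neq0.
  by [].
have := ler_wpM2l (A_ge0 x) T3; lra.
Qed.

(** Once every [D] is replaced by a component of [nu], the first-order terms add up to at most
    [G * m] and the squares to one: this is where [|nu| = 1] enters. Off [S] the functions [A] and
    [a i] vanish. *)
Let sum_Dw_le k x : \sum_i Dw i k x <=
  G x * m x - (p - 1) * (A x * d x `^ (- p)) + \sum_i err i k x.
Proof.
have sk := step_gt0 k.
have cp : (d x + step k) `^ (- p) <= d x `^ (- p).
  by apply: ler_powR_neg; rewrite ?lerDl ?(ltW sk).
have [Sx|Sx] := pselect (S x); last first.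
  rewrite SA// mul0r mulr0 subr0 (@le_trans _ _ (\sum_i err i k x))//.
    apply: ler_sum => i _; rewrite (le_trans (Dw_le i k x))// /err /psi /kappa.
    by rewrite SA// Sa// normr0 !(mul0r, mulr0, addr0, subr0, add0r).
  by rewrite lerDr mulr_ge0.
have [nu nu1 nuP] := d_semiconcave Sx.
have nui i : `|nu 0 i| <= 1 by rewrite -nu1 enorm_coord.
have DB i : `|D i k x - nu 0 i| <= B i k x.
  have := nuP _ (step_enorm i k); have := nuP (- (step k *: e_ i)).
  rewrite !enormN => /(_ (step_enorm i k)).
  rewrite dotNr dotZr dot_delta enormZ enorm_delta mulr1 gtr0_norm// => h1 h2.
  rewrite -(ler_pM2l sk) -{1}(gtr0_norm sk) -normrM mulrBr.
  have -> : step k * D i k x = d (x + step k *: e_ i) - d x.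
    by rewrite /D mulrCA divff ?gt_eqF// mulr1.
  have -> : step k * B i k x = 3 * (step k ^+ 2 / r0) +
    (2 * d x - d (x + step k *: e_ i) - d (x - step k *: e_ i)).
    by rewrite /B /gap; field; rewrite !gt_eqF.
  have : 0 <= step k ^+ 2 / r0 by rewrite divr_ge0 ?sqr_ge0// ltW.
  by rewrite ler_norml; move: (step k ^+ 2 / r0) h1 h2 => s2 h1 h2 s20; lra.
pose c := A x * d x `^ (- p).
have c0 : 0 <= c by rewrite mulr_ge0 ?powR_ge0.
have each i : Dw i k x <= err i k x + nu 0 i * a i x * m x - (p - 1) * c * nu 0 i ^+ 2.
  apply: (le_trans (Dw_le i k x)); rewrite /err /psi -/c.
  have Bi := DB i; have B0 : 0 <= B i k x by exact: le_trans Bi.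
  have T1 : D i k x * a i x * m x <= nu 0 i * a i x * m x + B i k x * `|a i x| * m x.
    have : (D i k x - nu 0 i) * a i x * m x <= B i k x * `|a i x| * m x.
      by rewrite ler_wpM2r// (le_trans (ler_norm _))// normrM ler_wpM2r.
    by lra.
  have T2 : nu 0 i ^+ 2 - 2 * B i k x <= D i k x ^+ 2.
    have h1 : - (nu 0 i * (D i k x - nu 0 i)) <= B i k x.
      rewrite (le_trans (ler_norm _))// normrN normrM (le_trans _ Bi)//.
      by rewrite ler_piMl.
    by have := sqr_ge0 (D i k x - nu 0 i); nra.
  have T3 : D i k x ^+ 2 <= 1.
    by rewrite -[D i k x ^+ 2]real_normK ?num_real// expr_le1.
  have T4 : c - kappa k x = A x * (d x + step k) `^ (- p).
    by rewrite /c /kappa; ring.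
  rewrite -T4.
  have p10 : 0 <= p - 1 by rewrite subr_ge0 ltW.
  have T5 : (p - 1) * c * (nu 0 i ^+ 2 - 2 * B i k x) <= (p - 1) * c * D i k x ^+ 2.
    by rewrite ler_wpM2l// mulr_ge0.
  have T6 : (p - 1) * kappa k x * D i k x ^+ 2 <= (p - 1) * kappa k x.
    by rewrite ler_piMr// mulr_ge0.
  lra.
apply: (le_trans (ler_sum _ (fun i _ => each i))).
have S1 : \sum_i nu 0 i * a i x * m x = (\sum_i nu 0 i * a i x) * m x.
  by rewrite mulr_suml.
have S2 : \sum_i (p - 1) * c * nu 0 i ^+ 2 = (p - 1) * c.
  rewrite -mulr_sumr (_ : \sum_i _ = 1) ?mulr1//.
  by have := sqr_enorm nu; rewrite nu1 expr1n => ->; apply: eq_bigr => i _; rewrite expr2.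
rewrite sumrB big_split/= S1 S2 -[X in _ <= X]addrC addrA lerD2r lerD2l.
by rewrite ler_wpM2r// aG.
Qed.

Theorem discrete_hardy :
  (p - 1) * Int (fun x => A x * d x `^ (- p)) <= Int (fun x => G x * d x `^ (1 - p)).
Proof.
have CGm : Cc (fun x => G x * m x) by apply: CcMr => //; exact: dpow_continuous.
have CAd : Cc (fun x => A x * d x `^ (- p)) by apply: CcMr => //; exact: dpow_continuous.
have key k : (p - 1) * Int (fun x => A x * d x `^ (- p)) <=
    Int (fun x => G x * m x) + (\sum_i Int (err i k) + Int (P k)).
  have := Int_Dw_ge k; rewrite -Int_sum// => h.
  have : Int (fun x => \sum_i Dw i k x) <=
     Int (fun x => G x * m x - (p - 1) * (A x * d x `^ (- p)) + \sum_i err i k x).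
    apply: Int_le; [exact: Cc_sum| |exact: sum_Dw_le].
    by apply: CcD; [apply: CcB => //; exact: CcZ|exact: Cc_sum].
  move=> /(le_trans h); rewrite IntD; last 2 first.
  - by apply: CcB => //; exact: CcZ.
  - exact: Cc_sum.
  rewrite (Int_sum _ (Cc_err^~ k)) IntB ?IntZ//; last exact: CcZ.
  lra.
have cv : (\sum_i Int (err i k) + Int (P k)) @[k --> \oo] --> (\sum_(i < n) 0 + 0 : R).
  apply: cvgD; last exact: Int_P_cvg0.
  by apply: cvg_big => [|i _]; [exact: add_continuous|exact: Int_err_cvg0].
rewrite big1// addr0 in cv.
apply/ler_addgt0Pr => e e0.
have /cvgrPdist_lt/(_ e e0)[N _ /(_ N (leqnn N))] := cv.
rewrite sub0r normrN ltr_norml => /andP[_ hN].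
by rewrite (le_trans (key N))// lerD2l ltW.
Qed.

End discrete_hardy.

(** * The Hardy inequality *)

Section positive_integral.
Context {R : realType} {n : nat}.

Lemma Int_gt0 (g : 'rV[R]_n -> R) x0 : Cc g -> (forall x, 0 <= g x) ->
  0 < g x0 -> 0 < Int g.
Proof.
move=> Cg g0 gx0; have [cg _] := Cg.
have ge0 : 0 < g x0 / 2 by rewrite divr_gt0.
have /(@cvgrPdist_lt _ _ _ (nbhs x0) (nbhs_filter x0))/(_ _ ge0) := cg x0.
move=> /nbhs_ballP[r /= r0 rP].
have cubeP x : cube x0 (r / 2) x -> g x0 / 2 <= g x.
  move=> xr; have : `|g x0 - g x| < g x0 / 2.
    apply: rP; rewrite -ball_normE /= (@le_lt_trans _ _ (r / 2))//.
      rewrite [leLHS]/Num.Def.normr/= mx_normrE; apply/bigmax_leP; split=> /=.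
        by rewrite divr_ge0// ltW.
      by move=> [i j] _; rewrite (ord1 i) !mxE distrC; exact: xr.
    by rewrite ltr_pdivrMr// ltr_pMr// ltr1n.
  by rewrite ltr_norml => /andP[_ h]; lra.
have mc : measurable (cube x0 (r / 2)) by exact: measurable_cube.
have : (((g x0 / 2) * (2 * (r / 2)) ^+ n)%:E <=
        \int[lebesgue_rV n]_x (g x)%:E)%E.
  rewrite EFinM -(lebesgue_cube x0); last by rewrite divr_ge0// ltW.
  rewrite -[leLHS]integral_cst// integral_mkcond/=.
  apply: ge0_le_integral => //.
  - by move=> x _; rewrite patchE; case: ifP => // _; rewrite lee_fin ltW.
  - apply/(measurable_restrictT _ mc); exact: measurable_cst.
  - by case/integrableP: (Cc_integrable Cg).
  - move=> x _; rewrite patchE; case: ifPn => [/set_mem xr|_]; rewrite lee_fin//.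
    exact: cubeP.
have fin : (\int[lebesgue_rV n]_x (g x)%:E \is a fin_num)%E.
  exact: (integrable_fin_num measurableT (Cc_integrable Cg)).
rewrite -(fineK fin) lee_fin; apply: lt_le_trans.
by rewrite mulr_gt0// exprn_gt0//; lra.
Qed.

End positive_integral.

Lemma gradient_off_support {R : realType} n (f : 'rV[R]_n -> R) x :
  ~ closure [set x | f x != 0] x -> gradient f x = 0.
Proof.
move=> xS; have oS : open (~` closure [set x | f x != 0]).
  by apply: closed_openC; exact: closed_closure.
have nS := open_nbhs_nbhs (conj oS xS).
apply/rowP => i; rewrite !mxE /partial -(@derive_cst R 'rV[R]_n R 0 x (delta_mx 0 i)).
apply: near_eq_derive; apply: filterS nS => z zS; apply: contrapT => fz; apply: zS.
by apply: subset_closure; exact/eqP.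
Qed.

Lemma enorm_gradient_continuous {R : realType} n (f : 'rV[R]_n -> R) :
  (forall i, continuous (partial i f)) -> continuous (fun x => enorm (gradient f x)).
Proof.
move=> cf.
have -> : (fun x => enorm (gradient f x)) =
    (fun x => Num.sqrt (\sum_i partial i f x ^+ 2)).
  apply/funext => x; rewrite /enorm; congr Num.sqrt.
  by apply: eq_bigr => i _; rewrite mxE.
have cs : continuous (fun x => \sum_i partial i f x ^+ 2).
  apply: continuous_sum => i x; have cp := cf i x.
  under eq_fun do rewrite expr2.
  exact: (continuousM cp cp).
move=> x; exact: (@continuous_comp _ _ _ _ Num.sqrt x (cs x) (@sqrt_continuous R _)).
Qed.

(** * The inequality and its strictness for a test function *)

Section hardy_for_test_functions.
Context {R : realType} {n : nat}.
Variables (Omega : set 'rV[R]_n.+1) (p : R) (f : 'rV[R]_n.+1 -> R).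
Hypotheses (n_gt0 : (0 < n)%N) (Omega_open : open Omega).
Hypothesis compl0 : ~` Omega !=set0.
Hypothesis mean_convex : weakly_mean_convex Omega.
Hypotheses (p_gt1 : 1 < p) (tf : test_function Omega f).
Local Notation delta := (dist_compl Omega).
Local Notation S := [set x | f x != 0].

Let f_continuous : continuous f.
Proof. by have [/(_ 0%N)[cf _] _ _] := tf; move=> x; exact: cf. Qed.

Let partial_continuous i : continuous (partial i f).
Proof.
have [/(_ 1%N)[_ /(_ i)[_ [cf _]]] _ _] := tf.
by move=> x; exact: cf.
Qed.

Let f_derivable i x : derivable f x (delta_mx 0 i).
Proof. by have [/(_ 1%N)[_ /(_ i)[df _]] _ _] := tf; exact: df. Qed.

Let dist_lower : exists2 r : R, 0 < r & forall x, f x != 0 -> r <= delta x.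
Proof.
have [_ cS SO] := tf.
have [S0|S0] := pselect (closure S !=set0); last first.
  exists 1 => // x fx; exfalso; apply: S0; exists x; exact: subset_closure.
have [x /set_mem Sx xmin] := EVT_min_rV S0 cS
  (continuous_subspaceT (dist_compl_continuous Omega_open compl0)).
exists (delta x); first exact: (dist_compl_gt0 Omega_open compl0 (SO _ Sx)).
by move=> z fz; apply: xmin; apply/mem_set; exact: subset_closure.
Qed.

(** The factor [3] leaves room for displacements of length [r0] within the region where the
    truncation of the distance at [r0] is inactive. The informative form allows [r0] to be defined
    by projection. *)
Let r0_sig : {r0 : R | 0 < r0 /\ forall x, f x != 0 -> 3 * r0 <= delta x}.
Proof.
have [r r_gt0 rP] := cid2 dist_lower.
exists (r / 3); split=> [|x fx]; first by rewrite divr_gt0.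
by rewrite mulrCA divff ?mulr1 ?rP.
Qed.

Let r0 := sval r0_sig.

Let r0_gt0 : 0 < r0. Proof. by have [] := svalP r0_sig. Qed.

Let dist_ge x : f x != 0 -> 3 * r0 <= delta x.
Proof. by have [_] := svalP r0_sig; apply. Qed.

(* Truncating the distance away from zero changes nothing near the support. *)
Let d x := Num.max (delta x) r0.

Let d_ge x : r0 <= d x. Proof. by rewrite le_max lexx orbT. Qed.

Let d_eq x : f x != 0 -> d x = delta x.
Proof. by move=> /dist_ge h; rewrite /d max_l//; have := r0_gt0; lra. Qed.

Let d_lip x y : `|d x - d y| <= enorm (x - y).
Proof.
have h u v : d u <= d v + enorm (u - v).
  have dv : delta v <= d v by rewrite le_max lexx.
  have := dist_compl_lipschitz Omega_open compl0 u v.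
  rewrite ler_norml => /andP[_]; rewrite lerBlDl => h1.
  rewrite ge_max (le_trans h1) ?lerD2r//=.
  by rewrite (le_trans (d_ge v))// lerDl enorm_ge0.
rewrite ler_norml lerBlDl h andbT lerBrDl lerBlDr enormB.
exact: h.
Qed.

Let in_Omega x : f x != 0 -> Omega x.
Proof. by have [_ _ SO] := tf => fx; apply: SO; exact: subset_closure. Qed.

Let d_semiconcave x : S x -> exists2 nu, enorm nu = 1 &
  forall v, enorm v <= r0 -> d (x + v) <= d x + dot nu v + enorm v ^+ 2 / r0.
Proof.
move=> fx; have Ox := in_Omega fx.
have [y Oy xy] := dist_compl_nearest Omega_open compl0 x.
have d0 := dist_compl_gt0 Omega_open compl0 Ox.
have nu1 : enorm ((delta x)^-1 *: (x - y)) = 1.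
  by rewrite enormZ -xy gtr0_norm ?invr_gt0// mulVf// gt_eqF.
exists ((delta x)^-1 *: (x - y)) => // v vr.
rewrite (d_eq fx) ge_max; apply/andP; split.
  rewrite (le_trans (dist_compl_semiconcave Omega_open compl0 v Ox xy Oy))//.
  rewrite lerD2l ler_wpM2l ?sqr_ge0// lef_pV2 ?posrE ?mulr_gt0//.
  by have := dist_ge fx; have := r0_gt0; lra.
(* The constant branch of the maximum: moving by at most [r0] costs at most [r0], out of the
   available [3 * r0]. *)
have h : - dot ((delta x)^-1 *: (x - y)) v <= enorm v.
  by rewrite -dotNl (le_trans (cauchy_schwarz _ _))// enormN nu1 mul1r.
have : 0 <= enorm v ^+ 2 / r0 by rewrite divr_ge0 ?sqr_ge0// ltW.
by have := dist_ge fx; have := r0_gt0; lra.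
Qed.

Let d_superharmonic x : S x -> forall e : R, 0 < e ->
  exists2 eta, 0 < eta & forall h : R, 0 < h -> h < eta ->
    \sum_i (d (x + h *: delta_mx 0 i) + d (x - h *: delta_mx 0 i) - 2 * d x)
      <= e * h ^+ 2.
Proof.
move=> fx e e0; have Ox := in_Omega fx.
have [eta eta0 etaP] := dist_compl_superharmonic n_gt0 Omega_open compl0 mean_convex Ox e0.
exists (Num.min eta r0); first by rewrite lt_min eta0 r0_gt0.
move=> h h0; rewrite lt_min => /andP[h1 h2].
have near_d v : enorm v <= r0 -> d (x + v) = delta (x + v).
  move=> vr; rewrite /d max_l//.
  have := dist_compl_lipschitz Omega_open compl0 (x + v) x.
  rewrite (addrC _ (- x)) addKr ler_norml => /andP[h3 _].
  by have := dist_ge fx; have := r0_gt0; lra.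
rewrite (le_trans _ (etaP h h0 h1))//; apply: ler_sum => i _.
by rewrite (d_eq fx) !near_d// ?enormN enormZ enorm_delta mulr1 gtr0_norm// ltW.
Qed.

Let Cc_f : Cc f.
Proof.
split=> //; have [_ /compact_sub_cube[r _ rS] _] := tf.
exists r => x xr; apply: contrapT => fx; apply/xr/rS/subset_closure; exact/eqP.
Qed.

Let p_gt0 : 0 < p. Proof. exact: lt_trans p_gt1. Qed.
Let p1_gt0 : 0 < p - 1. Proof. by rewrite subr_gt0. Qed.

Let A x := `|f x| `^ p.
Let a i x := dnorm_powR p (f x) * partial i f x.

Let Cc_comp (g : R -> R) : continuous g -> g 0 = 0 -> Cc (fun x => g (f x)).
Proof.
move=> cg g0; have [cf [r vf]] := Cc_f; split.
  move=> x; exact: (@continuous_comp _ _ _ f g x (@f_continuous x) (cg (f x))).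
by exists r => x xr; rewrite vf.
Qed.

Let CA : Cc A.
Proof.
apply: (@Cc_comp (fun s => `|s| `^ p)); first exact: continuous_norm_powR.
by rewrite normr0 powR0// gt_eqF.
Qed.

Let dnorm_powR0 : dnorm_powR p 0 = 0.
Proof. by rewrite dnorm_powR_ge0// powR0 ?mulr0// gt_eqF. Qed.

Let Ca i : Cc (a i).
Proof.
apply: CcMr; last exact: partial_continuous.
by apply: Cc_comp => //; exact: dnorm_powR_continuous.
Qed.

Let dA i x (s : R) :
  is_derive s 1 (fun t => A (x + t *: delta_mx 0 i)) (a i (x + s *: delta_mx 0 i)).
Proof.
apply: (@is_derive1_comp R (fun s => `|s| `^ p) (fun t => f (x + t *: delta_mx 0 i))).
  exact: is_derive_norm_powR.
exact: is_derive_line.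
Qed.

Let grad x := enorm (gradient f x).

Let grad_continuous : continuous grad.
Proof. exact: enorm_gradient_continuous. Qed.

Let G x := p * `|f x| `^ (p - 1) * grad x.

Let CG : Cc G.
Proof.
apply: CcMr => //; apply: CcZ; apply: (@Cc_comp (fun s => `|s| `^ (p - 1))).
  exact: continuous_norm_powR.
by rewrite normr0 powR0// gt_eqF.
Qed.

Let aG x nu : enorm nu = 1 -> \sum_i nu 0 i * a i x <= G x.
Proof.
move=> nu1; have -> : \sum_i nu 0 i * a i x = dnorm_powR p (f x) * dot nu (gradient f x).
  by rewrite mulr_sumr; apply: eq_bigr => i _; rewrite /a mxE mulrCA.
rewrite /G -norm_dnorm_powR// (le_trans (ler_norm _))// normrM ler_wpM2l//.
rewrite ler_norml; apply/andP; split.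
  rewrite lerNl -dotNl (le_trans (cauchy_schwarz _ _))// enormN nu1 mul1r//.
by rewrite (le_trans (cauchy_schwarz _ _))// nu1 mul1r.
Qed.

Let q x := A x * d x `^ (- p).
Let g x := G x * d x `^ (1 - p).

Let dpow_continuous (s : R) : continuous (fun x => d x `^ s).
Proof.
move=> x; apply: (@continuous_comp _ _ _ d (fun t : R => t `^ s)).
  by apply: lipschitz_continuous => u v; exact: d_lip.
by apply: continuous_powR_gt0; exact: lt_le_trans (d_ge x).
Qed.

Let Cc_q : Cc q. Proof. by apply: CcMr => //; exact: dpow_continuous. Qed.
Let Cc_g : Cc g. Proof. by apply: CcMr => //; exact: dpow_continuous. Qed.

Let q_le_g : (p - 1) * Int q <= Int g.
Proof.
apply: (@discrete_hardy _ _ d r0 p S A G a) => //.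
- by move=> x; exact: powR_ge0.
- move=> x fx; rewrite /A; have -> : f x = 0 by apply: contrapT => /eqP.
  by rewrite normr0 powR0// gt_eqF.
- move=> i x fx; rewrite /a; have -> : f x = 0 by apply: contrapT => /eqP.
  by rewrite dnorm_powR0 mul0r.
- by move=> x; rewrite /G !mulr_ge0 ?powR_ge0 ?enorm_ge0// ltW.
Qed.

Let e x := grad x `^ p.

Let grad_off x : ~ closure S x -> grad x = 0.
Proof.
by move=> xS; rewrite /grad gradient_off_support ?enorm0.
Qed.

Let Cc_e : Cc e.
Proof.
split.
  move=> x; have -> : e = (fun s => `|s| `^ p) \o grad.
    by apply/funext => z; rewrite /e /= ger0_norm// enorm_ge0.
  apply: continuous_comp; first exact: grad_continuous.
  exact: continuous_norm_powR.
have [_ /compact_sub_cube[r _ rS] _] := tf.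
exists r => x xr; rewrite /e grad_off ?powR0 ?gt_eqF// => /rS; exact.
Qed.

Let alpha := (p - 1) / p.
Let alpha_gt0 : 0 < alpha. Proof. exact: divr_gt0. Qed.

(* The gap between [s `^ p], at [s = |grad f|], and its tangent line at
   [alpha * |f| / d], see [tangentE]. *)
Let rest x := e x - alpha `^ p * q x - alpha `^ (p - 1) * (g x - (p - 1) * q x).

(** Since [p * alpha = p - 1], the term [p * c^p] of the tangent is [alpha^(p - 1) * (p - 1) * q],
    so [g] and [q] occur in the combination whose integral is nonnegative by [q_le_g]. *)
Let tangentE x : let c := alpha * (`|f x| / d x) in
  c `^ p + p * c `^ (p - 1) * (grad x - c) =
  alpha `^ p * q x + alpha `^ (p - 1) * (g x - (p - 1) * q x).
Proof.
have d0 : 0 < d x by exact: lt_le_trans (d_ge x).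
have dV (s : R) : (`|f x| / d x) `^ s = `|f x| `^ s * d x `^ (- s).
  by rewrite powRM// ?invr_ge0 ?(ltW d0)// -powR_inv1 ?(ltW d0)// -powRrM mulN1r.
move=> c; rewrite /q /g /G /A.
have cE (s : R) : c `^ s = alpha `^ s * (`|f x| `^ s * d x `^ (- s)).
  by rewrite /c powRM ?dV ?divr_ge0 ?(ltW d0)// ltW.
have c0 : 0 <= c by rewrite /c mulr_ge0 ?divr_ge0// ltW.
have := mulr_powRB1 c0 p_gt0.
rewrite !cE opprB => cc.
have -> : p * (alpha `^ (p - 1) * (`|f x| `^ (p - 1) * d x `^ (1 - p))) * (grad x - c) =
  p * (alpha `^ (p - 1) * (`|f x| `^ (p - 1) * d x `^ (1 - p))) * grad x
   - p * (c * (alpha `^ (p - 1) * (`|f x| `^ (p - 1) * d x `^ (1 - p)))) by ring.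
rewrite cc -(mulr_powRB1 (ltW alpha_gt0) p_gt0).
have pa : p * alpha = p - 1 by rewrite /alpha mulrC divfK// gt_eqF.
rewrite (_ : p * (alpha * _ * _) = (p * alpha) * (alpha `^ (p - 1) *
   (`|f x| `^ p * d x `^ (- p)))); last by ring.
by rewrite pa; ring.
Qed.

Let rest_ge0 x : 0 <= rest x.
Proof.
rewrite /rest -addrA -opprD -tangentE subr_ge0; apply: powR_tangent => //.
  exact: enorm_ge0.
apply: mulr_ge0; first exact: ltW.
by apply: divr_ge0 => //; exact: ltW (lt_le_trans r0_gt0 (d_ge x)).
Qed.

Let Cc_rest : Cc rest.
Proof. by apply: CcB; [apply: CcB => //|]; apply: CcZ => //; apply: CcB => //; exact: CcZ. Qed.

Let Int_rest : Int e - alpha `^ p * Int q >= Int rest.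
Proof.
have Cq : Cc (fun x => (p - 1) * q x) by exact: CcZ.
have Cgq : Cc (fun x => g x - (p - 1) * q x) by exact: CcB.
have Caq : Cc (fun x => alpha `^ p * q x) by exact: CcZ.
have Cag : Cc (fun x => alpha `^ (p - 1) * (g x - (p - 1) * q x)) by exact: CcZ.
rewrite /rest IntB//; last exact: CcB.
rewrite IntB// !IntZ// IntB// IntZ// gerBl mulr_ge0 ?powR_ge0// subr_ge0.
exact: q_le_g.
Qed.

Let energyE : (\int[lebesgue_rV n.+1]_(x in Omega) (enorm (gradient f x) `^ p)%:E
  = (Int e)%:E)%E.
Proof.
rewrite /Int fineK; last exact: (integrable_fin_num measurableT (Cc_integrable Cc_e)).
rewrite [LHS]integral_mkcond; apply: eq_integral => x _; rewrite patchE.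
case: ifPn => // /negP xO; rewrite /e grad_off ?powR0 ?gt_eqF//.
by have [_ _ SO] := tf => /SO Ox; apply: xO; exact/mem_set.
Qed.

Let hardyE : (\int[lebesgue_rV n.+1]_(x in Omega)
   ((`|f x| `^ p) / (dist_compl Omega x `^ p))%:E = (Int q)%:E)%E.
Proof.
rewrite /Int fineK; last exact: (integrable_fin_num measurableT (Cc_integrable Cc_q)).
have q0 x : f x = 0 -> q x = 0.
  by move=> fx; rewrite /q /A fx normr0 powR0 ?mul0r// gt_eqF.
rewrite [LHS]integral_mkcond; apply: eq_integral => x _; rewrite patchE.
have [fx|fx] := eqVneq (f x) 0.
  by rewrite q0//; case: ifP => // _; rewrite fx normr0 powR0 ?mul0r// gt_eqF.
rewrite ifT; last by apply/mem_set; exact: in_Omega.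
rewrite /q d_eq//; congr (_ * _)%:E.
by rewrite -powR_inv1 ?powR_ge0// -powRrM mulrN1.
Qed.

Local Notation energy :=
  (\int[lebesgue_rV n.+1]_(x in Omega) (enorm (gradient f x) `^ p)%:E)%E.
Local Notation hardy := (\int[lebesgue_rV n.+1]_(x in Omega)
   ((`|f x| `^ p) / (dist_compl Omega x `^ p))%:E)%E.

Lemma hardy_inequality : ((((p - 1) / p) `^ p)%:E * hardy <= energy)%E.
Proof.
rewrite energyE hardyE -EFinM lee_fin -subr_ge0 (le_trans _ Int_rest)//.
by apply: Rintegral_ge0 => x _; exact: rest_ge0.
Qed.

Let gradient_max x0 : (forall x, A x <= A x0) -> f x0 != 0 -> grad x0 = 0.
Proof.
move=> max0 fx0; rewrite /grad (_ : gradient f x0 = 0) ?enorm0//.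
apply/rowP => i; rewrite !mxE.
have [|t _|||_ D0] := @derive1_at_max R (fun t => A (x0 + t *: delta_mx 0 i)) (-1) 1 0.
- lra.
- by have [] := dA i x0 t.
- by rewrite in_itv/=; lra.
- by move=> t _; rewrite scale0r addr0; exact: max0.
have [_] := dA i x0 0; rewrite D0 scale0r addr0 /a => /esym/eqP.
rewrite mulf_eq0 => /orP[|/eqP//]; rewrite -normr_eq0 norm_dnorm_powR//.
by rewrite mulf_eq0 gt_eqF//= powR_eq0 normr_eq0 (negPf fx0).
Qed.

Lemma hardy_inequality_strict : (exists x, f x != 0) ->
  ((((p - 1) / p) `^ p)%:E * hardy < energy)%E.
Proof.
move=> [x1 fx1].
rewrite energyE hardyE -EFinM lte_fin -subr_gt0 (lt_le_trans _ Int_rest)//.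
have [_ [r vA]] := CA.
have Ax1 : 0 < A x1 by rewrite powR_gt0// normr_gt0.
have r1 : cube 0 r x1.
  by apply: contrapT => /vA A0; move: Ax1; rewrite A0 ltxx.
have cA : {within cube 0 r, continuous A} by apply: continuous_subspaceT; case: CA.
have [x0 _ x0max] := EVT_max_rV (ex_intro _ x1 r1) (@cube_compact R n.+1 0 r) cA.
have max0 x : A x <= A x0.
  have [xr|xr] := pselect (cube 0 r x); first by apply: x0max; exact/mem_set.
  by rewrite vA// powR_ge0.
have Ax0 : 0 < A x0 by exact: lt_le_trans (max0 x1).
have fx0 : f x0 != 0.
  by apply: contraTneq Ax0 => fx0; rewrite /A fx0 normr0 powR0 ?ltxx// gt_eqF.
apply: (@Int_gt0 _ _ rest x0) => //.
have gr0 := gradient_max max0 fx0.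
have q0 : 0 < q x0 by rewrite mulr_gt0// powR_gt0// (lt_le_trans r0_gt0).
rewrite /rest /g /G /e gr0 powR0 ?gt_eqF// mulr0 mul0r sub0r add0r.
rewrite mulrN opprK -(mulr_powRB1 (ltW alpha_gt0) p_gt0).
(* Where the gradient vanishes the tangent at [c] is compared with the power at [0]; the gap is
   positive because [alpha < p - 1], that is, [1 / p < 1]. *)
have -> : - (alpha * alpha `^ (p - 1) * q x0) + alpha `^ (p - 1) * ((p - 1) * q x0) =
   alpha `^ (p - 1) * q x0 * (p - 1 - alpha) by ring.
apply: mulr_gt0; first by apply: mulr_gt0 => //; exact: powR_gt0.
by rewrite subr_gt0 /alpha ltr_pdivrMr// ltr_pMr.
Qed.

End hardy_for_test_functions.

(** * Smooth cutoffs *)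

Section flat_exponential.
Context {R : realType}.

(** The index closes the family under differentiation: the derivative of a member combines those of
    index [k + 1] and [k + 2], so smoothness at [0] follows by induction. *)
Definition flat (k : nat) (t : R) : R :=
  if 0 < t then t^-1 ^+ k * expR (- t^-1) else 0.

Lemma flat_ge0 k t : 0 <= flat k t.
Proof. by rewrite /flat; case: ifP => // t0; rewrite mulr_ge0 ?expR_ge0// exprn_ge0// invr_ge0 ltW. Qed.

Lemma flat_gt0 k t : 0 < t -> 0 < flat k t.
Proof. by move=> t0; rewrite /flat t0 mulr_gt0 ?expR_gt0// exprn_gt0// invr_gt0. Qed.

Lemma flat_eq0 k t : t <= 0 -> flat k t = 0.
Proof. by move=> t0; rewrite /flat ltNge t0. Qed.

(** One term of the exponential series at [1 / t]. The bound is linear in [t], so [flat k.+1], which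
    for positive [t] is the difference quotient of [flat k] at zero, tends to zero there. *)
Lemma flat_le k t : 0 <= t -> flat k t <= k.+1`!%:R * t.
Proof.
rewrite le_eqVlt => /predU1P[<-|t0]; first by rewrite flat_eq0 ?mulr0.
have s0 : 0 < t^-1 by rewrite invr_gt0.
rewrite /flat t0 expRN ler_pdivrMr ?expR_gt0//.
have E : t^-1 ^+ k.+1 <= k.+1`!%:R * expR t^-1.
  have := expR_ge1Dxn k (ltW s0).
  have f0 : 0 < k.+1`!%:R :> R by rewrite ltr0n fact_gt0.
  move=> h; rewrite mulrC -ler_pdivrMr//; move: h; lra.
rewrite -(ler_pM2l s0) -exprS (le_trans E)// [leRHS](_ : _ = k.+1`!%:R * expR t^-1)//.
by rewrite -mulrA mulrCA mulKf// gt_eqF.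
Qed.

Let is_derive_flat_gt0 k (t : R) : 0 < t ->
  is_derive t 1 (fun s => s^-1 ^+ k * expR (- s^-1))
    (- k%:R * (t^-1 ^+ k.+1 * expR (- t^-1)) + t^-1 ^+ k.+2 * expR (- t^-1)).
Proof.
move=> t0; have tn0 : t != 0 by rewrite gt_eqF.
have dV : is_derive t 1 (fun s : R => s^-1) (- t^-1 ^+ 2).
  have h := @is_deriveV R id t 1 1 tn0 (is_derive_id _ _).
  by apply: (is_derive_eq h); rewrite exprVn /GRing.scale/= mulr1.
elim: k => [|k IHk].
  have -> : (fun s : R => s^-1 ^+ 0 * expR (- s^-1)) = expR \o (fun s => - s^-1).
    by apply/funext => s /=; rewrite expr0 mul1r.
  rewrite oppr0 mul0r add0r mulrC.
  apply: (@is_derive1_comp R expR (fun s => - s^-1)).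
  have := is_deriveN dV; rewrite opprK; exact.
have -> : (fun s : R => s^-1 ^+ k.+1 * expR (- s^-1)) =
   (fun s : R => s^-1) * (fun s => s^-1 ^+ k * expR (- s^-1)).
  by apply/funext => s; rewrite exprS -mulrA.
have h := is_deriveM dV IHk; apply: (is_derive_eq h).
rewrite /GRing.scale/= !exprS -natr1; ring.
Qed.

Lemma is_derive_flat k (t : R) :
  is_derive t 1 (flat k) (- k%:R * flat k.+1 t + flat k.+2 t).
Proof.
have [t0|t0|t0] := ltgtP 0 t.
- rewrite {2 3}/flat t0; apply: near_eq_is_derive (is_derive_flat_gt0 k t0).
  near=> s; rewrite /flat ifT//; near: s; exact: lt_nbhsr.
- rewrite !flat_eq0 ?(ltW t0)// mulr0 addr0.
  apply: near_eq_is_derive (is_derive_cst 0 t 1).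
  near=> s; rewrite flat_eq0//; apply: ltW; near: s; exact: lt_nbhsl.
rewrite -t0 !flat_eq0// mulr0 addr0.
have cv : (fun h : R => h^-1 *: (flat k (h *: 1 + 0) - flat k 0)) @ 0^' --> (0 : R).
  apply/cvgrPdist_lt => e e0.
  have F0 : 0 < k.+2`!%:R :> R by rewrite ltr0n fact_gt0.
  near=> h.
  have h0 : h != 0 by near: h; exact: nbhs_dnbhs_neq.
  have hd : `|h| < e / k.+2`!%:R by near: h; apply: dnbhs0_lt; rewrite divr_gt0.
  rewrite [h *: 1]mulr1 addr0 (@flat_eq0 k 0)// subr0 sub0r normrN.
  rewrite -[h^-1 *: _]/(h^-1 * _).
  have [hp|hn] := ltP 0 h; last by rewrite flat_eq0// mulr0 normr0.
  have -> : h^-1 * flat k h = flat k.+1 h by rewrite /flat hp exprS mulrA.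
  rewrite ger0_norm ?flat_ge0// (le_lt_trans (flat_le _ (ltW hp)))//.
  by rewrite mulrC -ltr_pdivlMr// (le_lt_trans (ler_norm _)).
by apply: DeriveDef; [apply/cvg_ex; exists 0|exact/cvg_lim].
Unshelve. all: by end_near. Qed.

End flat_exponential.

(** * A class of smooth functions given by formulas *)

Section smooth_expressions.
Context {R : realType}.

Lemma is_derive_lineP (V : normedModType R) (f : V -> R) x v (D : R) :
  is_derive x v f D <-> is_derive (0 : R) 1 (fun t => f (x + t *: v)) D.
Proof.
have E : (fun h : R => h^-1 *: (f (x + (h *: (1 : R) + 0 : R) *: v) - f (x + (0 : R) *: v))) =
         (fun h : R => h^-1 *: (f (h *: v + x) - f x)).
  by apply/funext => h; rewrite [h *: 1]mulr1 addr0 scale0r addr0 (addrC x).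
by split=> -[d <-]; apply: DeriveDef; rewrite /derivable /derive /= ?E//;
  move: d; rewrite /derivable /= E.
Qed.

Lemma is_derive_comp_real (V : normedModType R) (f : V -> R) (g : R -> R) x v (a b : R) :
  is_derive (f x) 1 g a -> is_derive x v f b ->
  is_derive x v (fun y => g (f y)) (a * b).
Proof.
move=> dg /is_derive_lineP df; apply/is_derive_lineP.
apply: (@is_derive1_comp R g (fun t => f (x + t *: v))) => //.
by rewrite scale0r addr0.
Qed.

(* A class of functions given by closed formulas, stable under differentiation:
   all its members are therefore infinitely differentiable. *)
Inductive smooth_expr (V : normedModType R) : (V -> R) -> Prop :=
| smooth_cst (c : R) : smooth_expr (fun=> c)
| smooth_linear (l : V -> R) : continuous l ->
    (forall x v (t : R), l (x + t *: v) = l x + t * l v) -> smooth_expr l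
| smoothD f g : smooth_expr f -> smooth_expr g -> smooth_expr (fun x => f x + g x)
| smoothM f g : smooth_expr f -> smooth_expr g -> smooth_expr (fun x => f x * g x)
| smooth_flat k f : smooth_expr f -> smooth_expr (fun x => flat k (f x))
| smooth_powR q f : (forall x, 0 < f x) -> smooth_expr f ->
    smooth_expr (fun x => f x `^ q).

Lemma smooth_expr_continuous (V : normedModType R) (f : V -> R) :
  smooth_expr f -> continuous f.
Proof.
elim=> {f} [c|l cl _|f g _ cf _ cg|f g _ cf _ cg|k f _ cf|q f f0 _ cf] x.
- exact: cst_continuous.
- exact: cl.
- exact: (continuousD (cf x) (cg x)).
- exact: (continuousM (cf x) (cg x)).
- apply: (@continuous_comp _ _ _ f (flat k) x (cf x)).
  apply: differentiable_continuous; apply/derivable1_diffP.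
  by have [] := is_derive_flat k (f x).
- apply: (@continuous_comp _ _ _ f (fun t : R => t `^ q) x (cf x)).
  exact: continuous_powR_gt0.
Qed.

Lemma smooth_expr_derive (V : normedModType R) (f : V -> R) v : smooth_expr f ->
  exists2 f', smooth_expr f' & forall x, is_derive x v f (f' x).
Proof.
elim=> {f} [c|l cl dl|f g _ [f' sf df] _ [g' sg dg]
  |f g f0 [f' sf df] g0 [g' sg dg]|k f f0 [f' sf df]|q f fp f0 [f' sf df]].
- by exists (fun=> 0) => [|x]; [exact: smooth_cst|exact: is_derive_cst].
- exists (fun=> l v); first exact: smooth_cst.
  move=> x; apply/is_derive_lineP; under eq_fun do rewrite dl.
  have h := is_deriveD (is_derive_cst (l x) (0 : R) 1)
    (is_deriveM (is_derive_id (0 : R) 1) (is_derive_cst (l v) (0 : R) 1)).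
  by apply: (is_derive_eq h); rewrite scaler0 !add0r [_ *: 1]mulr1.
- exists (fun x => f' x + g' x); first exact: smoothD.
  by move=> x; exact: (is_deriveD (df x) (dg x)).
- exists (fun x => f x * g' x + g x * f' x); first by apply: smoothD; exact: smoothM.
  by move=> x; exact: (is_deriveM (df x) (dg x)).
- exists (fun x => (- k%:R * flat k.+1 (f x) + flat k.+2 (f x)) * f' x).
    apply: smoothM => //; apply: smoothD; last exact: smooth_flat.
    by apply: smoothM; [exact: smooth_cst|exact: smooth_flat].
  by move=> x; apply: is_derive_comp_real => //; exact: is_derive_flat.
- exists (fun x => q * f x `^ (q - 1) * f' x).
    apply: smoothM => //; apply: smoothM; first exact: smooth_cst.
    exact: smooth_powR.
  move=> x; apply: (@is_derive_comp_real V f (fun t : R => t `^ q)) => //.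
  exact: is_derive1_powR.
Qed.

Lemma smooth_expr_Ck n (f : 'rV[R]_n -> R) : smooth_expr f -> forall k, Ck k setT f.
Proof.
move=> sf k; elim: k f sf => [|k IHk] f sf.
  by split=> // x _; exact: smooth_expr_continuous.
split=> [x _|i]; first exact: smooth_expr_continuous.
have [f' sf' df] := smooth_expr_derive (delta_mx 0 i) sf.
split=> [x _|]; first by have [] := df x.
suff -> : partial i f = f' by exact: IHk.
by apply/funext => x; have [_] := df x.
Qed.

Lemma smooth_id : smooth_expr (fun t : R => t).
Proof.
by apply: smooth_linear => [x|x v t]; [exact: cvg_id|].
Qed.

Lemma smooth_comp (V : normedModType R) (f : R -> R) (g : V -> R) :
  smooth_expr f -> smooth_expr g -> smooth_expr (fun x => f (g x)).
Proof.
move=> sf sg; elim: sf => {f} [c|l cl dl|f g' _ h1 _ h2|f g' _ h1 _ h2|k f _ h|q f f0 _ h].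
- exact: smooth_cst.
- have lE s : l s = l 0 + s * l 1 by rewrite -dl add0r [s *: 1]mulr1.
  under eq_fun do rewrite lE.
  by apply: smoothD; [|apply: smoothM => //]; exact: smooth_cst.
- exact: smoothD.
- exact: smoothM.
- exact: smooth_flat.
- by apply: smooth_powR => // x; exact: f0.
Qed.

Lemma smoothN (V : normedModType R) (f : V -> R) :
  smooth_expr f -> smooth_expr (fun x => - f x).
Proof.
by move=> sf; under eq_fun do rewrite -mulN1r; apply: smoothM => //; exact: smooth_cst.
Qed.

Lemma smoothB (V : normedModType R) (f g : V -> R) :
  smooth_expr f -> smooth_expr g -> smooth_expr (fun x => f x - g x).
Proof. by move=> sf sg; apply: smoothD => //; exact: smoothN. Qed.

Lemma smooth_prod (V : normedModType R) (I : Type) (s : seq I) (P : pred I) (F : I -> V -> R) :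
  (forall i, smooth_expr (F i)) -> smooth_expr (fun x => \prod_(i <- s | P i) F i x).
Proof.
move=> sF; elim: s => [|i s IHs].
  by under eq_fun do rewrite big_nil; exact: smooth_cst.
under eq_fun do rewrite big_cons.
by case: (P i) => //; exact: smoothM.
Qed.

End smooth_expressions.

Section cutoffs.
Context {R : realType}.

(** The quotient is written as a power [-1] to match the constructor [smooth_powR]; its base is
    positive since [1 < t] or [t < 2] always holds. *)
Definition smooth_step (t : R) : R :=
  flat 0 (t - 1) * (flat 0 (t - 1) + flat 0 (2 - t)) `^ (-1).

Let denom_gt0 (t : R) : 0 < flat 0 (t - 1) + flat 0 (2 - t).
Proof.
have [t1|t1] := ltP 1 t.
  by rewrite ltr_pwDl ?flat_ge0// flat_gt0// subr_gt0.
by rewrite ltr_wpDl ?flat_ge0// flat_gt0// subr_gt0; lra.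
Qed.

Lemma smooth_step_smooth : smooth_expr smooth_step.
Proof.
have s1 : smooth_expr (fun t : R => flat 0 (t - 1)).
  by apply: smooth_flat; apply: smoothB; [exact: smooth_id|exact: smooth_cst].
apply: smoothM => //; apply: smooth_powR => //; apply: smoothD => //.
by apply: smooth_flat; apply: smoothB; [exact: smooth_cst|exact: smooth_id].
Qed.

Lemma smooth_stepE t : smooth_step t =
  flat 0 (t - 1) / (flat 0 (t - 1) + flat 0 (2 - t)).
Proof. by rewrite /smooth_step powR_inv1// ltW. Qed.

Lemma smooth_step0 t : t <= 1 -> smooth_step t = 0.
Proof. by move=> t1; rewrite smooth_stepE flat_eq0 ?mul0r// subr_le0. Qed.

Lemma smooth_step1 t : 2 <= t -> smooth_step t = 1.
Proof.
move=> t2; rewrite smooth_stepE (@flat_eq0 _ _ (2 - t)) ?subr_le0// addr0 divff//.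
by rewrite gt_eqF// flat_gt0//; lra.
Qed.

Lemma smooth_step_ge0 t : 0 <= smooth_step t.
Proof. by rewrite smooth_stepE divr_ge0 ?flat_ge0// ltW. Qed.

Lemma smooth_step_le1 t : smooth_step t <= 1.
Proof. by rewrite smooth_stepE ler_pdivrMr// mul1r lerDl flat_ge0. Qed.

Lemma smooth_step_derive : exists ds : R -> R, exists2 K : R, 0 < K &
  [/\ forall t : R, is_derive t 1 smooth_step (ds t), forall t, `|ds t| <= K,
      forall t, t < 1 -> ds t = 0 & forall t, 2 < t -> ds t = 0].
Proof.
have [ds sds dsP] := smooth_expr_derive (1 : R) smooth_step_smooth.
have ds1 t : t < 1 -> ds t = 0.
  move=> t1; have [_ <-] := dsP t.
  rewrite -(@derive_cst R R R 0 t 1); apply: near_eq_derive.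
  near=> s; rewrite smooth_step0//; apply: ltW; near: s; exact: lt_nbhsl.
have ds2 t : 2 < t -> ds t = 0.
  move=> t1; have [_ <-] := dsP t.
  rewrite -(@derive_cst R R R 1 t 1); apply: near_eq_derive.
  near=> s; rewrite smooth_step1//; apply: ltW; near: s; exact: lt_nbhsr.
have cds : {within `[1, 2], continuous (fun t => `|ds t|)}.
  apply: continuous_subspaceT => t.
  exact: (cvg_norm (smooth_expr_continuous sds (x:=t))).
have [c _ cP] := EVT_max (ler1n R 2) cds.
exists ds, (`|ds c| + 1); first by rewrite ltr_wpDl.
split=> // t; have [t1|t1] := ltP t 1; first by rewrite ds1// normr0 addr_ge0.
have [t2|t2] := ltP 2 t; first by rewrite ds2// normr0 addr_ge0.
by rewrite (le_trans (cP t _)) ?lerDl// in_itv/= t1.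
Unshelve. all: by end_near. Qed.

End cutoffs.

(** * Optimality of the constant *)

Section slab_integrals.
Context {R : realType} {n : nat}.
Local Notation mu := (@lebesgue_rV R).
Variables (i : 'I_n.+1) (nu : 'rV[R]_n.+1).
Hypothesis nui : nu 0 i != 0.

Lemma measurable_col' : measurable_fun setT (col' i : 'rV[R]_n.+1 -> 'rV[R]_n).
Proof.
apply: measurable_fun_mxP => k j; under eq_fun do rewrite mxE.
exact: measurable_coord.
Qed.

Lemma dot_continuous (c : R) : continuous (fun x : 'rV[R]_n.+1 => dot x nu + c).
Proof.
have cd : continuous (fun x : 'rV[R]_n.+1 => dot x nu).
  apply: continuous_sum => j x.
  exact: (continuousM (@coord_continuous _ _ _ 0 j x) (@cst_continuous _ _ (nu 0 j) x)).
by move=> x; exact: (continuousD (cd x) (@cst_continuous _ _ c x)).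
Qed.

(** With the other coordinates fixed, the height is affine in coordinate [i] with slope [nu 0 i];
    the shift does not change the inner integral, which thus splits off with the Jacobian
    [1 / |nu 0 i|]. *)
Lemma ge0_integral_slab (c : R) (g : measurableTypeR R -> \bar R) (h : 'rV[R]_n -> \bar R) :
  measurable_fun setT g -> (forall t, 0 <= g t)%E ->
  measurable_fun setT h -> (forall w, 0 <= h w)%E ->
  (\int[mu n.+1]_x (g (dot x nu + c)%R * h (col' i x)) =
   (`|nu 0 i|^-1)%:E * \int[@lebesgue_measure R]_t g t * \int[mu n]_w h w)%E.
Proof.
move=> mg g0 mh h0.
have mgd : measurable_fun setT (fun x : 'rV[R]_n.+1 => g (dot x nu + c)).
  apply: (measurableT_comp mg); apply: continuous_measurable_rV.
  exact: dot_continuous.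
have mhc : measurable_fun setT (fun x : 'rV[R]_n.+1 => h (col' i x)).
  by apply: (measurableT_comp mh); exact: measurable_col'.
rewrite (ge0_integral_rV_insert i); last 2 first.
- exact: emeasurable_funM.
- by move=> x; rewrite mule_ge0.
have inner w : (\int[@lebesgue_measure R]_s
     (g (dot (rV_insert i s w) nu + c)%R * h (col' i (rV_insert i s w))) =
   (`|nu 0 i|^-1)%:E * \int[@lebesgue_measure R]_t g t * h w)%E.
  pose b := dot w (col' i nu) + c.
  have E s : dot (rV_insert i s w) nu + c = nu 0 i * s + b.
    by rewrite -{1}(rV_insert_col' i nu) dot_rV_insert mulrC addrA.
  under eq_integral do rewrite col'_rV_insert E.
  rewrite ge0_integralZr//; last first.
    by apply: (measurableT_comp mg); apply: measurable_funD => //.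
  congr (_ * _)%E.
  rewrite (ge0_integral_affine b nui mg g0) muleA -EFinM mulVf ?normr_eq0//.
  by rewrite mul1e.
under eq_integral do rewrite inner.
by rewrite ge0_integralZl// mule_ge0// ?lee_fin ?invr_ge0// integral_ge0.
Qed.

Lemma integral_inv_itv (a b : R) : 0 < a -> a < b ->
  (\int[@lebesgue_measure R]_t (t `^ (-1) * \1_(`[a, b]%classic) t)%:E =
   (ln b - ln a)%:E)%E.
Proof.
move=> a0 ab.
rewrite EFinB -(@continuous_FTC2 R (fun t => t `^ (-1)) (@ln R) a b ab).
- rewrite [RHS]integral_mkcond; apply: eq_integral => t _.
  by rewrite patchE indicE; case: ifP => _; rewrite ?mulr1 ?mulr0.
- apply: continuous_in_subspaceT => t /set_mem; rewrite /= in_itv/= => /andP[at_ _].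
  by apply: continuous_powR_gt0; exact: lt_le_trans at_.
- split.
  + move=> t; rewrite in_itv/= => /andP[at_ _].
    by have [] := @is_derive1_ln R t (lt_trans a0 at_).
  + by apply: cvg_at_right_filter; apply: continuous_ln.
  + by apply: cvg_at_left_filter; apply: continuous_ln; exact: lt_trans ab.
- move=> t; rewrite in_itv/= => /andP[at_ _].
  have t0 := lt_trans a0 at_.
  have [_ ] := @is_derive1_ln R t t0; rewrite derive1E => ->.
  by rewrite powR_inv1// ltW.
Qed.

Lemma slab_integral (c a b : R) (B : set 'rV[R]_n) : 0 < a -> a < b -> measurable B ->
  (\int[mu n.+1]_x ((dot x nu + c) `^ (-1) * \1_(`[a, b]%classic) (dot x nu + c)
                    * \1_B (col' i x))%:E =
   (`|nu 0 i|^-1 * (ln b - ln a))%:E * mu n B)%E.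
Proof.
move=> a0 ab mB.
rewrite EFinM -integral_inv_itv// -[in RHS](setIT B) -integral_indic//.
rewrite -(@ge0_integral_slab c (fun t => (t `^ (-1) * \1_(`[a, b]%classic) t)%:E)
  (fun w => (\1_B w)%:E))//.
- apply/measurable_EFinP; apply: measurable_funM; first exact: measurable_powR.
  by apply: measurable_indic; exact: measurable_itv.
- by move=> t; rewrite lee_fin mulr_ge0 ?powR_ge0.
- by apply/measurable_EFinP; exact: measurable_indic.
Qed.

End slab_integrals.

(** * A region where the distance is almost at most the height *)

Section boundary_region.
Context {R : realType} {n : nat}.
Variables (Omega : set 'rV[R]_n.+1) (y : 'rV[R]_n.+1) (Q : 'M[R]_n.+1).
Variable phi : 'rV[R]_n -> R.
Hypotheses (Omega_open : open Omega) (bdy : boundary Omega y).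
Hypotheses (graph : local_graph Omega y Q phi) (grad0 : gradient phi 0 = 0).
Local Notation delta := (dist_compl Omega).

(** The inward unit normal at [y], since [Omega] lies above the graph. *)
Definition normal_dir : 'rV[R]_n.+1 := \row_j Q j ord_max.

Lemma height_dot x : ((x - y) *m Q) 0 ord_max = dot (x - y) normal_dir.
Proof. by rewrite mxE; apply: eq_bigr => j _; rewrite [normal_dir _ _]mxE. Qed.

Lemma enorm_normal_dir : enorm normal_dir = 1.
Proof.
have [rQ _] := graph; rewrite enorm_sqrt (_ : dot _ _ = 1) ?sqrtr1//.
have /matrixP/(_ ord_max ord_max) := rotation_tr rQ.
rewrite !mxE eqxx mulr1n => <-; apply: eq_bigr => j _; by rewrite !mxE.
Qed.

Lemma normal_dir_neq0 : exists i, normal_dir 0 i != 0.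
Proof.
apply: contrapT => h; have := enorm_normal_dir.
rewrite (_ : normal_dir = 0) ?enorm0; first by move/eqP; rewrite eq_sym oner_eq0.
apply/rowP => j; rewrite [RHS]mxE; apply: contrapT => /eqP hj; apply: h.
by exists j.
Qed.

(** Flatness bounds [phi] by a small multiple of the distance to [y], not of the height. Keeping the
    height above [s * rho] makes the two comparable, so [|phi|] is at most [eta] times the
    height. *)
Lemma region_near_boundary (i : 'I_n.+1) (eta s : R) : normal_dir 0 i != 0 ->
  0 < eta -> eta < 1 -> 0 < s -> exists2 rho, 0 < rho & forall x,
    s * rho <= dot (x - y) normal_dir -> dot (x - y) normal_dir <= 2 * rho ->
    (forall k, `|(x - y) 0 (lift i k)| <= 2 * rho) ->
    Omega x /\ delta x <= (1 + eta) * dot (x - y) normal_dir.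
Proof.
move=> nui eta0 eta1 s0.
have [rQ [r r0 [_ gr]]] := graph.
have [phi0 flat] := graph_flat Omega_open bdy graph grad0.
have [r1 r10 le_graph] := dist_compl_le_graph graph.
set nu := normal_dir in nui *.
(* [M * rho] bounds [|x - y|]: coordinate [i] is recovered from the height through [nu 0 i], and the
   [n] others are at most [2 * rho]. *)
pose M := (2 + 2 * n%:R) / `|nu 0 i| + 2 * n%:R.
have nn : 0 <= n%:R :> R by [].
have nui0 : 0 < `|nu 0 i| by rewrite normr_gt0.
have M0 : 0 < M by rewrite ltr_pwDl ?mulr_ge0// divr_gt0// ltr_pwDl// mulr_ge0.
(* Flatness then gives [|phi| <= e * M * rho <= eta * s * rho], which is at most [eta] times the
   height. *)
pose e := Num.min 1 (eta * s / M).
have e0 : 0 < e by rewrite lt_min ltr01 divr_gt0// mulr_gt0.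
have [d d0 dP] := flat e e0.
pose m := Num.min r (Num.min d (r1 / 2)).
have m0 : 0 < m by rewrite !lt_min r0 d0 divr_gt0.
pose rho := m / 2 / M.
have rho0 : 0 < rho by rewrite !divr_gt0.
have rhoM : M * rho = m / 2 by rewrite /rho mulrC divfK// gt_eqF.
exists rho => // x tx1 tx2 xk.
set v := x - y in tx1 tx2 xk *; set t := dot v nu in tx1 tx2 *.
have t0 : 0 < t by rewrite (lt_le_trans _ tx1)// mulr_gt0.
have sumk : \sum_k `|v 0 (lift i k)| <= 2 * n%:R * rho.
  apply: (@le_trans _ _ (\sum_(k < n) 2 * rho)); first by apply: ler_sum => k _; exact: xk.
  by rewrite sumr_const card_ord -[leLHS]mulr_natr mulrAC.
have vi : `|v 0 i| <= (2 + 2 * n%:R) / `|nu 0 i| * rho.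
  rewrite mulrAC ler_pdivlMr// -normrM.
  have -> : v 0 i * nu 0 i = t - \sum_k v 0 (lift i k) * nu 0 (lift i k).
    by rewrite /t /dot (bigD1_ord i)//= addrK.
  rewrite (le_trans (ler_normB _ _))// (gtr0_norm t0) mulrDl lerD//.
  rewrite (le_trans (ler_norm_sum _ _ _))// (le_trans _ sumk)//.
  apply: ler_sum => k _; rewrite normrM ler_piMr//.
  by rewrite -enorm_normal_dir enorm_coord.
have vM : enorm v <= m / 2.
  rewrite -rhoM -(rV_insert_col' i v) (le_trans (enorm_rV_insert_le _ _ _))//.
  rewrite /M mulrDl lerD// (le_trans _ sumk)//.
  apply: le_trans (_ : _ <= \sum_k `|(col' i v) 0 k|) _; last first.
    by apply: ler_sum => k _; rewrite mxE.
  exact: enorm_le_sum.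
have mr : m <= r by rewrite ge_min lexx.
have md : m <= d by rewrite !ge_min lexx orbT.
have mr1 : m <= r1 / 2 by rewrite !ge_min lexx !orbT.
have vr : enorm v < r by lra.
set z := v *m Q.
have zl : z 0 ord_max = t by rewrite /z height_dot.
have zn : enorm (col' ord_max z) <= m / 2.
  by rewrite (le_trans (enorm_col'_le _ _))// enorm_rotation.
have phz : `|phi (col' ord_max z)| <= e * (m / 2).
  rewrite (le_trans (dP _ _))//; first by lra.
  by rewrite ler_wpM2l// ltW.
have e1 : e <= 1 by rewrite ge_min lexx.
have phs : `|phi (col' ord_max z)| <= eta * t.
  rewrite (le_trans phz)// -rhoM.
  have : e <= eta * s / M by rewrite ge_min lexx orbT.
  rewrite ler_pdivlMr// => h.
  apply: (@le_trans _ _ (eta * s * rho)).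
    by rewrite mulrA ler_wpM2r// ltW.
  by rewrite -mulrA ler_wpM2l// ltW.
have lt_t : eta * t < t by rewrite gtr_pMl.
move: phs; rewrite ler_norml => /andP[ph1 ph2].
split.
  apply/(gr x vr); have : phi (col' ord_max z) < t by lra.
  by rewrite -zl.
have h : enorm (rV_insert ord_max (phi (col' ord_max z)) (col' ord_max z)) < r1 ->
    delta x <= `|t - phi (col' ord_max z)|.
  by rewrite -zl; exact: (le_graph x).
rewrite (le_trans (h _))//; last by rewrite ler_norml; apply/andP; split; lra.
rewrite (le_lt_trans (enorm_rV_insert_le _ _ _))//.
have : e * (m / 2) <= m / 2 by rewrite ler_piMl// ltW// divr_gt0.
by lra.
Qed.

End boundary_region.

(** * One-dimensional cutoffs and truncated powers *)

Section profiles.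
Context {R : realType}.

Lemma smooth_cutoff (s : R) : 0 < s -> s <= 1 ->
  exists psi dpsi : R -> R, exists2 K : R, 0 < K &
  [/\ smooth_expr psi, forall t : R, is_derive t 1 psi (dpsi t),
      forall t, 0 <= psi t <= 1, forall t, `|dpsi t| <= K &
      [/\ forall t, `|t| <= 1 -> psi t = 1, forall t, `|t| <= 1 -> dpsi t = 0 &
          forall t, 1 + s <= `|t| -> psi t = 0]].
Proof.
move=> s0 s1; have [ds [K K0 [dsP dsK ds1 ds2]]] := @smooth_step_derive R.
(* [t * t] makes the cutoff even and smooth. For [|t| <= 1] one gets [g t <= 0], and for
   [|t| >= 1 + s] one gets [g t >= 2 + s], on either side of the transition interval of
   [smooth_step]. *)
pose g (t : R) := (t * t - 1) / s.
have dg (t : R) : is_derive t 1 g (2 * t / s).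
  have h := is_deriveM (is_deriveB (is_deriveM (is_derive_id t 1) (is_derive_id t 1))
     (is_derive_cst (1 : R) t 1)) (is_derive_cst s^-1 t 1).
  by apply: (is_derive_eq h); rewrite scaler0 add0r subr0 /GRing.scale/=; ring.
have gE t : g t * s = `|t| ^+ 2 - 1.
  by rewrite /g divfK ?gt_eqF// real_normK ?num_real.
exists (fun t => 1 - smooth_step (g t)), (fun t => - (ds (g t) * (2 * t / s))).
(* For [|t| > 2] one has [g t > 2], because [s <= 1], and the derivative vanishes; elsewhere
   [|2 * t / s| <= 4 / s]. *)
exists (K * (4 / s)); first by rewrite mulr_gt0// divr_gt0.
split.
- apply: smoothB; first exact: smooth_cst.
  apply: smooth_comp; first exact: smooth_step_smooth.
  apply: smoothM; last exact: smooth_cst.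
  by apply: smoothB; [apply: smoothM; exact: smooth_id|exact: smooth_cst].
- move=> t; have h := is_deriveB (is_derive_cst (1 : R) t 1)
    (@is_derive1_comp R smooth_step g t _ _ (dsP (g t)) (dg t)).
  by apply: (is_derive_eq h); rewrite sub0r.
- by move=> t; have := smooth_step_ge0 (g t); have := smooth_step_le1 (g t); lra.
- move=> t; rewrite normrN normrM.
  have [t2|t2] := leP `|t| 2.
    by rewrite ler_pM// !normrM (gtr0_norm (_ : 0 < 2))// normfV (gtr0_norm s0)
       ler_wpM2r ?invr_ge0 ?(ltW s0)//; lra.
  rewrite ds2; first by rewrite normr0 mul0r mulr_ge0 ?divr_ge0 ?(ltW K0) ?(ltW s0).
  rewrite -(ltr_pM2r s0) gE.
  have : 2 ^+ 2 < `|t| ^+ 2 by rewrite ltr_pXn2r// nnegrE.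
  by rewrite [2 ^+ 2]expr2; lra.
have small t : `|t| <= 1 -> g t < 1.
  move=> t1; rewrite -(ltr_pM2r s0) gE.
  have : `|t| ^+ 2 <= 1 by rewrite expr_le1.
  by lra.
split.
- by move=> t /small/ltW gt1; rewrite smooth_step0// subr0.
- by move=> t /small gt1; rewrite ds1// mul0r oppr0.
- move=> t t1; rewrite smooth_step1 ?subrr//.
  rewrite -(ler_pM2r s0) gE.
  have : (1 + s) ^+ 2 <= `|t| ^+ 2 by rewrite ler_pXn2r// nnegrE; lra.
  by have := sqr_ge0 s; rewrite sqrrD; lra.
Qed.

(** [K] is fixed before [a] and [b]: the cutoffs depend on [t / a] and [t / b], so their derivatives
    are of order [1 / t] where they do not vanish. This independence lets [b / a] grow later at
    bounded cost. *)
Lemma smooth_profile (al : R) : 0 < al -> al <= 1 ->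
  exists2 K : R, 0 < K & forall a b : R, 0 < a -> 2 * a < b ->
  exists u du : R -> R,
  [/\ smooth_expr u, forall t : R, is_derive t 1 u (du t),
      forall t, (t < a) || (2 * b < t) -> u t = 0 /\ du t = 0,
      forall t, a <= t -> 0 <= u t <= t `^ al /\ `|du t| <= K * t `^ (al - 1) &
      (forall t, 2 * a <= t <= b -> u t = t `^ al) /\
      (forall t, 2 * a < t < b -> du t = al * t `^ (al - 1))].
Proof.
move=> al0 al1; have [ds [K K0 [dsP dsK ds1 ds2]]] := @smooth_step_derive R.
(* [1] comes from the derivative of the power, as [al <= 1], and [2 * K] from each of the two
   cutoffs, by [dsb]. *)
exists (1 + 4 * K); first by rewrite ltr_pwDl ?mulr_ge0 ?(ltW K0).
move=> a b a0 ab; have b0 : 0 < b by lra.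
move: (@smooth_step R) (@smooth_step_smooth R) (@smooth_step0 R) (@smooth_step1 R)
  (@smooth_step_ge0 R) (@smooth_step_le1 R) dsP => th sth th_0 th_1 th_ge0 th_le1 dsP.
(* A positive smooth function equal to [t] where [th (t / a)] is not zero. *)
pose m t := t * th (2 * t / a) + (1 - th (2 * t / a)) * (a / 2).
have m_gt0 t : 0 < m t.
  rewrite /m; have [ta|ta] := leP (2 * t / a) 1.
    by rewrite th_0// mulr0 add0r subr0 mul1r divr_gt0.
  have t0 : 0 < t by move: ta; rewrite ltr_pdivlMr//; lra.
  have := th_ge0 (2 * t / a); have := th_le1 (2 * t / a).
  set q := th _ => q1 q0.
  have a20 : 0 < a / 2 by lra.
  have [qe|qn] := eqVneq q 0; first by rewrite qe mulr0 add0r subr0 mul1r.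
  have q_gt0 : 0 < q by rewrite lt_neqAle eq_sym qn.
  by apply: ltr_pwDl; [exact: mulr_gt0|apply: mulr_ge0; lra].
pose dm t := th (2 * t / a) + (t - a / 2) * (ds (2 * t / a) * (2 / a)).
have dlin (c t : R) : is_derive t 1 (fun t => t / c) c^-1.
  have h := is_deriveM (is_derive_id t 1) (is_derive_cst c^-1 t 1).
  by apply: (is_derive_eq h); rewrite scaler0 add0r [_ *: 1]mulr1.
have d2 (t : R) : is_derive t 1 (fun t => 2 * t / a) (2 / a).
  have h := is_deriveM (is_deriveM (is_derive_cst (2 : R) t 1) (is_derive_id t 1))
     (is_derive_cst a^-1 t 1).
  by apply: (is_derive_eq h); rewrite !scaler0 add0r addr0 /GRing.scale/=; ring.
have dth2 (t : R) := @is_derive1_comp R th (fun t => 2 * t / a) t _ _ (dsP _) (d2 t).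
have dmP (t : R) : is_derive t 1 m (dm t).
  have h := is_deriveD (is_deriveM (is_derive_id t 1) (dth2 t))
    (is_deriveM (is_deriveB (is_derive_cst (1 : R) t 1) (dth2 t))
       (is_derive_cst (a / 2) t 1)).
  apply: (is_derive_eq h); rewrite scaler0 add0r /GRing.scale/= /dm.
  by field; exact: lt0r_neq0.
have dpow (t : R) : is_derive t 1 (fun t => m t `^ al) (al * m t `^ (al - 1) * dm t).
  exact: (@is_derive1_comp R (fun t => t `^ al) m t _ _ (is_derive1_powR al (m_gt0 t)) (dmP t)).
have dtha (t : R) := @is_derive1_comp R th (fun t => t / a) t _ _ (dsP _) (dlin a t).
have dthb (t : R) := is_deriveB (is_derive_cst (1 : R) t 1)
  (@is_derive1_comp R th (fun t => t / b) t _ _ (dsP _) (dlin b t)).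
pose u t := m t `^ al * (th (t / a) * (1 - th (t / b))).
pose du t := al * m t `^ (al - 1) * dm t * (th (t / a) * (1 - th (t / b)))
   + m t `^ al * (ds (t / a) / a * (1 - th (t / b)) - th (t / a) * (ds (t / b) / b)).
have duP (t : R) : is_derive t 1 u (du t).
  have h := is_deriveM (dpow t) (is_deriveM (dtha t) (dthb t)).
  apply: (is_derive_eq h); rewrite /GRing.scale/= /du sub0r.
  have E1 : (cst (1 : R) - (th \o (fun t => t / b))) t = 1 - th (t / b) by [].
  have E2 : ((th \o (fun t => t / a)) * (cst (1 : R) - (th \o (fun t => t / b)))) t =
     th (t / a) * (1 - th (t / b)) by [].
  by rewrite E1 E2; ring.
exists u, du.
have th01 t : 0 <= th t <= 1 by rewrite th_ge0 th_le1.
have m_eq t : a <= t -> m t = t.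
  move=> at_; rewrite /m th_1 ?mulr1 ?subrr ?mul0r ?addr0//.
  by rewrite ler_pdivlMr// ler_pM2l.
have dm_eq t : a < t -> dm t = 1.
  move=> at_; rewrite /dm ds2; last by rewrite ltr_pdivlMr// ltr_pM2l.
  rewrite th_1 ?mul0r ?mulr0 ?addr0//.
  by rewrite ler_pdivlMr// ler_pM2l// ltW.
have tha t : 2 * a <= t -> th (t / a) = 1.
  by move=> at_; rewrite th_1// ler_pdivlMr.
have thb t : t <= b -> th (t / b) = 0.
  by move=> tb; rewrite th_0// ler_pdivrMr// mul1r.
split => //.
- apply: smoothM.
    apply: smooth_powR => //; apply: smoothD.
      apply: smoothM; first exact: smooth_id.
      apply: smooth_comp; first exact: sth.
      apply: smoothM; last exact: smooth_cst.
      by apply: smoothM; [exact: smooth_cst|exact: smooth_id].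
    apply: smoothM; last exact: smooth_cst.
    apply: smoothB; first exact: smooth_cst.
    apply: smooth_comp; first exact: sth.
    apply: smoothM; last exact: smooth_cst.
    by apply: smoothM; [exact: smooth_cst|exact: smooth_id].
  have sthc c : smooth_expr (fun t : R => th (t / c)).
    apply: smooth_comp; first exact: sth.
    by apply: smoothM; [exact: smooth_id|exact: smooth_cst].
  by apply: smoothM => //; apply: smoothB => //; exact: smooth_cst.
- move=> t /orP[ta|tb].
    have ta1 : t / a < 1 by rewrite ltr_pdivrMr// mul1r.
    have E : th (t / a) = 0 by rewrite th_0// ltW.
    by rewrite /u /du E ds1// !(mul0r, mulr0, subrr, addr0).
  have tb2 : 2 < t / b by rewrite ltr_pdivlMr.
  have E : th (t / b) = 1 by rewrite th_1// ltW.
  by rewrite /u /du E (ds2 _ tb2) subrr !(mul0r, mulr0, subrr, addr0).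
- move=> t at_; have t0 : 0 < t by exact: lt_le_trans at_.
  have /andP[A0 A1] := th01 (t / a); have /andP[B0 B1] := th01 (t / b).
  have B2 : 0 <= 1 - th (t / b) by rewrite subr_ge0.
  have B3 : 1 - th (t / b) <= 1 by rewrite gerBl.
  have h2 : 0 <= th (t / a) * (1 - th (t / b)) by exact: mulr_ge0.
  have h1 : th (t / a) * (1 - th (t / b)) <= 1 by exact: mulr_ile1.
  split.
    rewrite /u m_eq//; apply/andP; split.
      by apply: mulr_ge0; [exact: powR_ge0|exact: h2].
    by rewrite ler_piMr ?powR_ge0.
  have tE : t `^ al = t * t `^ (al - 1) by rewrite mulr_powRB1// ltW.
  have dsb c : 0 < c -> `|ds (t / c) / c| * t <= 2 * K.
    move=> c0; rewrite normrM normfV (gtr0_norm c0) -mulrA (mulrC c^-1).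
    have [tc|tc] := leP (t / c) 2.
      by rewrite [leLHS]mulrC; apply: ler_pM => //; apply: divr_ge0; exact: ltW.
    by rewrite ds2// normr0 mul0r mulr_ge0// ltW.
  rewrite /du m_eq// tE.
  set P := t `^ (al - 1); have P0 : 0 <= P by exact: powR_ge0.
  have T1 : `|al * P * dm t * (th (t / a) * (1 - th (t / b)))| <= P.
    have [ate|atn] := eqVneq t a.
      rewrite ate divff ?gt_eqF// [th 1](_ : _ = 0) ?mul0r ?mulr0 ?normr0//.
      by rewrite th_0.
    rewrite dm_eq ?mulr1; last by rewrite lt_neqAle eq_sym atn.
    rewrite ger0_norm ?mulr_ge0 ?(ltW al0) ?subr_ge0//.
    apply: (@le_trans _ _ (al * P)); first by rewrite ler_piMr// mulr_ge0// ltW.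
    by rewrite ler_piMl.
  have T2 : `|t * P * (ds (t / a) / a * (1 - th (t / b)) - th (t / a) * (ds (t / b) / b))|
     <= 4 * K * P.
    have -> : t * P * (ds (t / a) / a * (1 - th (t / b)) - th (t / a) * (ds (t / b) / b))
      = P * (ds (t / a) / a * t * (1 - th (t / b)) - th (t / a) * (ds (t / b) / b * t)).
      by ring.
    rewrite normrM (ger0_norm P0) mulrC ler_wpM2r//.
    have ha : `|ds (t / a) / a * t * (1 - th (t / b))| <= 2 * K.
      rewrite normrM (normrM _ t) (gtr0_norm t0) (le_trans _ (dsb a a0))//.
      by rewrite ler_piMr ?mulr_ge0 ?(ltW t0)// ger0_norm ?subr_ge0// gerBl.
    have hb : `|th (t / a) * (ds (t / b) / b * t)| <= 2 * K.
      rewrite normrM (normrM _ t) (gtr0_norm t0) (le_trans _ (dsb b b0))//.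
      by rewrite ler_piMl ?mulr_ge0 ?(ltW t0)// ger0_norm.
    by rewrite (le_trans (ler_normB _ _))//; lra.
  rewrite (le_trans (ler_normD _ _))// mulrDl mul1r lerD//.
- split=> t /andP[t1 t2].
    by rewrite /u tha// thb// m_eq ?subr0 ?mulr1//; lra.
  have ta2 : 2 < t / a by rewrite ltr_pdivlMr.
  have tb1 : t / b < 1 by rewrite ltr_pdivrMr// mul1r.
  rewrite /du tha ?ltW// thb ?ltW// (ds2 _ ta2) (ds1 _ tb1) dm_eq ?m_eq; lra.
Qed.

End profiles.

(** * Energy and Hardy term of a truncated power of the height *)

Section near_optimal_function.
Context {R : realType} {n : nat}.
(** The test function lives at heights from [a] to [2 * b] and, in the [n] coordinates other than
    [i], within [(1 + s) * rho] of [y]. [K] and [L] control the derivatives of the profile [u] and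
    of the lateral cutoff [psi]. *)
Variables (Omega : set 'rV[R]_n.+1) (p : R) (y nu : 'rV[R]_n.+1) (i : 'I_n.+1).
Variables (eta s a b rho K L : R) (u du psi dpsi : R -> R).
Local Notation delta := (dist_compl Omega).
Local Notation al := ((p - 1) / p).
Local Notation height x := (dot (x - y) nu).
Local Notation coord x k := ((x - y) 0 (lift i k)).
Hypotheses (p_gt1 : 1 < p) (nu1 : enorm nu = 1) (nui : nu 0 i != 0).
Hypotheses (Omega_open : open Omega) (compl0 : ~` Omega !=set0).
Hypotheses (eta_gt0 : 0 < eta) (s_gt0 : 0 < s) (s_le1 : s <= 1).
Hypotheses (a_gt0 : 0 < a) (ab : 2 * a < b) (rho_gt0 : 0 < rho).
Hypotheses (K_gt0 : 0 < K) (L_gt0 : 0 < L).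
Hypothesis region : forall x, a <= height x <= 2 * b ->
  (forall k, `|coord x k| <= 2 * rho) ->
  Omega x /\ delta x <= (1 + eta) * height x.
(** The slab is thin relative to its width, so the lateral derivatives of the test function
    contribute at most [t^(al - 1)] at height [t]. *)
Hypothesis b_small : 2 * b * (n%:R * (L / rho)) <= 1.
Hypotheses (u_smooth : smooth_expr u) (duP : forall t : R, is_derive t 1 u (du t)).
Hypothesis u_off : forall t, (t < a) || (2 * b < t) -> u t = 0 /\ du t = 0.
Hypothesis u_le : forall t, a <= t ->
  0 <= u t <= t `^ al /\ `|du t| <= K * t `^ (al - 1).
Hypothesis u_eq : forall t, 2 * a <= t <= b -> u t = t `^ al.
Hypothesis du_eq : forall t, 2 * a < t < b -> du t = al * t `^ (al - 1).
Hypotheses (psi_smooth : smooth_expr psi).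
Hypothesis dpsiP : forall t : R, is_derive t 1 psi (dpsi t).
Hypotheses (psi01 : forall t, 0 <= psi t <= 1) (dpsi_le : forall t, `|dpsi t| <= L).
Hypothesis psi1 : forall t, `|t| <= 1 -> psi t = 1.
Hypothesis dpsi0 : forall t, `|t| <= 1 -> dpsi t = 0.
Hypothesis psi0 : forall t, 1 + s <= `|t| -> psi t = 0.

Definition cut (x : 'rV[R]_n.+1) : R := \prod_k psi (coord x k / rho).

Definition almost_extremal (x : 'rV[R]_n.+1) : R := u (height x) * cut x.

Let f := almost_extremal.

Let height_line (x v : 'rV[R]_n.+1) (t : R) :
  height (x + t *: v) = height x + t * dot v nu.
Proof. by rewrite (addrAC x) (dotDl (x - y)) dotZl. Qed.

Let coord_line (x v : 'rV[R]_n.+1) (t : R) k :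
  coord (x + t *: v) k = coord x k + t * v 0 (lift i k).
Proof. by rewrite !mxE addrAC. Qed.

Let height_smooth : smooth_expr (fun x : 'rV[R]_n.+1 => height x).
Proof.
have -> : (fun x : 'rV[R]_n.+1 => height x) = (fun x => dot x nu + - dot y nu).
  by apply/funext => x; rewrite dotDl dotNl.
apply: smoothD; last exact: smooth_cst.
apply: smooth_linear => [x|x v t]; last by rewrite dotDl dotZl.
by have := @dot_continuous R n nu 0 x; under eq_fun do rewrite addr0.
Qed.

Let coord_smooth k : smooth_expr (fun x : 'rV[R]_n.+1 => coord x k / rho).
Proof.
have -> : (fun x : 'rV[R]_n.+1 => coord x k / rho) =
    (fun x => (x 0 (lift i k) + - y 0 (lift i k)) * rho^-1).
  by apply/funext => x; rewrite !mxE.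
apply: smoothM; last exact: smooth_cst.
apply: smoothD; last exact: smooth_cst.
apply: smooth_linear => [x|x v t]; last by rewrite !mxE.
exact: coord_continuous.
Qed.

Let f_smooth : smooth_expr f.
Proof.
apply: smoothM; first exact: (smooth_comp u_smooth height_smooth).
apply: smooth_prod => k; exact: (smooth_comp psi_smooth (coord_smooth k)).
Qed.

Let Z : set 'rV[R]_n.+1 := [set x | a <= height x <= 2 * b /\
  forall k, `|coord x k| <= (1 + s) * rho].

Let closed_Z : closed Z.
Proof.
have -> : Z = (fun x => height x) @^-1` `[a, 2 * b]%classic `&`
   \bigcap_(k in [set: 'I_n]) ((fun x => coord x k / rho) @^-1` `[- (1 + s), 1 + s]%classic).
  apply/seteqP; split=> [x [h1 h2]|x [h1 h2]].
    split; first by rewrite /= in_itv.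
    move=> k _; rewrite /= in_itv/= -ler_norml normrM normfV (gtr0_norm rho_gt0).
    by rewrite ler_pdivrMr.
  split; first by move: h1; rewrite /= in_itv.
  move=> k; have := h2 k I; rewrite /= in_itv/= -ler_norml normrM normfV.
  by rewrite (gtr0_norm rho_gt0) ler_pdivrMr.
apply: closedI.
  apply: preimage_closed; last exact: itv_closed.
  by move=> x _; exact: (smooth_expr_continuous height_smooth).
apply: closed_bigI => k _; apply: preimage_closed; last exact: itv_closed.
by move=> x _; exact: (smooth_expr_continuous (coord_smooth k)).
Qed.

Let support_Z : closure [set x | f x != 0] `<=` Z.
Proof.
rewrite [X in _ `<=` X](closure_id Z).1//; apply: closure_subset => x fx.
split.
  apply: contrapT => /negP; rewrite negb_and -!ltNge => /u_off[u0 _].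
  by move: fx; rewrite /= /f /almost_extremal u0 mul0r eqxx.
move=> k; rewrite leNgt; apply/negP => kx; move: fx => /negP; apply.
rewrite /f /almost_extremal /cut (bigD1 k)//= psi0 ?mul0r ?mulr0//.
by rewrite normrM normfV (gtr0_norm rho_gt0) ler_pdivlMr// ltW.
Qed.

Let Z_2rho x : Z x -> forall k, `|coord x k| <= 2 * rho.
Proof.
move=> [_ h] k; rewrite (le_trans (h k))// ler_wpM2r ?(ltW rho_gt0)//.
by move: s_le1; lra.
Qed.

Let compact_Z : compact Z.
Proof.
apply: bounded_closed_compact; last exact: closed_Z.
pose B := (2 * b + \sum_(k < n) 2 * rho) / `|nu 0 i| + \sum_(k < n) 2 * rho + enorm y.
exists B; split; first by rewrite num_real.
move=> M BM x Zx /=; rewrite (le_trans (mx_norm_le_enorm _))// (le_trans _ (ltW BM))//.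
rewrite -[x](subrK y) (le_trans (enormD _ _))// lerD2r.
have [/andP[h1 h2] _] := Zx; have h3 := Z_2rho Zx.
have nui0 : 0 < `|nu 0 i| by rewrite normr_gt0.
have t0 : 0 < height x by exact: lt_le_trans h1.
set v := x - y in h1 h2 h3 t0 *.
rewrite -[v](rV_insert_col' i) (le_trans (enorm_rV_insert_le _ _ _))// lerD//.
  rewrite ler_pdivlMr// -normrM.
  have -> : v 0 i * nu 0 i = dot v nu - \sum_k v 0 (lift i k) * nu 0 (lift i k).
    by rewrite /dot (bigD1_ord i)//= addrK.
  rewrite (le_trans (ler_normB _ _))// (gtr0_norm t0) lerD//.
  rewrite (le_trans (ler_norm_sum _ _ _))//.
  apply: ler_sum => k _; rewrite normrM -[leRHS]mulr1 ler_pM//.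
  by rewrite -nu1 enorm_coord.
apply: le_trans (_ : _ <= \sum_k `|(col' i v) 0 k|) _; last first.
  by apply: ler_sum => k _; rewrite mxE.
exact: enorm_le_sum.
Qed.

Lemma almost_extremal_test : test_function Omega f.
Proof.
split; first exact: smooth_expr_Ck.
  by apply: (subclosed_compact _ compact_Z support_Z); exact: closed_closure.
by move=> x /support_Z Zx; have [h _] := Zx; have [] := region h (Z_2rho Zx).
Qed.

Let dcut (j : 'I_n.+1) (x : 'rV[R]_n.+1) : R :=
  if unlift i j is Some k then
    dpsi (coord x k / rho) / rho * \prod_(l | l != k) psi (coord x l / rho)
  else 0.

Let is_derive_cut j x : is_derive x (delta_mx 0 j) cut (dcut j x).
Proof.
have d0 k : (delta_mx 0 i : 'rV[R]_n.+1) 0 (lift i k) = 0.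
  by rewrite mxE eqxx/= eq_sym (negPf (neq_lift i k)).
have d1 k l : (delta_mx 0 (lift i k) : 'rV[R]_n.+1) 0 (lift i l) = (l == k)%:R.
  by rewrite mxE eqxx/= (inj_eq lift_inj).
apply/is_derive_lineP; rewrite /dcut /cut; case: unliftP => [k ->|->]; last first.
  have -> : (fun t : R => \prod_k psi (coord (x + t *: delta_mx 0 i) k / rho)) =
      (fun=> cut x).
    apply/funext => t; apply: eq_bigr => k _; congr (psi (_ / _)).
    by rewrite coord_line d0 mulr0 addr0.
  exact: is_derive_cst.
pose P := \prod_(l | l != k) psi (coord x l / rho).
have -> : (fun t : R => \prod_l psi (coord (x + t *: delta_mx 0 (lift i k)) l / rho)) =
    (fun t => psi ((coord x k + t) / rho) * P).
  apply/funext => t; rewrite (bigD1 k)//=; congr (psi (_ / _) * _).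
    by rewrite coord_line d1 eqxx mulr1.
  apply: eq_bigr => l lk; congr (psi (_ / _)).
  by rewrite coord_line d1 (negPf lk) mulr0 addr0.
have dg : is_derive (0 : R) 1 (fun t => (coord x k + t) / rho) rho^-1.
  have h := is_deriveM (is_deriveD (is_derive_cst (coord x k) (0 : R) 1)
    (is_derive_id (0 : R) 1)) (is_derive_cst rho^-1 (0 : R) 1).
  by apply: (is_derive_eq h); rewrite scaler0 !add0r [_ *: 1]mulr1.
have h := is_deriveM (@is_derive1_comp R psi _ 0 _ _ (dpsiP _) dg)
  (is_derive_cst P (0 : R) 1).
by apply: (is_derive_eq h); rewrite scaler0 add0r /GRing.scale/= mulrC addr0.
Qed.

Let gradientE x :
  gradient f x = (du (height x) * cut x) *: nu + u (height x) *: (\row_j dcut j x).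
Proof.
apply/rowP => j; rewrite !mxE /partial.
have dh : is_derive x (delta_mx 0 j) (fun x => height x) (nu 0 j).
  apply/is_derive_lineP; under eq_fun do rewrite height_line.
  have h := is_deriveD (is_derive_cst (height x) (0 : R) 1)
    (is_deriveM (is_derive_id (0 : R) 1) (is_derive_cst (dot (delta_mx 0 j) nu) (0 : R) 1)).
  by apply: (is_derive_eq h); rewrite scaler0 !add0r [_ *: 1]mulr1 dotC dot_delta.
have h := is_deriveM (@is_derive_comp_real R _ (fun z => height z) u x _ _ _ (duP (height x)) dh) (is_derive_cut j x).
have [_ ->] := h; rewrite /GRing.scale/=; ring.
Qed.

Let enorm_gradient_le x : enorm (gradient f x) <=
  `|du (height x)| * cut x + `|u (height x)| * \sum_k `|dpsi (coord x k / rho)| / rho.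
Proof.
have cut0 : 0 <= cut x by apply: prodr_ge0 => k _; have /andP[] := psi01 (coord x k / rho).
rewrite gradientE (le_trans (enormD _ _))// !enormZ nu1 mulr1 normrM (ger0_norm cut0).
rewrite lerD2l ler_wpM2l// (le_trans (enorm_le_sum _))//.
rewrite (bigD1_ord i)//= !mxE /dcut unlift_none normr0 add0r; apply: ler_sum => k _.
rewrite mxE liftK normrM normrM normfV (gtr0_norm rho_gt0) ler_piMr//.
  by rewrite divr_ge0// ltW.
rewrite ger0_norm; last by apply: prodr_ge0 => l _; have /andP[] := psi01 (coord x l / rho).
by apply: prodr_ile1 => l _; exact: psi01.
Qed.

Let cut_le1 x : 0 <= cut x <= 1.
Proof.
apply/andP; split; first by apply: prodr_ge0 => k _; have /andP[] := psi01 (coord x k / rho).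
by apply: prodr_ile1 => k _; exact: psi01.
Qed.

Let al_gt0 : 0 < al. Proof. by rewrite divr_gt0 ?subr_gt0// (lt_trans ltr01). Qed.

Let al1 : (al - 1) * p = -1.
Proof. by field; rewrite gt_eqF// (lt_trans ltr01). Qed.

Let p_gt0 : 0 < p. Proof. exact: lt_trans p_gt1. Qed.

(** A crude bound on the whole support: [K] from the profile, [1] from the lateral cutoffs by
    [b_small]. The exponent is [(al - 1) * p = -1]. *)
Let energy_density_shell x : Z x ->
  enorm (gradient f x) `^ p <= (K + 1) `^ p * height x `^ (-1).
Proof.
move=> Zx; have [/andP[h1 h2] _] := Zx; have [/andP[u0 u1] du1] := u_le h1.
set t := height x in h1 h2 u0 u1 du1 *.
have t0 : 0 < t by exact: lt_le_trans h1.
have /andP[c0 c1] := cut_le1 x.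
have P0 : 0 <= t `^ (al - 1) by exact: powR_ge0.
have bound : enorm (gradient f x) <= (K + 1) * t `^ (al - 1).
  rewrite (le_trans (enorm_gradient_le x))// -/t mulrDl mul1r lerD//.
    by rewrite (le_trans _ du1)// ler_piMr.
  rewrite (ger0_norm u0).
  apply: (@le_trans _ _ (t `^ al * (n%:R * (L / rho)))).
    rewrite ler_pM//; first by apply: sumr_ge0 => k _; rewrite divr_ge0// ltW.
    apply: (@le_trans _ _ (\sum_(k < n) L / rho)).
      by apply: ler_sum => k _; rewrite ler_wpM2r ?invr_ge0 ?(ltW rho_gt0).
    by rewrite sumr_const card_ord -[leLHS]mulr_natl.
  rewrite -(@mulr_powRB1 _ t al) ?(ltW t0)// mulrAC ler_piMl//.
  rewrite (le_trans _ b_small)// ler_wpM2r//.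
  by rewrite mulr_ge0// divr_ge0// ltW.
have K1 : 0 <= K + 1 by rewrite addr_ge0// ltW.
have -> : (K + 1) `^ p * t `^ (-1) = ((K + 1) * t `^ (al - 1)) `^ p.
  by rewrite powRM// -powRrM al1.
by apply: ge0_ler_powR => //; rewrite ?nnegrE ?enorm_ge0 ?mulr_ge0// ltW.
Qed.

Let inner_coord x k : `|coord x k| <= rho -> `|coord x k / rho| <= 1.
Proof. by move=> h; rewrite normrM normfV (gtr0_norm rho_gt0) ler_pdivrMr// mul1r. Qed.

Let energy_density_core x : 2 * a < height x < b -> (forall k, `|coord x k| <= rho) ->
  enorm (gradient f x) `^ p <= al `^ p * height x `^ (-1).
Proof.
move=> hx kx; set t := height x in hx *.
have t0 : 0 < t by move: hx a_gt0 => /andP[h _] ?; lra.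
have P0 : 0 <= al * t `^ (al - 1) by exact: (mulr_ge0 (ltW al_gt0) (powR_ge0 _ _)).
have bound : enorm (gradient f x) <= al * t `^ (al - 1).
  rewrite (le_trans (enorm_gradient_le x))// -/t big1; last first.
    by move=> k _; rewrite dpsi0 ?normr0 ?mul0r// inner_coord.
  rewrite mulr0 addr0 du_eq// (ger0_norm P0) ler_piMr//.
  by have /andP[] := cut_le1 x.
have -> : al `^ p * t `^ (-1) = (al * t `^ (al - 1)) `^ p.
  by rewrite (powRM _ (ltW al_gt0)) ?powR_ge0// -powRrM al1.
by apply: ge0_ler_powR => //; rewrite ?nnegrE ?enorm_ge0// ltW.
Qed.

(** On the core [f] equals [t^al], and [al * p - p = -1]; the factor is the price of
    [delta <= (1 + eta) * t]. *)
Let hardy_density_core x : 2 * a <= height x <= b -> (forall k, `|coord x k| <= rho) ->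
  (1 + eta) `^ (- p) * height x `^ (-1) <= `|f x| `^ p / delta x `^ p.
Proof.
move=> hx kx; have [|k|Ox dx] := @region x.
- by move: hx a_gt0 ab => /andP[? ?] ? ?; apply/andP; split; lra.
- by rewrite (le_trans (kx k))// ler_peMl ?(ltW rho_gt0)// ler1n.
set t := height x in hx dx *.
have t0 : 0 < t by move: hx a_gt0 => /andP[h _] ?; lra.
have d0 : 0 < delta x := dist_compl_gt0 Omega_open compl0 Ox.
have -> : f x = t `^ al.
  rewrite /f /almost_extremal -/t u_eq// /cut big1 ?mulr1// => k _.
  by rewrite psi1// inner_coord.
have eta1 : 0 <= 1 + eta by rewrite addr_ge0// ltW.
rewrite ger0_norm ?powR_ge0// -powRrM ler_pdivlMr ?powR_gt0//.
apply: (@le_trans _ _ ((1 + eta) `^ (- p) * t `^ (-1) * ((1 + eta) * t) `^ p)).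
  rewrite ler_wpM2l ?mulr_ge0 ?powR_ge0//.
  by apply: ge0_ler_powR => //; rewrite ?nnegrE ?mulr_ge0// ltW.
have e1 : 0 < 1 + eta by rewrite ltr_pwDl// ltW.
rewrite powRM ?(ltW t0)// mulrACA -powRD; last by apply/implyP => _; rewrite gt_eqF.
rewrite addNr powRr0 mul1r -powRD; last by apply/implyP => _; rewrite gt_eqF.
rewrite (_ : -1 + p = al * p)//; field; exact: lt0r_neq0.
Qed.

Let beta := `|nu 0 i|^-1.

(** The density [1 / t] at heights in [[u1, v1]] over the base [B]. Energy and Hardy term are
    compared with such slabs, whose integrals are logarithms times volumes. *)
Let slab u1 v1 (B : set 'rV[R]_n) (x : 'rV[R]_n.+1) : R :=
  height x `^ (-1) * \1_(`[u1, v1]%classic) (height x) * \1_B (col' i x).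

Let slab_ge0 u1 v1 B x : 0 <= slab u1 v1 B x.
Proof. by rewrite /slab !mulr_ge0 ?powR_ge0. Qed.

Let slab_in u1 v1 (B : set 'rV[R]_n) x : u1 <= height x <= v1 -> B (col' i x) ->
  slab u1 v1 B x = height x `^ (-1).
Proof.
by move=> hx Bx; rewrite /slab !indicE !mem_set// ?mulr1//= in_itv.
Qed.

Let measurable_slab u1 v1 B : measurable B ->
  measurable_fun setT (fun x => (slab u1 v1 B x)%:E).
Proof.
move=> mB; apply/measurable_EFinP.
have mh : measurable_fun setT (fun x : 'rV[R]_n.+1 => height x : measurableTypeR R).
  by apply: continuous_measurable_rV; exact: (smooth_expr_continuous height_smooth).
apply: measurable_funM; first apply: measurable_funM.
- exact: (measurableT_comp (measurable_powR (-1)) mh).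
- apply: (@measurableT_comp _ _ _ _ _ _ (\1_(`[u1, v1]%classic) : measurableTypeR R -> R)) => //.
- apply: (@measurableT_comp _ _ _ _ _ _ (\1_B : 'rV[R]_n -> R)) => //.
  exact: measurable_col'.
Qed.

Let integral_slab u1 v1 B : 0 < u1 -> u1 < v1 -> measurable B ->
  (\int[lebesgue_rV n.+1]_x (slab u1 v1 B x)%:E =
   (beta * (ln v1 - ln u1))%:E * lebesgue_rV n B)%E.
Proof.
move=> u10 uv mB; rewrite -(slab_integral nui (- dot y nu) u10 uv mB).
by apply: eq_integral => x _; rewrite /slab -dotNl -dotDl.
Qed.

Let B1 := cube (col' i y) rho.
Let B2 := cube (col' i y) ((1 + s) * rho).

Let B1E x : B1 (col' i x) <-> forall k, `|coord x k| <= rho.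
Proof. by split=> h k; have := h k; rewrite !mxE. Qed.

Let B2E x : B2 (col' i x) <-> forall k, `|coord x k| <= (1 + s) * rho.
Proof. by split=> h k; have := h k; rewrite !mxE. Qed.

Let mB1 : measurable B1. Proof. exact: measurable_cube. Qed.
Let mB2 : measurable B2. Proof. exact: measurable_cube. Qed.

Let V1 := (2 * rho) ^+ n.
Let V2 := (2 * ((1 + s) * rho)) ^+ n.

Let volB1 : lebesgue_rV n B1 = V1%:E.
Proof. by rewrite lebesgue_cube// ltW. Qed.

Let volB2 : lebesgue_rV n B2 = V2%:E.
Proof. by rewrite lebesgue_cube// mulr_ge0 ?(ltW rho_gt0)// addr_ge0// ltW. Qed.

Let volB21 : lebesgue_rV n (B2 `\` B1) = (V2 - V1)%:E.
Proof.
have B21 : B2 `&` B1 = B1.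
  apply/setIidPr => w Bw k; rewrite (le_trans (Bw k))//.
  by rewrite ler_peMl ?(ltW rho_gt0)// lerDl ltW.
have lty : (lebesgue_rV n B2 < +oo)%E by rewrite volB2 ltry.
transitivity (lebesgue_rV n B2 - lebesgue_rV n (B2 `&` B1))%E; first exact: measureD.
by rewrite B21 volB1 volB2.
Qed.

Let b_gt0 : 0 < b. Proof. by move: a_gt0 ab; lra. Qed.

(** The support is covered by the core, a bottom and a top layer over [B2], and the lateral shell
    over [B2] minus [B1]. Overlaps are harmless since the densities are nonnegative; each of the two
    layers spans one doubling and contributes [ln 2]. *)
Let energy_le : (\int[lebesgue_rV n.+1]_(x in Omega) (enorm (gradient f x) `^ p)%:E <=
  (beta * (al `^ p * ((ln b - ln (2 * a)) * V1)
    + (K + 1) `^ p * ((ln (2 * a) - ln a) * V2 + (ln (2 * b) - ln b) * V2)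
    + (K + 1) `^ p * ((ln (2 * b) - ln a) * (V2 - V1))))%:E)%E.
Proof.
have a2 : a < 2 * a by move: a_gt0; lra.
have b2 : b < 2 * b by move: b_gt0; lra.
have a20 : 0 < 2 * a by move: a_gt0; lra.
have ab2 : a < 2 * b by move: a_gt0 ab; lra.
have mB21 : measurable (B2 `\` B1) by exact: measurableD.
set K2 := (K + 1) `^ p; have K20 : 0 <= K2 by exact: powR_ge0.
set A := al `^ p; have A0 : 0 <= A by exact: powR_ge0.
pose G1 x := ((A%:E * (slab (2 * a) b B1 x)%:E) + (K2%:E * (slab a (2 * a) B2 x)%:E)
  + (K2%:E * (slab b (2 * b) B2 x)%:E) + (K2%:E * (slab a (2 * b) (B2 `\` B1) x)%:E))%E.
have cg : continuous (fun x => enorm (gradient f x)).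
  have [tf1 _ _] := almost_extremal_test; apply: enorm_gradient_continuous => j x.
  by have [_ /(_ j)[_ [+ _]]] := tf1 1%N; apply.
have me : measurable_fun setT (fun x => (enorm (gradient f x) `^ p)%:E).
  apply/measurable_EFinP; apply: (measurableT_comp (measurable_powR p)).
  exact: continuous_measurable_rV.
have mG (c : R) u1 v1 B : measurable B ->
    measurable_fun setT (fun x => c%:E * (slab u1 v1 B x)%:E)%E.
  by move=> mB; apply: emeasurable_funM => //; exact: measurable_slab.
have G0 (c : R) u1 v1 B x : 0 <= c -> (0 <= c%:E * (slab u1 v1 B x)%:E)%E.
  by move=> c0; rewrite mule_ge0// lee_fin.
apply: (@le_trans _ _ (\int[lebesgue_rV n.+1]_x G1 x)%E).
  apply: (@le_trans _ _ (\int[lebesgue_rV n.+1]_x (enorm (gradient f x) `^ p)%:E)%E).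
    apply: ge0_subset_integral => //; first exact: open_measurable_mx.
    by move=> x _; rewrite lee_fin powR_ge0.
  apply: ge0_le_integral => //.
  - by move=> x _; rewrite lee_fin powR_ge0.
  - apply: emeasurable_funD; last exact: mG.
    by apply: emeasurable_funD; [apply: emeasurable_funD|]; exact: mG.
  move=> x _.
  have S0 u1 v1 B := slab_ge0 u1 v1 B x.
  rewrite /G1 -!EFinM -!EFinD lee_fin.
  have P1 := mulr_ge0 A0 (S0 (2 * a) b B1).
  have P2 := mulr_ge0 K20 (S0 a (2 * a) B2).
  have P3 := mulr_ge0 K20 (S0 b (2 * b) B2).
  have P4 := mulr_ge0 K20 (S0 a (2 * b) (B2 `\` B1)).
  have [Zx|Zx] := pselect (Z x); last first.
    rewrite gradient_off_support ?enorm0 ?powR0 ?gt_eqF//; last by move=> /support_Z.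
    by rewrite !addr_ge0.
  have [hx kx] := Zx; have /andP[h1 h2] := hx; have B2x := (B2E x).2 kx.
  have := energy_density_shell Zx; rewrite -/K2.
  have [B1x|B1x] := pselect (B1 (col' i x)); last first.
    move=> /le_trans; apply; rewrite [in leRHS](slab_in hx)//.
    by rewrite ler_wpDl// !addr_ge0.
  have [ha|ha] := leP (height x) (2 * a).
    move=> /le_trans; apply; have ha' : a <= height x <= 2 * a by rewrite h1.
    by move: P2 P3 P4; rewrite (slab_in ha' B2x); move: P1; lra.
  have [hb|hb] := leP b (height x).
    move=> /le_trans; apply; have hb' : b <= height x <= 2 * b by rewrite hb.
    by move: P2 P3 P4; rewrite (slab_in hb' B2x); move: P1; lra.
  have hxx : 2 * a < height x < b by rewrite ha hb.
  have hxx' : 2 * a <= height x <= b by rewrite !ltW.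
  move=> _; apply: (le_trans (energy_density_core hxx ((B1E x).1 B1x))); rewrite -/A.
  by move: P1 P2 P3 P4; rewrite (slab_in hxx' B1x); lra.
rewrite /G1 ge0_integralD//; last 4 first.
- by move=> x _; rewrite !adde_ge0// G0.
- by apply: emeasurable_funD; [apply: emeasurable_funD|]; exact: mG.
- by move=> x _; exact: G0.
- exact: mG.
rewrite ge0_integralD//; last 4 first.
- by move=> x _; rewrite !adde_ge0// G0.
- by apply: emeasurable_funD; exact: mG.
- by move=> x _; exact: G0.
- exact: mG.
rewrite ge0_integralD//; last 4 first.
- by move=> x _; exact: G0.
- exact: mG.
- by move=> x _; exact: G0.
- exact: mG.
rewrite !ge0_integralZl//; try (by move=> x _; rewrite lee_fin); try exact: measurable_slab.
rewrite !integral_slab// volB1 volB2 volB21 -!EFinM -!EFinD lee_fin.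
by rewrite le_eqVlt; apply/orP; left; apply/eqP; ring.
Qed.

Let hardy_ge : (((1 + eta) `^ (- p) * (beta * ((ln b - ln (2 * a)) * V1)))%:E <=
  \int[lebesgue_rV n.+1]_(x in Omega) ((`|f x| `^ p) / (delta x `^ p))%:E)%E.
Proof.
have a20 : 0 < 2 * a by move: a_gt0; lra.
rewrite EFinM mulrA EFinM -volB1 -integral_slab// -ge0_integralZl//; last 3 first.
- exact: measurable_slab.
- by move=> x _; rewrite lee_fin.
- by rewrite lee_fin powR_ge0.
rewrite [leRHS]integral_mkcond; apply: ge0_le_integral => //.
- by move=> x _; rewrite mule_ge0 ?lee_fin ?powR_ge0 ?slab_ge0.
- by apply: emeasurable_funM => //; exact: measurable_slab.
- apply/(measurable_restrictT _ (open_measurable_mx Omega_open)).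
  apply: measurable_funS (_ : measurable_fun setT _) => //.
  have -> : (fun x => (`|f x| `^ p / delta x `^ p)%:E) =
            (fun x => (`|f x| `^ p * delta x `^ (- p))%:E).
    by apply/funext => x; rewrite -powR_inv1 ?powR_ge0// -powRrM mulrN1.
  apply/measurable_EFinP; apply: measurable_funM.
    apply: (measurableT_comp (measurable_powR p)).
    apply: continuous_measurable_rV => x.
    exact: (cvg_norm (smooth_expr_continuous f_smooth (x:=x))).
  apply: (measurableT_comp (measurable_powR (- p))).
  by apply: continuous_measurable_rV; exact: dist_compl_continuous.
move=> x _; rewrite -EFinM patchE.
have rhs0 : 0 <= `|f x| `^ p / delta x `^ p by rewrite divr_ge0 ?powR_ge0.
have [[hx Bx]|hB] := pselect (2 * a <= height x <= b /\ B1 (col' i x)); last first.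
  have -> : slab (2 * a) b B1 x = 0.
    rewrite /slab !indicE; have [hx|hx] := boolP (2 * a <= height x <= b).
      rewrite [col' i x \in B1]memNset ?mulr0// => Bx; exact: hB.
    by rewrite memNset ?mulr0 ?mul0r//= in_itv/=; exact/negP.
  by rewrite mulr0; case: ifP => _; rewrite lee_fin.
have kx := (B1E x).1 Bx.
rewrite ifT ?lee_fin ?slab_in//; first exact: hardy_density_core.
apply/mem_set; have [|k|//] := @region x.
- by move: hx a_gt0 ab => /andP[? ?] ? ?; apply/andP; split; lra.
- by rewrite (le_trans (kx k))// ler_peMl ?(ltW rho_gt0)// ler1n.
Qed.

(** Dividing by [beta * V1] removes position and scale; the logarithmic length, [eta] and [s] remain
    to be tuned. *)
Lemma almost_extremal_quotient (C : R) : 0 <= C ->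
  (forall g, test_function Omega g ->
    (C%:E * \int[lebesgue_rV n.+1]_(x in Omega) ((`|g x| `^ p) / (delta x `^ p))%:E <=
     \int[lebesgue_rV n.+1]_(x in Omega) (enorm (gradient g x) `^ p)%:E)%E) ->
  C * (1 + eta) `^ (- p) * (ln b - ln (2 * a)) <=
  al `^ p * (ln b - ln (2 * a))
    + (K + 1) `^ p * (2 * ln 2) * (1 + s) ^+ n
    + (K + 1) `^ p * (ln b - ln (2 * a) + 2 * ln 2) * ((1 + s) ^+ n - 1).
Proof.
move=> C0 hC; have V10 : 0 < V1 by rewrite exprn_gt0// mulr_gt0.
have beta0 : 0 < beta by rewrite invr_gt0 normr_gt0.
have V21 : V2 = (1 + s) ^+ n * V1.
  by rewrite /V1 /V2 -exprMn; congr (_ ^+ n); ring.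
have lna : ln (2 * a) - ln a = ln 2 by rewrite lnM ?posrE// addrK.
have lnb : ln (2 * b) - ln b = ln 2 by rewrite lnM ?posrE// addrK.
have lnab : ln (2 * b) - ln a = ln b - ln (2 * a) + 2 * ln 2.
  by rewrite !lnM ?posrE//; ring.
have : (C%:E * ((1 + eta) `^ (- p) * (beta * ((ln b - ln (2 * a)) * V1)))%:E <=
  (beta * (al `^ p * ((ln b - ln (2 * a)) * V1)
    + (K + 1) `^ p * ((ln (2 * a) - ln a) * V2 + (ln (2 * b) - ln b) * V2)
    + (K + 1) `^ p * ((ln (2 * b) - ln a) * (V2 - V1))))%:E)%E.
  apply: le_trans energy_le; apply: le_trans (hC _ almost_extremal_test).
  by rewrite lee_wpmul2l// lee_fin.
rewrite -EFinM lee_fin lna lnb lnab V21.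
rewrite -[leRHS](_ : beta * V1 * (al `^ p * (ln b - ln (2 * a))
    + (K + 1) `^ p * (2 * ln 2) * (1 + s) ^+ n
    + (K + 1) `^ p * (ln b - ln (2 * a) + 2 * ln 2) * ((1 + s) ^+ n - 1)) = _); last by ring.
rewrite -[leLHS](_ : beta * V1 * (C * (1 + eta) `^ (- p) * (ln b - ln (2 * a))) = _); last by ring.
by rewrite ler_pM2l// mulr_gt0.
Qed.

End near_optimal_function.

(** Makes the relative volume of the lateral shell small with [s]. *)
Lemma exprn_1D_le (R : realType) (s : R) n : 0 <= s -> s <= 1 ->
  (1 + s) ^+ n - 1 <= s * 3 ^+ n.
Proof.
move=> s0 s1; elim: n => [|n IHn]; first by rewrite !expr0 subrr mulr1.
have e1 : 1 <= 3 ^+ n :> R by rewrite exprn_ege1// ler1n.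
rewrite !exprS; set X := (1 + s) ^+ n in IHn *; set Y := 3 ^+ n in IHn e1 *.
have : (1 + s) * (X - 1) <= (1 + s) * (s * Y) by rewrite ler_wpM2l// addr_ge0.
have : s * (s * Y) <= s * Y by rewrite ler_piMl// mulr_ge0// (le_trans ler01).
have : s * 1 <= s * Y by rewrite ler_wpM2l.
by lra.
Qed.

(** The parameters are fixed in the order of their dependence: the length [L], then the relative
    width [s] of the shell and the tolerance [eta], then the ratios [k = b / rho] and [h = a / rho],
    and last the scale [rho], which flatness of the boundary supplies for the given [h] and
    [eta]. *)
Lemma hardy_constant_le (R : realType) n (Omega : set 'rV[R]_n.+1) (p C : R) :
  open Omega -> boundary Omega !=set0 -> weakly_mean_convex Omega -> 1 < p ->
  (forall g, test_function Omega g ->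
    (C%:E * \int[lebesgue_rV n.+1]_(x in Omega)
       ((`|g x| `^ p) / (dist_compl Omega x `^ p))%:E <=
     \int[lebesgue_rV n.+1]_(x in Omega) (enorm (gradient g x) `^ p)%:E)%E) ->
  C <= ((p - 1) / p) `^ p.
Proof.
move=> oO [y bdy] mc p1 hC; rewrite leNgt; apply/negP => cC.
set c := ((p - 1) / p) `^ p in cC.
have p0 : 0 < p by exact: lt_trans p1.
have C0 : 0 < C by rewrite (le_lt_trans _ cC)// powR_ge0.
have compl0 : ~` Omega !=set0.
  by exists y; case: bdy => _; move/interior_id : oO => ->.
have [_ [_ [Q [phi [gr grad0 _]]] _] _] := mc y bdy.
have [i nui] := normal_dir_neq0 gr.
have al0 : 0 < (p - 1) / p by rewrite divr_gt0// subr_gt0.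
have al1 : (p - 1) / p <= 1 by rewrite ler_pdivrMr// mul1r; lra.
have [K K0 profile] := smooth_profile al0 al1.
set K2 := (K + 1) `^ p.
have K20 : 0 <= K2 by exact: powR_ge0.
have ln20 : 0 < ln 2 :> R by rewrite ln_gt0// ltr1n.
pose M := K2 * (2 * ln 2).
have M0 : 0 <= M by rewrite mulr_ge0// mulr_ge0// ltW.
have D0 : 0 < C - c by rewrite subr_gt0.
(* [M] is the cost of the bottom and top layers, and [s] and [eta] will cost at most [1] each;
   [(C - c) * L = M + 3] exceeds the total. *)
pose L := (M + 3) / (C - c).
have L0 : 0 < L by rewrite divr_gt0//; lra.
have LE : (C - c) * L = M + 3 by rewrite mulrC divfK// gt_eqF.
(* The total coefficient of [(1 + s)^n - 1] in the final inequality; [s] makes its contribution at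
   most [1]. *)
pose N := M + K2 * (L + 2 * ln 2).
have N0 : 0 <= N by rewrite addr_ge0// mulr_ge0// addr_ge0 ?(ltW L0)// mulr_ge0// ltW.
have T0 : 0 < 3 ^+ n :> R by rewrite exprn_gt0.
pose s := Num.min 1 ((N + 1) * 3 ^+ n)^-1.
have NT0 : 0 < (N + 1) * 3 ^+ n by rewrite mulr_gt0//; lra.
have s0 : 0 < s by rewrite lt_min ltr01 invr_gt0.
have s1 : s <= 1 by rewrite ge_min lexx.
have sN : N * ((1 + s) ^+ n - 1) <= 1.
  apply: (@le_trans _ _ (N * (s * 3 ^+ n))).
    by rewrite ler_wpM2l// exprn_1D_le// ltW.
  have : s * ((N + 1) * 3 ^+ n) <= 1.
    by rewrite -ler_pdivlMr// mul1r ge_min lexx orbT.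
  have : 0 <= s * 3 ^+ n by rewrite mulr_ge0 ?(ltW T0)// ltW.
  by move: (3 ^+ n) => T; lra.
have CpL : 0 < C * p * L by exact: mulr_gt0 (mulr_gt0 C0 p0) L0.
(* Since [(1 + eta)^(- p) >= 1 - p * eta], this choice costs the left-hand side at most [1]. *)
pose eta := Num.min (1 / 2) (C * p * L)^-1.
have eta0 : 0 < eta by rewrite lt_min divr_gt0//= invr_gt0.
have eta1 : eta < 1.
  by apply: (@le_lt_trans _ _ (1 / 2)); [rewrite ge_min lexx|lra].
have etaC : C * p * L * eta <= 1.
  by rewrite mulrC -ler_pdivlMr// mul1r ge_min lexx orbT.
have [psi [dpsi [A A0 [psi_smooth dpsiP psi01 dpsiA [psi1 dpsi0 psi0]]]]] :=
  smooth_cutoff s0 s1.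
have nA : 0 <= n%:R * A by rewrite mulr_ge0// ltW.
(* Small enough for the thinness condition on [2 * b], and at most [1 / 2], so that heights up to
   [2 * b] stay below [2 * rho]. *)
pose k := (2 * (n%:R * A + 1))^-1.
have k0 : 0 < k by rewrite invr_gt0 mulr_gt0// ltr_wpDl.
have kE : k * (2 * (n%:R * A + 1)) = 1 by rewrite /k mulVf// gt_eqF// -invr_gt0.
have knA : 0 <= k * (n%:R * A) by rewrite mulr_ge0// ltW.
(* The ratio [a / rho] for which [ln b - ln (2 * a) = L]. It precedes [rho], because the region near
   the boundary depends on this lower cut. *)
pose h := k * expR (- L) / 2.
have h0 : 0 < h by rewrite divr_gt0// mulr_gt0// expR_gt0.
have [rho rho0 region] := region_near_boundary oO bdy gr grad0 nui eta0 eta1 h0.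
pose b := k * rho; pose a := h * rho.
have b0 : 0 < b by rewrite mulr_gt0.
have a0 : 0 < a by rewrite mulr_gt0.
have a2 : 2 * a = b * expR (- L).
  by rewrite /a /h mulrA [2 * _]mulrC divfK ?pnatr_eq0// mulrAC.
have ab : 2 * a < b by rewrite a2 gtr_pMr// -expR0 ltr_expR oppr_lt0.
have lnab : ln b - ln (2 * a) = L.
  by rewrite a2 (@lnM _ b) ?posrE ?expR_gt0// expRK opprD opprK addrA subrr add0r.
have [u [du [u_smooth duP u_off u_le [u_eq du_eq]]]] := profile a b a0 ab.
have reg x : a <= dot (x - y) (normal_dir Q) <= 2 * b ->
    (forall l, `|(x - y) 0 (lift i l)| <= 2 * rho) ->
    Omega x /\ dist_compl Omega x <= (1 + eta) * dot (x - y) (normal_dir Q).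
  move=> /andP[h1 h2] h3; apply: region => //; rewrite (le_trans h2)//.
  by rewrite /b mulrA ler_wpM2r ?(ltW rho0)//; lra.
have bs : 2 * b * (n%:R * (A / rho)) <= 1.
  have -> : 2 * b * (n%:R * (A / rho)) = 2 * (k * (n%:R * A)).
    by rewrite /b; field; rewrite gt_eqF.
  by lra.
have := almost_extremal_quotient p1 (enorm_normal_dir gr) nui oO compl0 eta0 s0 s1
  a0 ab rho0 K0 A0 reg bs u_smooth duP u_off u_le u_eq du_eq psi_smooth dpsiP psi01
  dpsiA psi1 dpsi0 psi0 (ltW C0) hC.
rewrite lnab -/c -/K2 -/M.
have T : 1 - p * eta <= (1 + eta) `^ (- p).
  have e1 : 0 < 1 + eta by rewrite ltr_pwDl// ltW.
  have Np : - p <= 0 by rewrite oppr_le0 ltW.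
  have := powR_tangent_neg Np ltr01 e1.
  by rewrite !powR1 mulr1 (addrC 1 eta) addrK mulNr.
have : C * L * (1 - p * eta) <= C * L * (1 + eta) `^ (- p).
  by rewrite ler_wpM2l// mulr_ge0// ltW.
move: sN; rewrite /N; move: ((1 + s) ^+ n) ((1 + eta) `^ (- p)) => X E; lra.
Qed.

Theorem theorem1p2 (R : realType) (n : nat) (Omega : set 'rV[R]_n.+1) (p : R)
    (hn : (1 <= n)%N)
    (Omega_open : open Omega) (Omega_connected : connected Omega)
    (boundary_nonempty : boundary Omega !=set0)
    (Omega_C2 : C2_boundary Omega)
    (Omega_mean_convex : weakly_mean_convex Omega)
    (hp : 1 < p) :
  let c : R := ((p - 1) / p) `^ p in
  let energy (f : 'rV[R]_n.+1 -> R) : \bar R :=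
    (\int[lebesgue_rV n.+1]_(x in Omega) (enorm (gradient f x) `^ p)%:E)%E in
  let hardy (f : 'rV[R]_n.+1 -> R) : \bar R :=
    (\int[lebesgue_rV n.+1]_(x in Omega)
       ((`|f x| `^ p) / (dist_compl Omega x `^ p))%:E)%E in
  [/\ forall f, test_function Omega f -> (c%:E * hardy f <= energy f)%E,
      forall C : R,
        (forall f, test_function Omega f -> (C%:E * hardy f <= energy f)%E) ->
        C <= c
    & forall f, test_function Omega f ->
        (exists x, f x != 0) -> energy f <> (c%:E * hardy f)%E ].
Proof.
move=> c energy hardy.
have compl0 : ~` Omega !=set0.
  have [y [_ Oy]] := boundary_nonempty; exists y.
  by move: Oy; move/interior_id : Omega_open => ->.
split=> [f tf|C hC|f tf f0 eq_f].
- exact: (hardy_inequality hn Omega_open compl0 Omega_mean_convex hp tf).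
- exact: (hardy_constant_le Omega_open boundary_nonempty Omega_mean_convex hp hC).
have := hardy_inequality_strict hn Omega_open compl0 Omega_mean_convex hp tf f0.
by rewrite -[X in (_ < X)%E]/(energy f) eq_f ltxx.
Qed.
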